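(* Let $(\Omega,\mathcal A,\mathrm P)$ be a probability space, $(T,d)$ be a compact metric space, $(X_t)_{t\in T}$ be a Gaussian process on $(\Omega,\mathcal A,\mathrm P)$ with continuous paths, mean function $m(t)=\mathbb E X_t$ and covariance function $k(t_1,t_2)=\operatorname{cov}(X_{t_1},X_{t_2})$, and let $X:\Omega\to C(T)$ be the Gaussian random variable associated to the process, i.e. $X(\omega)=(t\mapsto X_t(\omega))$. For closed $S\subset T$ let $Y:=X_{|S}$, i.e. $Y:\Omega\to C(S)$, $Y(\omega):=(X(\omega))_{|S}$. Finally, let $S_\infty\subset S$ be countable and dense with enumeration $S_\infty=\{s_i:i\ge1\}$, and write $S_n:=\{s_1,\dots,s_n\}$ for all $n\ge1$. Then for every version $\mathrm P_{X|Y}(\cdot|\cdot):\mathfrak B(C(T))\times C(S)\to[0,1]$ of the regular conditional probability of $X$ given $Y$ there exists an $N\in\mathfrak B(C(S))$ with $\mathrm P_Y(N)=0$ such that for all $g\in C(S)\setminus N$ we have $$\mathrm P_{X|Y}(\cdot|g)=\mathcal N\bigl(m_{X|Y=g},k_{X|Y}\bigr),$$ where the mean and covariance functions are given by $$m_{X|Y=g}(t)=m(t)+\lim_{n\to\infty}K_{t,S_n}K_{S_n,S_n}^\dagger\bigl(g(S_n)-m(S_n)\bigr),$$ $$k_{X|Y}(t_1,t_2)=k(t_1,t_2)-\lim_{n\to\infty}K_{t_1,S_n}K_{S_n,S_n}^\dagger K_{S_n,t_2},$$ and the convergence is uniform in $t\in T$, respectively in $t_1,t_2\in T$. Moreover,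 for all $g\in C(S)\setminus N$, $s\in S$, and $t\in T$ we have $$m_{X|Y=g}(s)=g(s)\qquad\text{and}\qquad k_{X|Y}(s,t)=0.$$
   Context: $C(T)$ is the Banach space of continuous functions $T\to\mathbb R$ with the supremum norm, and $\mathfrak B(\cdot)$ denotes the Borel $\sigma$-algebra. A Gaussian process $(X_t)_{t\in T}$ is a family of random variables such that $(X_{t_1},\dots,X_{t_n})$ is a (possibly degenerate) Gaussian vector for all $n$ and $t_1,\dots,t_n\in T$; it has continuous paths if $t\mapsto X_t(\omega)$ is continuous for every $\omega$. Gaussian processes with continuous paths correspond one-to-one to $C(T)$-valued Gaussian random variables (random variables $X$ such that $x'\circ X$ is real Gaussian for every $x'\in C(T)'$) via $X(\omega)(t)=X_t(\omega)$. $\mathcal N(m,k)$ denotes the (unique) Gaussian measure on $C(T)$ that is the distribution of a $C(T)$-valued Gaussian random variable whose associated process has mean function $m$ and covariance function $k$. For finite tuples $R=\{r_1,\dots,r_p\}$, $S=\{s_1,\dots,s_n\}$ of points of $T$: $K_{R,S}:=(k(r_i,s_j))_{i,j}\in\mathbb R^{p\times n}$, $K_{r,S}:=K_{\{r\},S}$, $K_{S,s}:=K_{S,\{s\}}$, and for a function $f$, $f(S):=(f(s_1),\dots,f(s_n))\in\mathbb R^n$. $A^\dagger$ is the Moore–Penrose pseudo-inverse of a matrix $A$. A version of the regular conditional probability of $X:\Omega\to E$ given $Y:\Omega\to F$ ($E,F$ separable Banach spaces) is a map $\mathrm P_{X|Y}(\cdot|\cdot):\mathfrak B(E)\times F\to[0,1]$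 such that $\mathrm P_{X|Y}(\cdot|y)$ is a probability measure for all $y\in F$, $\mathrm P_{X|Y}(B|\cdot)$ is measurable for all $B\in\mathfrak B(E)$, and $\mathrm P(X\in B,Y\in A)=\int_A\mathrm P_{X|Y}(B|y)\,d\mathrm P_Y(y)$ for all $B\in\mathfrak B(E)$, $A\in\mathfrak B(F)$, where $\mathrm P_Y$ is the distribution of $Y$. *)

(* Defs.v *)
From HB Require Import structures.
From mathcomp Require Import all_boot all_order all_algebra.
From mathcomp Require Import all_classical all_reals all_analysis.
From mathcomp Require Import measurable_realfun.

Set Implicit Arguments.
Unset Strict Implicit.
Unset Printing Implicit Defensive.

Import Order.TTheory GRing.Theory Num.Theory.
Import numFieldNormedType.Exports.

Local Open Scope classical_set_scope.
Local Open Scope ring_scope.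

(* The Banach space C(T). The compactness proof is a parameter of the type so
   that the supremum norm can be a canonical structure. *)
Definition cspace (R : realType) (T : topologicalType)
  (cT : compact [set: T]) : Type := continuousType T R.

HB.instance Definition _ (R : realType) (T : topologicalType)
  (cT : compact [set: T]) := Choice.on (cspace R cT).

Section cspace_lmodule.
Context (R : realType) (T : topologicalType) (cT : compact [set: T]).
Local Notation C := (cspace R cT).
Implicit Types f g h : C.

Lemma cspaceP f g : f =1 g -> f = g.
Proof. by move=> fg; apply/continuousEP. Qed.

Definition mkcspace (f : T -> R) (cf : continuous f) : C := mkcts cf.

Lemma cspace_continuous f : continuous f.
Proof. exact: cts_fun. Qed.

Let cstC (c : R) : continuous (fun _ : T => c).
Proof. by move=> x; exact: cvg_cst. Qed.

Let addC_cont f g : continuous (fun t => f t + g t).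
Proof. by move=> x; apply: cvgD; exact: cspace_continuous. Qed.

Let oppC_cont f : continuous (fun t => - f t).
Proof. by move=> x; apply: cvgN; exact: cspace_continuous. Qed.

Let scaleC_cont (a : R) f : continuous (fun t => a * f t).
Proof. by move=> x; apply: cvgM; [exact: cvg_cst|exact: cspace_continuous]. Qed.

Let czero : C := mkcspace (@cstC 0).
Let cadd f g : C := mkcspace (@addC_cont f g).
Let copp f : C := mkcspace (@oppC_cont f).
Let cscale (a : R) f : C := mkcspace (@scaleC_cont a f).

Let caddA : associative cadd.
Proof. by move=> f g h; apply: cspaceP => t /=; exact: addrA. Qed.

Let caddC : commutative cadd.
Proof. by move=> f g; apply: cspaceP => t /=; exact: addrC. Qed.

Let cadd0 : left_id czero cadd.
Proof. by move=> f; apply: cspaceP => t /=; exact: add0r. Qed.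

Let caddN : left_inverse czero copp cadd.
Proof. by move=> f; apply: cspaceP => t /=; exact: addNr. Qed.

HB.instance Definition _ := GRing.isZmodule.Build C caddA caddC cadd0 caddN.

Let cscaleA (a b : R) f : cscale a (cscale b f) = cscale (a * b) f.
Proof. by apply: cspaceP => t /=; exact: mulrA. Qed.

Let cscale1 : left_id 1 cscale.
Proof. by move=> f; apply: cspaceP => t /=; exact: mul1r. Qed.

Let cscaleDr : right_distributive cscale +%R.
Proof. by move=> a f g; apply: cspaceP => t /=; exact: mulrDr. Qed.

Let cscaleDl f : {morph cscale^~ f : a b / a + b}.
Proof. by move=> a b; apply: cspaceP => t /=; exact: mulrDl. Qed.

HB.instance Definition _ :=
  GRing.Zmodule_isLmodule.Build R C cscaleA cscale1 cscaleDr cscaleDl.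

Lemma cspaceDE f g t : (f + g) t = f t + g t. Proof. by []. Qed.
Lemma cspaceNE f t : (- f) t = - f t. Proof. by []. Qed.
Lemma cspaceBE f g t : (f - g) t = f t - g t. Proof. by []. Qed.
Lemma cspace0E t : (0 : C) t = 0. Proof. by []. Qed.
Lemma cspaceZE a f t : (a *: f) t = a * f t. Proof. by []. Qed.

Definition cnorm f : R := sup [set `|f t| | t in [set: T]].

Lemma cspace_has_ubound f : has_ubound [set `|f t| | t in [set: T]].
Proof.
have /compact_bounded[M [_ /(_ (M + 1))]] : compact (f @` [set: T]).
  apply: continuous_compact => //; apply: continuous_subspaceT.
  exact: cspace_continuous.
rewrite ltrDl ltr01 => /(_ isT) fM; exists (M + 1) => _ [t _ <-].
by apply: fM; exists t.
Qed.

Lemma le_cnorm f t : `|f t| <= cnorm f.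
Proof. by apply: ub_le_sup; [exact: cspace_has_ubound|exists t]. Qed.

Lemma cnorm_le f (M : R) : 0 <= M -> (forall t, `|f t| <= M) -> cnorm f <= M.
Proof.
move=> M0 fM; rewrite /cnorm.
have [->|/set0P ne] := eqVneq [set `|f t| | t in [set: T]] set0.
  by rewrite sup0.
by apply: ge_sup => // _ [t _ <-].
Qed.

Lemma cnorm_ge0 f : 0 <= cnorm f.
Proof.
rewrite /cnorm.
have [->|/set0P[_ [t _ _]]] := eqVneq [set `|f t| | t in [set: T]] set0.
  by rewrite sup0.
exact: le_trans (normr_ge0 (f t)) (le_cnorm f t).
Qed.

Let cnormD f g : cnorm (f + g) <= cnorm f + cnorm g.
Proof.
apply: cnorm_le => [|t]; first by rewrite addr_ge0 ?cnorm_ge0.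
by rewrite (le_trans (ler_normD _ _))// lerD ?le_cnorm.
Qed.

Let cnormZ (a : R) f : cnorm (a *: f) = `|a| * cnorm f.
Proof.
have le b h : cnorm (b *: h) <= `|b| * cnorm h.
  apply: cnorm_le => [|t]; first by rewrite mulr_ge0 ?cnorm_ge0.
  by rewrite cspaceZE normrM ler_wpM2l ?le_cnorm.
apply/eqP; rewrite eq_le le/=.
have [->|a0] := eqVneq a 0; first by rewrite normr0 mul0r cnorm_ge0.
rewrite -ler_pdivlMl ?normr_gt0// -normfV.
by have := le a^-1 (a *: f); rewrite scalerA mulVf// scale1r.
Qed.

Let cnorm0 f : cnorm f = 0 -> f = 0.
Proof.
move=> f0; apply: cspaceP => t; rewrite cspace0E.
by apply/eqP; rewrite -normr_le0 -f0 le_cnorm.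
Qed.

HB.instance Definition _ := Lmodule_isNormed.Build R C cnormD cnormZ cnorm0.

Lemma cspace_normE f : `|f| = sup [set `|f t| | t in [set: T]].
Proof. by []. Qed.

Lemma cspace_complete (F : set_system C) :
  ProperFilter F -> cauchy F -> cvg F.
Proof.
move=> FF /cauchyP Fc.
pose G : set_system (arrow_uniform_type T R) :=
  (fun f : C => (f : arrow_uniform_type T R)) @ F.
have GF : ProperFilter G by exact: fmap_proper_filter.
have Gc : cauchy G.
  apply/cauchyP => e e0; have [f Ff] := Fc e e0.
  exists (f : arrow_uniform_type T R).
  apply: (@filterS C F _ (ball f e)) Ff => g fg t.
  rewrite -ball_normE /= in fg.
  by apply: le_lt_trans fg; exact: (le_cnorm (f - g) t).
have /cvg_ex[l Gl] := @cauchy_cvg (arrow_uniform_type T R) G GF Gc.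
have lc : continuous (l : T -> R).
  apply: (@uniform_limit_continuous _ _ (G : set_system (T -> R))).
  - by apply: (@nearW _ F) => f; exact: cspace_continuous.
  - by move=> A; rewrite uniform_nbhsT; exact: Gl.
apply/cvg_ex; exists (mkcspace lc).
apply/cvgrPdist_le => e e0.
have Fl := Gl _ (nbhsx_ballx l e e0).
apply: (@filterS C F _ _ _ _ Fl) => f lf.
apply: cnorm_le => [|t]; first exact: ltW.
by have := lf t; exact: ltW.
Qed.

HB.instance Definition _ := Uniform_isComplete.Build C cspace_complete.

End cspace_lmodule.

Lemma compact_set_type (T : topologicalType) (S : set T) :
  compact S -> compact [set: S].
Proof.
move=> cS F FF _.
pose G := (set_val : S -> T) @ F.
have GF : ProperFilter G by exact: fmap_proper_filter.
have GS : G S by apply: (@filterE _ F) => -[x Sx]; exact: set_mem.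
have [p [Sp clp]] := cS G GF GS.
exists (@exist _ (fun x => x \in S) p (mem_set Sp)); split => // A B FA.
move=> [B0 [[V oV <-] /= Vp VB]].
have [] := clp (set_val @` A) V.
- by apply: (@filterS _ F _ A) FA => x Ax; exists x.
- exact: open_nbhs_nbhs.
by move=> _ [[x Ax <-] Vx]; exists x; split => //; exact: VB.
Qed.

Lemma closed_compact_set_type (T : topologicalType) (S : set T) :
  compact [set: T] -> closed S -> compact [set: S].
Proof.
by move=> cT clS; apply: compact_set_type; exact: subclosed_compact cT _.
Qed.

Notation borel E := (g_sigma_algebraType (@open E)).

Lemma continuous_borel (R : realType) (E F : normedModType R) (f : E -> F) :
  continuous f ->
  measurable_fun [set: borel E] (f : borel E -> borel F).
Proof.
move=> /continuousP cf.
apply: (@measurability _ _ (borel E) (borel F) setT f (@open F)) => // _ [A oA <-].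
by rewrite setTI; apply: sub_sigma_algebra; exact: cf.
Qed.

Section restriction.
Context (R : realType) (T : topologicalType) (cT : compact [set: T])
  (S : set T) (clS : closed S).
Let cS := closed_compact_set_type cT clS.

Let restriction_cont (f : cspace R cT) :
  continuous (fun t : S => f (\val t)).
Proof.
move=> x; apply: (@continuous_comp _ _ _ (set_val : S -> T) f).
  exact: initial_continuous.
exact: cspace_continuous.
Qed.

Definition restriction (f : cspace R cT) : cspace R cS :=
  mkcspace cS (@restriction_cont f).

Lemma continuous_restriction : continuous restriction.
Proof.
move=> f; apply/(@cvgrPdist_le _ _ _ (nbhs f)) => e e0.
have /cvgrPdist_le/(_ e e0) : id x @[x --> f] --> f by exact: cvg_id.
apply: filterS => g fg; apply: cnorm_le => [|t]; first exact: ltW.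
exact: le_trans (le_cnorm (f - g) (\val t)) fg.
Qed.

Lemma measurable_restriction :
  measurable_fun [set: borel (cspace R cT)]
    (restriction : borel (cspace R cT) -> borel (cspace R cS)).
Proof.
exact: (@continuous_borel R (cspace R cT) (cspace R cS) restriction
  continuous_restriction).
Qed.

End restriction.

Lemma countable_bigcup_measurable d (T : measurableType d) (I : Type)
    (A : set I) (F : I -> set T) :
  countable A -> (forall i, A i -> measurable (F i)) ->
  measurable (\bigcup_(i in A) F i).
Proof.
move=> /pfcard_geP[->|[f]] mF; first by rewrite bigcup_set0.
rewrite (_ : \bigcup_(i in A) F i = \bigcup_n F (f n)).
  by apply: bigcupT_measurable => n; apply: mF; exact: funS.
apply/seteqP; split=> [t [i Ai Fi]|t [n _ Fn]].
  by have [n _ fn] := @surj _ _ _ _ f i Ai; exists n => //; rewrite fn.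
by exists (f n) => //; exact: funS.
Qed.

Section process.
Context (R : realType) (T : metricType R) (cT : compact [set: T]).
Local Notation C := (cspace R cT).

Lemma compact_net (e : R) : 0 < e ->
  exists s : seq T, forall t, exists2 x, x \in s & ball x e t.
Proof.
move=> e0.
have [F FF FE] : exists2 F : set_system (seq T), ProperFilter F &
    forall x, F [set s | x \in s].
  exists (filter_from setT (fun s : seq T => [set s' | {subset s <= s'}])).
    apply: filter_from_proper; last by move=> s _; exists s.
    apply: filter_from_filter; first by exists [::].
    move=> s1 s2 _ _; exists (s1 ++ s2) => // s /= h.
    by split=> x xs; apply: h; rewrite mem_cat xs// orbT.
  by move=> x; exists [:: x] => // s /= h; apply: h; rewrite mem_head.
have /compact_near_coveringP := cT.
move=> /(_ _ F (fun s t => exists2 x, x \in s & ball x e t) _).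
have cov : forall x, [set: T] x -> \forall x' \near x & s \near F,
    exists2 y, y \in s & ball y e x'.
  move=> x _; exists (ball x e, [set s | x \in s]) => /=.
    by split; [exact: nbhsx_ballx|exact: FE].
  by move=> [y s] /= [xy xs]; exists x.
move=> /(_ cov) h; have [s hs] := @filter_ex _ F _ _ h.
by exists s => t; exact: hs.
Qed.

Lemma cspace_unif (f : C) (e : R) : 0 < e ->
  exists n : nat, forall x y : T, ball x n.+1%:R^-1 y -> `|f x - f y| <= e.
Proof.
move=> e0.
have /compact_near_coveringP := cT.
move=> /(_ _ \oo (fun n x => forall y, ball x n.+1%:R^-1 y -> `|f x - f y| <= e) _).
have cov : forall x, [set: T] x -> \forall x' \near x & n \near \oo,
    forall y, ball x' n.+1%:R^-1 y -> `|f x' - f y| <= e.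
  move=> x _.
  have := @cspace_continuous R T cT f x.
  move=> /cvgrPdist_le/(_ (e / 2) (divr_gt0 e0 (ltr0Sn R 1))).
  move=> /nbhs_ballP[r /= r0 rf].
  exists (ball x (r / 2), [set n : nat | n.+1%:R^-1 < r / 2]) => /=.
    split; first by apply: nbhsx_ballx; rewrite divr_gt0.
    exact: near_infty_natSinv_lt (PosNum (divr_gt0 r0 (ltr0Sn R 1))).
  move=> [y n] /= [xy nr] z yz.
  rewrite (splitr e) (le_trans (ler_distD (f x) _ _))// lerD//.
    rewrite distrC; apply: rf; apply: le_ball xy.
    by rewrite ler_pdivrMr// ler_peMr ?(ltW r0)// (ler1n _ 2).
  apply: rf; rewrite (splitr r); apply: ball_triangle xy _.
  by apply: le_ball yz; exact: ltW.
move=> /(_ cov) h; have [n hn] := @filter_ex _ \oo _ _ h.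
by exists n => x; exact: hn.
Qed.

Let net (n : nat) : seq T :=
  sval (cid (@compact_net n.+1%:R^-1 (ltac:(by rewrite invr_gt0)))).

Let netP n t : exists2 i, (i < size (net n))%N &
  forall x0, ball (nth x0 (net n) i) n.+1%:R^-1 t.
Proof.
rewrite /net; case: cid => s /= /(_ t)[x xs xt].
by exists (index x s) => [|x0]; rewrite ?index_mem ?nth_index.
Qed.

Let D : set T := \bigcup_n [set` net n].

Let countableD : countable D.
Proof. by apply: bigcup_countable => // n _; exact/finite_set_countable/finite_seq. Qed.

Let denseD (f : C) (M : R) (t : T) (c : R) r : 0 < r ->
  (forall x, D x -> ball x r t -> `|f x - c| <= M) -> `|f t - c| <= M.
Proof.
move=> r0 fM; apply/ler_addgt0Pr => e e0.
have [n fn] := cspace_unif f e0.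
have [m [mn mr]] : exists m, m.+1%:R^-1 <= n.+1%:R^-1 :> R /\ m.+1%:R^-1 <= r.
  have [N _ /(_ N)/(_ (leqnn _)) /= Nr] := near_infty_natSinv_lt (PosNum r0).
  exists (maxn n N); split; last apply: le_trans (ltW Nr).
    by rewrite lef_pV2 ?posrE// ler_nat ltnS leq_maxl.
  by rewrite lef_pV2 ?posrE// ler_nat ltnS leq_maxr.
have [i im /(_ t) it] := netP m t.
set x := nth t (net m) i in it.
rewrite [leRHS]addrC (le_trans (ler_distD (f x) _ _))// lerD//.
  by rewrite distrC; apply: fn; exact: le_ball it.
apply: fM; last exact: le_ball it.
by exists m => //=; exact: mem_nth.
Qed.

Let V (i : nat * seq rat * nat) : set C :=
  [set f | forall j x, (j < size (net i.1.1))%N -> D x ->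
     ball (nth x (net i.1.1) j) i.1.1.+1%:R^-1 x ->
     `|f x - ratr (nth 0 i.1.2 j)| <= i.2.+1%:R^-1].

Let V_diam i (f g : C) : V i f -> V i g -> `|f - g| <= i.2.+1%:R^-1 *+ 2.
Proof.
move=> Vf Vg; have k0 : (0 : R) < i.2.+1%:R^-1 by rewrite invr_gt0.
apply: cnorm_le => [|t]; first by rewrite mulrn_wge0// ltW.
have [j js /(_ t)] := netP i.1.1 t; set y := nth _ _ _ => yt.
have [r [r0 rt]] : exists r : R, 0 < r /\
    forall x, ball t r x -> ball y i.1.1.+1%:R^-1 x.
  move: yt; rewrite ballEmdist /= => yt.
  exists (i.1.1.+1%:R^-1 - mdist y t); split; first by rewrite subr_gt0.
  move=> x; rewrite !ballEmdist/= ltrBrDl.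
  exact/le_lt_trans/metric_triangle.
have bd h : V i h -> `|h t - ratr (nth 0 i.1.2 j)| <= i.2.+1%:R^-1.
  move=> Vh; apply: (denseD r0) => x Dx /ball_sym xt; apply: Vh => //.
  by rewrite (set_nth_default t)//; apply: rt.
rewrite cspaceBE (le_trans (ler_distD (ratr (nth 0 i.1.2 j)) _ _))//.
by rewrite mulr2n lerD ?bd// distrC bd.
Qed.

Let V_cover (f : C) k : exists n q, V (n, q, k) f.
Proof.
have k2 : (0 : R) < k.+1%:R^-1 / 2 by rewrite divr_gt0.
have [n fn] := cspace_unif f k2; exists n.
have rx x : exists q : rat, `|f x - ratr q| <= k.+1%:R^-1 / 2.
  have : f x < f x + k.+1%:R^-1 / 2 by rewrite ltrDl.
  move=> /rat_in_itvoo[q]; rewrite in_itv/= => /andP[xq qx]; exists q.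
  by rewrite distrC ger0_norm ?subr_ge0 ?(ltW xq)// lerBlDl ltW.
exists [seq sval (cid (rx x)) | x <- net n] => j x /= jn Dx xn.
rewrite (nth_map x)//; case: cid => q /= hq.
rewrite (splitr _^-1) (le_trans (ler_distD (f (nth x (net n) j)) _ _))// lerD//.
by rewrite distrC; exact: fn.
Qed.

Let open_bigcupV (U : set C) : open U ->
  U = \bigcup_(i in [set i | V i `<=` U]) V i.
Proof.
move=> oU; apply/seteqP; split=> [f Uf|f [i iU Vf]]; last exact: iU.
have /nbhs_ballP[r /= r0 rU] : nbhs f U by exact: open_nbhs_nbhs.
have [k _ /(_ k)/(_ (leqnn _)) /= kr] :=
  near_infty_natSinv_lt (PosNum (divr_gt0 r0 (ltr0Sn R 1))).
have [n [q Vf]] := V_cover f k; exists (n, q, k) => //= g Vg; apply: rU.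
rewrite -ball_normE /=; apply: le_lt_trans (V_diam Vf Vg) _ => /=.
by rewrite (splitr r) mulr2n ltrD.
Qed.

(* By separability of C(T), Borel measurability only needs to be checked on
   point evaluations. *)
Lemma measurable_cspace d (Omega : measurableType d) (X : Omega -> C) :
  (forall t, measurable_fun [set: Omega] (fun w => X w t)) ->
  measurable_fun [set: Omega] (X : Omega -> borel C).
Proof.
move=> mX.
apply: (@measurability _ _ Omega (borel C) setT X (@open C)) => // _ [U oU <-].
rewrite setTI (open_bigcupV oU) preimage_bigcup.
apply: countable_bigcup_measurable => // -[[n q] k] _.
rewrite -[X in measurable X]setCK; apply: measurableC.
rewrite (_ : ~` _ = \bigcup_(j in `I_(size (net n)))
    \bigcup_(x in D `&` [set x | ball (nth x (net n) j) n.+1%:R^-1 x])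
      [set w | k.+1%:R^-1 < `|X w x - ratr (nth 0 q j)|]); last first.
  apply/seteqP; split=> [w /= nV|w [j jn [x [Dx xn] /= lt]] /= Vw].
    apply: contrapT => h; apply: nV => j x jn Dx xn.
    by rewrite leNgt; apply/negP => lt; apply: h; exists j => //; exists x.
  by have := Vw j x jn Dx xn; rewrite leNgt lt.
apply: bigcup_measurable => j _; apply: countable_bigcup_measurable.
  by apply: sub_countable countableD; apply: subset_card_le; exact: subIsetl.
move=> x _; set c := _^-1; set a := ratr _.
have mXa : measurable_fun [set: Omega] (fun w => `|X w x - a|).
  by apply: measurableT_comp => //; exact: measurable_funB.
have := mXa measurableT `]c, +oo[%classic (measurable_itv _).
rewrite setTI; congr measurable; apply/seteqP.
by split=> w /=; rewrite in_itv/= andbT.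
Qed.

End process.

Section moore_penrose.
Context (F : realFieldType) (m n : nat).
Implicit Types (A : 'M[F]_(m, n)) (X Y : 'M[F]_(n, m)).

Definition is_moore_penrose A X :=
  [/\ A *m X *m A = A, X *m A *m X = X,
      (A *m X)^T = A *m X & (X *m A)^T = X *m A].

Lemma moore_penrose_uniq A X Y :
  is_moore_penrose A X -> is_moore_penrose A Y -> X = Y.
Proof.
move=> [x1 x2 x3 x4] [y1 y2 y3 y4].
have AXY : A *m X = A *m Y.
  rewrite -x3 -[in LHS]y1 -[A *m Y *m A *m X]mulmxA trmx_mul x3 y3.
  by rewrite mulmxA x1.
have XYA : X *m A = Y *m A.
  rewrite -x4 -[in LHS]y1 !mulmxA -mulmxA trmx_mul y4 x4.
  by rewrite mulmxA -[Y *m A *m X *m A]mulmxA -mulmxA [A *m (X *m A)]mulmxA x1.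
by rewrite -x2 -mulmxA AXY mulmxA XYA y2.
Qed.
End moore_penrose.

Lemma gram_unit (F : realFieldType) (r n : nat) (B : 'M[F]_(r, n)) :
  row_free B -> B *m B^T \in unitmx.
Proof.
move=> fB; rewrite -row_free_unit; apply/row_freeP.
have : kermx (B *m B^T) = 0.
  apply/row_matrixP => i; rewrite row0; set v := row i _.
  have v0 : v *m (B *m B^T) = 0.
    by rewrite -row_mul mulmx_ker row0.
  have w0 : (v *m B) *m (v *m B)^T = 0.
    by rewrite trmx_mul mulmxA -(mulmxA v) v0 mul0mx.
  have : v *m B = 0.
    apply/rowP => j; rewrite mxE [RHS]mxE.
    move/matrixP : w0 => /(_ 0 0); rewrite !mxE => /eqP.
    rewrite psumr_eq0 => [/allP/(_ j (mem_index_enum _))|k _].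
      by rewrite !mxE mulf_eq0 orbb => /eqP.
    by rewrite [X in _ * X]mxE -expr2 sqr_ge0.
  by move/eqP; rewrite mulmx_free_eq0// => /eqP.
move/eqP; rewrite kermx_eq0 => /row_freeP[D BD].
by exists D.
Qed.

Lemma moore_penrose_ex (F : realFieldType) (m n : nat) (A : 'M[F]_(m, n)) :
  exists X, is_moore_penrose A X.
Proof.
have [r [C [B [-> fB fC]]]] : exists r (C : 'M[F]_(m, r)) (B : 'M[F]_(r, n)),
    [/\ A = C *m B, row_free B & row_free C^T].
  exists (\rank A), (col_base A), (row_base A).
  rewrite mulmx_base row_base_free; split=> //.
  by rewrite /row_free mxrank_tr; exact: col_base_full.
have uB : B *m B^T \in unitmx by exact: gram_unit.
have uC : C^T *m C \in unitmx.
  by rewrite -[Y in _ *m Y]trmxK; exact: gram_unit.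
pose X := B^T *m invmx (B *m B^T) *m (invmx (C^T *m C) *m C^T).
have AX : C *m B *m X = C *m invmx (C^T *m C) *m C^T.
  by rewrite /X !mulmxA -[C *m B *m B^T]mulmxA mulmxK.
have XA : X *m (C *m B) = B^T *m invmx (B *m B^T) *m B.
  by rewrite /X !mulmxA -[_ *m C^T *m C]mulmxA mulmxKV.
exists X; split.
- by rewrite AX !mulmxA -[_ *m C^T *m C]mulmxA mulmxKV.
- by rewrite XA /X !mulmxA -[_ *m B *m B^T]mulmxA mulmxKV.
- by rewrite AX !trmx_mul trmx_inv trmx_mul !trmxK mulmxA.
- by rewrite XA !trmx_mul trmx_inv trmx_mul !trmxK mulmxA.
Qed.

Definition moore_penrose (F : realFieldType) (m n : nat) (A : 'M[F]_(m, n)) :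
  'M[F]_(n, m) := sval (cid (moore_penrose_ex A)).

Lemma moore_penroseP (F : realFieldType) (m n : nat) (A : 'M[F]_(m, n)) :
  is_moore_penrose A (moore_penrose A).
Proof. exact: svalP (cid (moore_penrose_ex A)). Qed.


(* One-dimensional Gaussian measure with mean [m] and standard deviation [s];
   the case [s = 0] is separated because [normal_prob m 0] is not a Dirac
   measure. *)
Definition gauss1 (R : realType) (m s : R) : set R -> \bar R :=
  if s == 0 then \d_m else normal_prob m s.

Section gaussian.
Context (R : realType) d (Omega : measurableType d) (P : probability Omega R).

Definition gaussian_real (Z : Omega -> R) :=
  exists m s : R, 0 <= s /\
    forall B : set R, measurable B -> pushforward P Z B = gauss1 m s B.

(* Gaussian vectors may be degenerate, so they are characterized through the
   linear functionals, as Banach-valued Gaussian random variables are. *)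
Definition gaussian_vector n (Z : 'I_n -> Omega -> R) :=
  forall a : 'I_n -> R, gaussian_real (fun w => \sum_(i < n) a i * Z i w).

Definition gaussian_process (T : Type) (X : T -> {RV P >-> R}) :=
  forall n (t : 'I_n -> T), gaussian_vector (fun i => X (t i)).

Definition gaussian_rv (E : normedModType R) (X : {RV P >-> borel E}) :=
  forall x' : {scalar E}, continuous x' -> gaussian_real (x' \o X).

Definition mean_fun (T : Type) (X : T -> Omega -> R) (t : T) : R :=
  fine 'E_P[X t].

Definition cov_fun (T : Type) (X : T -> Omega -> R) (t1 t2 : T) : R :=
  fine (covariance P (X t1) (X t2)).

(* Being a kernel, [K] already has probability measures [K y] and measurable
   maps [K ^~ B]. *)
Definition is_regular_cond_prob d1 d2 (E : measurableType d1)
    (F : measurableType d2) (X : {RV P >-> E}) (Y : {RV P >-> F})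
    (K : R.-pker F ~> E) :=
  forall (B : set E) (A : set F), measurable B -> measurable A ->
    P (X @^-1` B `&` Y @^-1` A) = (\int[distribution P Y]_(y in A) K y B)%E.
End gaussian.

Section process.
Context (R : realType) (T : metricType R) (cT : compact [set: T]).
Context d (Omega : measurableType d) (X : T -> {mfun Omega >-> R}).
Context (cX : forall w, continuous (fun t => X t w)).

Definition process_rv (w : Omega) : borel (cspace R cT) := mkcspace cT (@cX w).

Let measurable_process_rv : measurable_fun [set: Omega] process_rv.
Proof. by apply: measurable_cspace => t; exact: measurable_funPT. Qed.

HB.instance Definition _ := @isMeasurableFun.Build _ _ Omega
  (borel (cspace R cT)) process_rv measurable_process_rv.
End process.
Arguments process_rv {R T} cT {d Omega X} cX w.

Section restriction_random.
Context (R : realType) (T : topologicalType) (cT : compact [set: T]).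
Context (S : set T) (clS : closed S).
Context d (Omega : measurableType d) (X : {mfun Omega >-> borel (cspace R cT)}).

Definition restriction_rv (w : Omega) :
  borel (cspace R (closed_compact_set_type cT clS)) := restriction clS (X w).

Let measurable_restriction_rv : measurable_fun [set: Omega] restriction_rv.
Proof.
exact: (measurableT_comp (@measurable_restriction R T cT S clS)
  (measurable_funPT X)).
Qed.

HB.instance Definition _ := @isMeasurableFun.Build _ _ Omega
  (borel (cspace R (closed_compact_set_type cT clS))) restriction_rv
  measurable_restriction_rv.
End restriction_random.
Arguments restriction_rv {R T cT S} clS {d Omega} X w.

(* [mu] is N(m, k): the law of a C(T)-valued Gaussian random variable whose
   associated process has mean function [m] and covariance function [k]. *)
Definition is_gaussian_law (R : realType) (T : metricType R)
    (cT : compact [set: T]) (mu : set (borel (cspace R cT)) -> \bar R)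
    (m : T -> R) (k : T -> T -> R) :=
  exists (d : measure_display) (Omega : measurableType d)
    (P : probability Omega R) (Z : {RV P >-> borel (cspace R cT)}),
    [/\ gaussian_rv Z,
        mean_fun P (fun t w => Z w t) = m,
        cov_fun P (fun t w => Z w t) = k &
        forall B, measurable B -> mu B = distribution P Z B].

Section conditional.
Context (R : realType) (T : Type).

(* The matrix K_{r,s} *)
Definition kmx (k : T -> T -> R) (p n : nat) (r : 'I_p -> T) (s : 'I_n -> T) :
  'M[R]_(p, n) := \matrix_(i, j) k (r i) (s j).

(* The vector f(s) *)
Definition fcol (U : Type) (f : U -> R) n (s : 'I_n -> U) : 'cV[R]_n :=
  \col_i f (s i).

Definition pt1 (t : T) : 'I_1 -> T := fun=> t.

Context (S : set T) (s : nat -> S).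

(* The enumeration starts at 0: S_n consists of s 0, ..., s (n - 1).
   [mean_incr] is K_{t,S_n} K_{S_n,S_n}^+ (g(S_n) - m(S_n)) and [cov_incr] is
   K_{t1,S_n} K_{S_n,S_n}^+ K_{S_n,t2}. *)
Definition mean_incr (m : T -> R) (k : T -> T -> R) (g : S -> R)
    (n : nat) (t : T) : R :=
  let Sn : 'I_n -> T := fun i => \val (s i) in
  let gSn := fcol g (fun i : 'I_n => s i) in
  (kmx k (pt1 t) Sn *m moore_penrose (kmx k Sn Sn) *m (gSn - fcol m Sn)) 0 0.

Definition cov_incr (k : T -> T -> R) (n : nat) (t : T * T) : R :=
  let Sn : 'I_n -> T := fun i => \val (s i) in
  (kmx k (pt1 t.1) Sn *m moore_penrose (kmx k Sn Sn) *m kmx k Sn (pt1 t.2)) 0 0.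

Definition lim_mean_incr m k g (t : T) : R :=
  lim (mean_incr m k g n t @[n --> \oo]).

Definition lim_cov_incr k (t : T * T) : R := lim (cov_incr k n t @[n --> \oo]).

Definition cond_mean m k g (t : T) : R := m t + lim_mean_incr m k g t.

Definition cond_cov k (t1 t2 : T) : R := k t1 t2 - lim_cov_incr k (t1, t2).
End conditional.

(* Main.v *)
(* Put xi = X - m and let M_n(t) = K_{t,S_n} K_{S_n,S_n}^+ xi(S_n); this is the
   L^2-projection of xi(t) onto the span of xi(s_1), ..., xi(s_n). On a Gaussian
   space orthogonality is independence, so reflecting the residual of the
   projection preserves joint laws, which gives Levy's maximal inequality
   P(sup_n |M_n| > e) <= 2 P(|xi| > e), uniformly over countably many times or
   increments. Applied to increments of xi over small distances it makes (M_n)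
   almost surely equicontinuous, hence almost surely uniformly convergent to a
   continuous function that depends only on Y. The residual W = X - m - lim M_n
   is orthogonal to, hence independent of, Y, so that X = m + lim M_n + W is
   conditionally Gaussian with mean m + lim M_n and the covariance of W.
   Independence and the uniqueness of laws on C(T) are both reduced to integrals
   of cos(l(.) + b) for finite linear combinations l of point evaluations. *)

Require Import Defs.
From HB Require Import structures.
From mathcomp Require Import all_boot all_order all_algebra.
From mathcomp Require Import all_classical all_reals all_analysis.
From mathcomp Require Import measurable_realfun lra.

Set Implicit Arguments.
Unset Strict Implicit.
Unset Printing Implicit Defensive.

Import Order.TTheory GRing.Theory Num.Theory.
Import numFieldNormedType.Exports.

Local Open Scope classical_set_scope.
Local Open Scope ring_scope.

(** * Laws are determined by cosine integrals *)

(** Covariances may be singular, so densities enter only for nondegenerate laws on the line; vectors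
    and paths are reached through linear forms. Cosines of such forms suffice because their span is
    an algebra: polynomials in slow sine waves converge boundedly to indicators of half-spaces.
    Limits inside the Gaussian space are taken almost everywhere, without prior moment bounds. A
    truncated absolute mean controls both parameters of a normal law, so such limits stay Gaussian
    and inner products converge; the same argument turns continuity of paths into continuity of [m]
    and [k]. The last obstacle is that the exceptional set must be Borel in $C(S)$ and must serve an
    arbitrary version. Hence the mean formula is studied for every [g], convergence is stated as a
    uniform Cauchy property over countably many times, which is a measurable condition on [g], and
    kernels are compared on a countable family of cylinders that generates the Borel sets of $C(T)$.
    Interpolation at the nodes holds only almost everywhere, because a singular Gram matrix cannot
    reproduce arbitrary data. *)

Section bounded_integral.
Context d (T : measurableType d) (R : realType) (P : probability T R).

Lemma bounded_integrable (f : T -> R) (M : R) :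
  measurable_fun setT f -> (forall x, `|f x| <= M) ->
  P.-integrable setT (EFin \o f).
Proof.
move=> mf fM; apply: measurable_bounded_integrable => //.
  by rewrite [X in (X < _)%E]probability_setT ltry.
by exists M; split => [|x Mx y _] /=; [exact: num_real|exact: le_trans (fM y) (ltW Mx)].
Qed.

Lemma bounded_cvg_Rintegral (f_ : nat -> T -> R) (f : T -> R) (M : R) :
  (forall n, measurable_fun setT (f_ n)) -> measurable_fun setT f ->
  (forall n x, `|f_ n x| <= M) ->
  {ae P, forall x, f_ n x @[n --> \oo] --> f x} ->
  \int[P]_x f_ n x @[n --> \oo] --> \int[P]_x f x.
Proof.
move=> mf_ mf f_M cf.
have [] := @dominated_convergence _ T R P setT measurableT
  (fun n x => (f_ n x)%:E) (fun x => (f x)%:E) (fun x => M%:E).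
- by move=> n; exact/measurable_EFinP.
- exact/measurable_EFinP.
- by apply: filterS cf => x fx _; apply: cvg_EFin => //; exact: nearW.
- exact: finite_measure_integrable_cst.
- by apply: aeW => x n _; rewrite lee_fin.
move=> If _ c.
apply: (@fine_cvg _ _ _ _ _ (\int[P]_x f x)).
rewrite /Rintegral fineK//; exact: integrable_fin_num.
Qed.

Lemma Rintegral_indic (A : set T) : measurable A ->
  \int[P]_x (\1_A x : R) = fine (P A).
Proof. by move=> mA; rewrite /Rintegral integral_indic// setIT. Qed.

End bounded_integral.

(* Brosowski-Deutsch polynomials: on [0, 1] they converge to the indicator of
   p < 1/2, with value 0 at p = 1/2. *)
Definition half_threshold (R : realType) (n : nat) (p : R) : R :=
  (1 - p ^+ n.+1) ^+ (n.+1 * 2 ^ n.+1).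

Section half_threshold.
Context (R : realType).
Implicit Types p : R.

Lemma half_threshold_ge0_le1 n p : 0 <= p <= 1 -> 0 <= half_threshold n p <= 1.
Proof.
move=> /andP[p0 p1]; rewrite /half_threshold.
have h : 0 <= 1 - p ^+ n.+1 by rewrite subr_ge0 exprn_ile1.
by rewrite exprn_ge0//= exprn_ile1// gerBl exprn_ge0.
Qed.

Lemma bernoulli_ge n (x : R) : 0 <= x <= 1 -> 1 - n%:R * x <= (1 - x) ^+ n.
Proof.
move=> /andP[x0 x1]; elim: n => [|n ih]; first by rewrite mul0r subr0 expr0.
rewrite exprS -natr1; apply: le_trans (_ : (1 - x) * (1 - n%:R * x) <= _).
  by have := mulr_ge0 (mulr_ge0 (ler0n R n) x0) x0; nra.
by rewrite ler_wpM2l// subr_ge0.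
Qed.

(** The induction rests on $(1-x)(1+(n+1)x) = 1+nx-(n+1)x^2 \le 1+nx$. *)
Lemma bernoulli_le n (x : R) : 0 <= x <= 1 -> (1 - x) ^+ n <= (1 + n%:R * x)^-1.
Proof.
move=> /andP[x0 x1].
have p0 : 0 < 1 + n%:R * x by rewrite ltr_pwDl// mulr_ge0.
rewrite -[leRHS]div1r ler_pdivlMr//.
elim: n p0 => [|n ih] p0; first by rewrite mul0r addr0 expr0 mulr1.
apply: le_trans (ih _); last by rewrite ltr_pwDl// mulr_ge0.
rewrite exprSr -mulrA ler_wpM2l ?exprn_ge0 ?subr_ge0// -natr1.
by have := mulr_ge0 (mulr_ge0 (ler0n R n) x0) x0; nra.
Qed.

Lemma cvg_invS : (n.+1%:R : R)^-1 @[n --> \oo] --> (0 : R).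
Proof. by have := @cvg_harmonic R. Qed.

(** With $y=z^2$, write $n y^n=(n z^n)z^n$: [bernoulli_le] at $1-z$ bounds $n z^n$ by $1/(1-z)$, and
    $z^n$ tends to 0. *)
Lemma cvg_natM_expr (y : R) : 0 <= y < 1 -> n%:R * y ^+ n @[n --> \oo] --> (0 : R).
Proof.
move=> /andP[y0 y1]; pose z := Num.sqrt y.
have z0 : 0 <= z by exact: sqrtr_ge0.
have yE : y = z ^+ 2 by rewrite sqr_sqrtr.
have z1 : z < 1 by rewrite -(@ltr_sqr _ z 1) ?nnegrE// -yE expr1n.
have z10 : 0 < 1 - z by rewrite subr_gt0.
have c : (1 - z)^-1 * z ^+ n @[n --> \oo] --> (0 : R).
  rewrite -[X in _ --> X](mulr0 (1 - z)^-1); apply: cvgM; first exact: cvg_cst.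
  by apply: cvg_expr; rewrite ger0_norm.
apply: (squeeze_cvgr _ (cvg_cst 0) c); apply: nearW => n.
rewrite mulr_ge0 ?exprn_ge0//= yE exprAC expr2 mulrA.
rewrite ler_wpM2r ?exprn_ge0// -[leRHS]div1r ler_pdivlMr//.
have z10' : 0 <= 1 - z <= 1 by lra.
have := bernoulli_le n z10'; rewrite subKr => h.
have p0 : 0 < 1 + n%:R * (1 - z) by rewrite ltr_pwDl// mulr_ge0// ltW.
rewrite -mulrA [_ * (1 - z)]mulrC mulrA.
apply: le_trans (_ : n%:R * (1 - z) * (1 + n%:R * (1 - z))^-1 <= _).
  by rewrite ler_wpM2l// mulr_ge0// ltW.
by rewrite ler_pdivrMr// mul1r lerDr.
Qed.

Lemma cvg_half_threshold p : 0 <= p <= 1 ->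
  half_threshold n p @[n --> \oo] --> (((p < 2^-1)%R : bool)%:R : R).
Proof.
move=> p01; have /andP[p0 p1] := p01.
have pn01 n : 0 <= p ^+ n <= 1 by rewrite exprn_ge0//= exprn_ile1.
(* The exponent of [half_threshold] is tuned to this product, which tends to 0 for $p<1/2$ and is at
   least $n+1$ for $p\ge1/2$. The factor [n.+1] settles $p=1/2$, where the exponent $2^{n+1}$ alone
   would give the limit $1/e$. *)
have E n : (n.+1 * 2 ^ n.+1)%:R * p ^+ n.+1 = n.+1%:R * (2 * p) ^+ n.+1 :> R.
  by rewrite natrM natrX exprMn mulrA.
case: ltP => ph /=.
  have y01 : 0 <= 2 * p < 1 by lra.
  have c1 : 1 - n.+1%:R * (2 * p) ^+ n.+1 @[n --> \oo] --> (1 : R).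
    rewrite -[X in _ --> X](subr0 1); apply: cvgB; first exact: cvg_cst.
    by have := cvg_natM_expr y01; rewrite -(cvg_shiftS (fun n => n%:R * (2 * p) ^+ n : R)).
  apply: (@squeeze_cvgr _ _ _ _ _ (fun=> 1) _ _ _ c1); last exact: cvg_cst.
  apply: nearW => n; rewrite -E bernoulli_ge//=.
  by have /andP[] := half_threshold_ge0_le1 n p01.
apply: (@squeeze_cvgr _ _ _ _ (fun=> 0) _ _ _ _ _ cvg_invS); last exact: cvg_cst.
apply: nearW => n; have /andP[-> _] /= := half_threshold_ge0_le1 n p01.
apply: le_trans (bernoulli_le _ (pn01 n.+1)) _; rewrite E.
rewrite lef_pV2 ?posrE//; last by rewrite ltr_pwDl// mulr_ge0// exprn_ge0// mulr_ge0.
apply: (@le_trans _ _ (n.+1%:R * 1)); first by rewrite mulr1.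
rewrite ler_wpDl// ler_wpM2l// exprn_ege1//; lra.
Qed.
End half_threshold.

(** * The algebra spanned by cosines of linear forms, and cylinder sets *)

Section cylinders.
Context (R : realType) (I E : Type) (ev : I -> E -> R).

(** Rational bounds keep the family countable when [I] is countable, so that one null set can serve
    all its members; strict inequalities match the value 0 of the threshold at $1/2$. *)
Definition cylinder (l : seq (I * rat)) : set E :=
  [set e | all (fun p => ev p.1 e < ratr p.2) l].

Definition lin (l : seq (R * I)) (e : E) : R := \sum_(p <- l) p.1 * ev p.2 e.

Lemma lin_cat l1 l2 e : lin (l1 ++ l2) e = lin l1 e + lin l2 e.
Proof. exact: big_cat. Qed.

Lemma lin_opp l e : lin [seq (- p.1, p.2) | p <- l] e = - lin l e.
Proof.
by rewrite /lin big_map -sumrN; apply: eq_bigr => p _; rewrite mulNr.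
Qed.

Lemma cylinder_setI_closed : setI_closed (range cylinder).
Proof.
move=> _ _ [l1 _ <-] [l2 _ <-]; exists (l1 ++ l2) => //.
apply/seteqP; rewrite /cylinder; split=> e /=; rewrite all_cat; first by move/andP.
by move=> [-> ->].
Qed.

(** The phase [b] brings in sines and the empty form brings in constants; the product-to-sum formula
    makes this span an algebra ([trigpolyM]). *)
Inductive trigpoly : (E -> R) -> Prop :=
| trigpoly_cos l b : trigpoly (fun e => cos (lin l e + b))
| trigpolyD f g : trigpoly f -> trigpoly g -> trigpoly (fun e => f e + g e)
| trigpolyZ c f : trigpoly f -> trigpoly (fun e => c * f e).

Lemma eq_trigpoly f g : f =1 g -> trigpoly f -> trigpoly g.
Proof. by move=> /funext ->. Qed.

Lemma trigpoly_cst c : trigpoly (fun=> c).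
Proof.
apply: eq_trigpoly (trigpolyZ c (trigpoly_cos [::] 0)) => e.
by rewrite /lin big_nil addr0 cos0 mulr1.
Qed.

Lemma trigpolyM f g : trigpoly f -> trigpoly g -> trigpoly (fun e => f e * g e).
Proof.
move=> + tg; elim=> {f} [l b|f1 f2 _ h1 _ h2|c f _ h].
- elim: tg => {g} [l' b'|g1 g2 _ h1 _ h2|c g _ h].
  + apply: eq_trigpoly (trigpolyZ 2^-1 (trigpolyD (trigpoly_cos (l ++ l') (b + b'))
      (trigpoly_cos (l ++ [seq (- p.1, p.2) | p <- l']) (b - b')))) => e.
    rewrite !lin_cat lin_opp [lin l e + lin l' e + _]addrACA.
    rewrite [lin l e - lin l' e + _]addrACA -opprD.
    move: (lin l e + b) (lin l' e + b') => x y; rewrite cosD cosB; lra.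
  + by apply: eq_trigpoly (trigpolyD h1 h2) => e; rewrite mulrDr.
  + by apply: eq_trigpoly (trigpolyZ c h) => e; rewrite mulrCA.
- by apply: eq_trigpoly (trigpolyD h1 h2) => e; rewrite mulrDl.
- by apply: eq_trigpoly (trigpolyZ c h) => e; rewrite mulrA.
Qed.

Lemma trigpolyX f n : trigpoly f -> trigpoly (fun e => f e ^+ n).
Proof.
move=> tf; elim: n => [|n ih]; first exact: trigpoly_cst.
by apply: eq_trigpoly (trigpolyM tf ih) => e; rewrite exprS.
Qed.

Lemma trigpoly_prod (J : Type) (s : seq J) (f : J -> E -> R) :
  (forall j, trigpoly (f j)) -> trigpoly (fun e => \prod_(j <- s) f j e).
Proof.
move=> tf; elim: s => [|j s ih].
  by apply: eq_trigpoly (trigpoly_cst 1) => e; rewrite big_nil.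
by apply: eq_trigpoly (trigpolyM (tf j) ih) => e; rewrite big_cons.
Qed.

(** Takes values in $[0,1]$ and falls below $1/2$ exactly where the sine is negative, as
    [half_threshold] expects; dividing by [k.+1] stretches the period. *)
Definition sine_wave (k : nat) (p : I * rat) (e : E) : R :=
  (1 + sin ((ev p.1 e - ratr p.2) / k.+1%:R)) / 2.

Lemma sine_wave_ge0_le1 k p e : 0 <= sine_wave k p e <= 1.
Proof.
rewrite /sine_wave; set x := _ / k.+1%:R.
have := sin_geN1 x; have := sin_le1 x; lra.
Qed.

Lemma trigpoly_sine_wave k p : trigpoly (sine_wave k p).
Proof.
apply: eq_trigpoly (trigpolyZ 2^-1 (trigpolyD (trigpoly_cst 1)
  (trigpoly_cos [:: (k.+1%:R^-1, p.1)] (- ratr p.2 / k.+1%:R - pi / 2)))) => e.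
rewrite /lin big_seq1 addrA cosBpihalf /sine_wave [RHS]mulrC.
by congr (_ * (_ + sin _)); rewrite [RHS]mulrDl [_ * ev _ _]mulrC.
Qed.

Lemma trigpoly_half_threshold n f :
  trigpoly f -> trigpoly (fun e => half_threshold n (f e)).
Proof.
move=> tf; apply: trigpolyX; apply: trigpolyD; first exact: trigpoly_cst.
by apply: eq_trigpoly (trigpolyZ (-1) (trigpolyX n.+1 tf)) => e; rewrite mulN1r.
Qed.

(* For large k the sign of sin (x / k) is the sign of x. *)
Lemma cvg_sine_wave p e :
  ((sine_wave k p e < 2^-1)%R : bool)%:R @[k --> \oo] -->
  (((ev p.1 e < ratr p.2)%R : bool)%:R : R).
Proof.
apply: cvg_near_cst; rewrite /sine_wave; set x := _ - _.
near=> k.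
have kx : `|x| / k.+1%:R < 2.
  rewrite ltr_pdivrMr// (@lt_le_trans _ _ k.+1%:R)//; last by rewrite ler_peMl// (ler1n _ 2).
  near: k; exists (Num.Def.archi_bound `|x|) => // k /= kx.
  by rewrite (lt_le_trans (archi_boundP _))// ler_nat (leq_trans kx).
rewrite -[_ < ratr _]subr_lt0 -/x.
have -> : ((1 + sin (x / k.+1%:R)) / 2 < 2^-1) = (sin (x / k.+1%:R) < 0).
  by apply/idP/idP => h; lra.
suff -> : (sin (x / k.+1%:R) < 0) = (x < 0) by [].
have [x0|x0|->] := ltgtP x 0; last by rewrite mul0r sin0 ltxx.
  rewrite -oppr_gt0 -sinN -mulNr sin2_gt0// divr_gt0 ?oppr_gt0//=.
  by rewrite -(ltr0_norm x0).
apply/negbTE; rewrite -leNgt ltW// sin2_gt0// divr_gt0//=.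
by rewrite -(gtr0_norm x0).
Unshelve. all: by end_near. Qed.

Lemma cvg_prod_seq (J : Type) (s : seq J) (u : nat -> J -> R) (v : J -> R) :
  (forall j, u n j @[n --> \oo] --> v j) ->
  \prod_(j <- s) u n j @[n --> \oo] --> \prod_(j <- s) v j.
Proof.
move=> uv; elim: s => [|j s ih].
  by rewrite big_nil; under eq_fun do rewrite big_nil; exact: cvg_cst.
by rewrite big_cons; under eq_fun do rewrite big_cons; exact: cvgM.
Qed.

Lemma prod_indic (J : Type) (s : seq J) (b : pred J) :
  \prod_(j <- s) ((b j)%:R : R) = (all b s)%:R.
Proof.
elim: s => [|j s ih]; first by rewrite big_nil.
by rewrite big_cons ih /=; case: (b j); rewrite ?mul1r ?mul0r.
Qed.

End cylinders.

Section uniqueness.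
Context (R : realType) (I : Type) d (E : measurableType d) (ev : I -> E -> R).
Context (mev : forall i, measurable_fun setT (ev i)).
Context d1 (O1 : measurableType d1) (P1 : probability O1 R) (F1 : O1 -> E).
Context d2 (O2 : measurableType d2) (P2 : probability O2 R) (F2 : O2 -> E).
Context (mF1 : measurable_fun setT F1) (mF2 : measurable_fun setT F2).

Lemma measurable_lin (l : seq (R * I)) : measurable_fun setT (lin ev l).
Proof.
apply: (@measurable_sum _ _ R setT _ l (fun p e => p.1 * ev p.2 e)) => p.
exact: measurable_funM.
Qed.

Lemma measurable_cos : measurable_fun setT (@cos R).
Proof. by apply: continuous_measurable_fun; exact: continuous_cos. Qed.

Hypothesis cos_eq : forall l b,
  \int[P1]_x cos (lin ev l (F1 x) + b) = \int[P2]_x cos (lin ev l (F2 x) + b).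

(** Test functions that do not separate the two laws. Boundedness is carried along so that the class
    is stable under bounded pointwise limits ([agree_cvg]). *)
Let agree (f : E -> R) := [/\ measurable_fun setT f,
  exists M : R, forall e, `|f e| <= M &
  \int[P1]_x f (F1 x) = \int[P2]_x f (F2 x)].

Let agree_trigpoly f : trigpoly ev f -> agree f.
Proof.
elim => {f} [l b|f g _ [mf [M fM] fE] _ [mg [N gN] gE]|c f _ [mf [M fM] fE]].
- split; last exact: cos_eq.
    apply: (measurableT_comp measurable_cos); apply: measurable_funD => //.
    exact: measurable_lin.
  by exists 1 => e; exact: cos_max.
- split; first exact: measurable_funD.
    by exists (M + N) => e; rewrite (le_trans (ler_normD _ _))// lerD.
  rewrite !RintegralD ?fE ?gE//;
    by (apply: bounded_integrable => [|x]; [exact: measurableT_comp|first [exact: fM|exact: gN]]).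
- split; first exact: measurable_funM.
    by exists (`|c| * M) => e; rewrite normrM ler_wpM2l.
  rewrite !RintegralZl ?fE//;
    by (apply: bounded_integrable => [|x]; [exact: measurableT_comp|exact: fM]).
Qed.

Let agree_cvg (f_ : nat -> E -> R) (f : E -> R) (M : R) : (forall n, agree (f_ n)) ->
  (forall n e, `|f_ n e| <= M) -> (forall e, f_ n e @[n --> \oo] --> f e) -> agree f.
Proof.
move=> af_ f_M f_f.
have mf : measurable_fun setT f.
  apply: (measurable_fun_cvg (h := f_)) => [n|e _]; first by have [] := af_ n.
  exact: f_f.
split=> //.
  exists M => e; rewrite ler_norml.
  have fM n : - M <= f_ n e <= M by rewrite -ler_norml.
  apply/andP; split; [apply: (cvgr_to_ge (f_f e))|apply: (cvgr_to_le (f_f e))];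
    by apply: nearW => n; have /andP[] := fM n.
have c d' (O : measurableType d') (P : probability O R) (F : O -> E) :
    measurable_fun setT F ->
    \int[P]_x f_ n (F x) @[n --> \oo] --> \int[P]_x f (F x).
  move=> mF.
  apply: (@bounded_cvg_Rintegral _ _ _ P (fun n x => f_ n (F x)) _ M) => [n||n x|].
  - by apply: (measurableT_comp _ mF); have [] := af_ n.
  - exact: (measurableT_comp mf mF).
  - exact: f_M.
  - by apply: aeW => x; exact: f_f.
apply: (@cvg_unique _ _ (\int[P1]_x f_ n (F1 x) @[n --> \oo])) => //.
  exact: c.
rewrite (_ : (fun n => _) = (fun n => \int[P2]_x f_ n (F2 x))); first exact: c.
by apply/funext => n; have [] := af_ n.
Qed.

Lemma measurable_cylinder l : measurable (cylinder ev l).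
Proof.
elim: l => [|p l ih]; first by rewrite (_ : cylinder _ _ = setT)//; apply/seteqP.
rewrite (_ : cylinder _ _ = (ev p.1 @^-1` `]-oo, ratr p.2[) `&` cylinder ev l).
  by apply: measurableI => //; rewrite -[X in measurable X]setTI; exact: mev.
by apply/seteqP; split=> e; rewrite /cylinder/= in_itv/=; move/andP.
Qed.

(** Two bounded limits in a fixed order: for fixed [k], letting [n] grow turns the product of
    thresholded waves into the indicator of a periodic set; then growing [k] pushes the other
    periods to infinity and leaves the cylinder. *)
Lemma cos_uniqueness_cylinder l :
  P1 (F1 @^-1` cylinder ev l) = P2 (F2 @^-1` cylinder ev l).
Proof.
pose g k n e := \prod_(p <- l) half_threshold n (sine_wave ev k p e).
pose h k e := \prod_(p <- l) (((sine_wave ev k p e < 2^-1)%R : bool)%:R : R).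
have prod01 (u : I * rat -> R) : (forall p, 0 <= u p <= 1) ->
    `|\prod_(p <- l) u p| <= 1.
  move=> u01; rewrite ger0_norm ?prodr_ge0// => [|p _]; last by have /andP[] := u01 p.
  by rewrite prodr_ile1// => p _; exact: u01.
have ag k n : agree (g k n).
  apply/agree_trigpoly/trigpoly_prod => p.
  exact/trigpoly_half_threshold/trigpoly_sine_wave.
have ah k : agree (h k).
  apply: (@agree_cvg (g k) _ 1) => // [n e|e].
    by apply: prod01 => p; rewrite half_threshold_ge0_le1// sine_wave_ge0_le1.
  by apply: cvg_prod_seq => p; apply: cvg_half_threshold; exact: sine_wave_ge0_le1.
have [mi _] : agree (\1_(cylinder ev l)).
  apply: (@agree_cvg h _ 1) => // [n e|e].
    by apply: prod01 => p; case: (_ < _); rewrite ?lexx ?ler01.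
  rewrite indicE (_ : (e \in _) = all (fun p => ev p.1 e < ratr p.2) l); last first.
    by apply/idP/idP => [/set_mem|/mem_set].
  by rewrite -prod_indic; apply: cvg_prod_seq => p; exact: cvg_sine_wave.
have mc := measurable_cylinder l.
have E1 (O : Type) (F : O -> E) x : \1_(cylinder ev l) (F x) = \1_(F @^-1` cylinder ev l) x :> R.
  by rewrite !indicE; congr (_%:R); apply/idP/idP => /set_mem h'; exact/mem_set.
under eq_Rintegral do rewrite E1.
under [in RHS]eq_Rintegral do rewrite E1.
have m1 : measurable (F1 @^-1` cylinder ev l) by rewrite -[X in measurable X]setTI; exact: mF1.
have m2 : measurable (F2 @^-1` cylinder ev l) by rewrite -[X in measurable X]setTI; exact: mF2.
rewrite !Rintegral_indic// => h'.
by rewrite -[LHS]fineK ?h' ?fineK//; exact: fin_num_measure.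
Qed.

(* A law is determined by the characteristic functions of its finite-dimensional
   marginals. *)
Lemma cos_uniqueness B : measurable B -> <<s range (cylinder ev) >> B ->
  P1 (F1 @^-1` B) = P2 (F2 @^-1` B).
Proof.
move=> mB sB.
pose X1 : {mfun O1 >-> E} := HB.pack F1 (isMeasurableFun.Build _ _ _ _ F1 mF1).
pose X2 : {mfun O2 >-> E} := HB.pack F2 (isMeasurableFun.Build _ _ _ _ F2 mF2).
rewrite -[LHS]/(distribution P1 X1 B) -[RHS]/(distribution P2 X2 B).
apply: (g_sigma_algebra_measure_unique (range (cylinder ev)) _ (fun=> setT)) => //.
- by move=> _ [l _ <-]; exact: measurable_cylinder.
- by move=> _; exists [::] => //; apply/seteqP; split.
- by rewrite bigcup_const//; exists 0%N.
- exact: cylinder_setI_closed.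
- by move=> _ [l _ <-]; exact: cos_uniqueness_cylinder.
- by move=> _; rewrite [X in (X < _)%E]probability_setT ltry.
Qed.
End uniqueness.

(** * Gaussian laws on the line *)

Section cylinder_borel.
Context (R : realType) (I : Type) (E : pointedType) (ev : I -> E -> R).

Lemma measurable_ev_cylinder i :
  measurable_fun setT (ev i : g_sigma_algebraType (range (cylinder ev)) -> R).
Proof.
apply: (measurability _ (RGenInftyO.measurableE R)) => _ [_ [x ->] <-].
rewrite setTI (_ : _ @^-1` _ = \bigcup_(q in [set q : rat | ratr q <= x])
    cylinder ev [:: (i, q)]).
  apply: countable_bigcup_measurable; first exact: countableP.
  by move=> q _; apply: sub_sigma_algebra; exists [:: (i, q)].
apply/seteqP; split=> [e /=|e [q /= qx]].
  rewrite in_itv/= => /rat_in_itvoo[q]; rewrite in_itv/= => /andP[eq qx].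
  by exists q; rewrite /cylinder/= ?eq// ltW.
by rewrite /cylinder/= andbT in_itv/= => /lt_le_trans; exact.
Qed.
End cylinder_borel.

Lemma borel_cylinder (R : realType) (B : set R) : measurable B ->
  <<s range (cylinder (fun (_ : unit) (x : R) => x)) >> B.
Proof.
move=> mB.
have := @measurable_ev_cylinder R unit R (fun _ x => x) tt.
by move=> /(_ measurableT B mB); rewrite setTI.
Qed.

Section normal.
Context (R : realType).
Notation mu := (@lebesgue_measure R).
Implicit Types (m s x y : R).

(** The Radon-Nikodym derivative and [normal_pdf] have the same integral over every measurable set,
    hence agree almost everywhere. *)
Lemma ge0_integral_normal_prob m s (f : R -> \bar R) :
  (forall x, (0 <= f x)%E) -> measurable_fun setT f ->
  (\int[normal_prob m s]_x f x = \int[mu]_x (f x * (normal_pdf m s x)%:E))%E.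
Proof.
move=> f0 mf.
have dom := @normal_prob_dominates R m s.
rewrite -(Radon_Nikodym_SigmaFinite.change_of_variables dom)//.
apply: ae_eq_integral => //.
- apply: emeasurable_funM => //; apply: (measurable_int mu).
  exact: Radon_Nikodym_SigmaFinite.f_integrable.
- by apply: emeasurable_funM => //; apply/measurable_EFinP; exact: measurable_normal_pdf.
- apply: ae_eqe_mul2l => /=.
  apply: integral_ae_eq => //=.
  + exact: Radon_Nikodym_SigmaFinite.f_integrable.
  + apply/measurable_EFinP; exact: measurable_normal_pdf.
  + by move=> E _ mE; rewrite -Radon_Nikodym_SigmaFinite.f_integral.
Qed.

Lemma ge0_integral_normal_probE m s (f : R -> R) :
  (forall x, 0 <= f x) -> measurable_fun setT f ->
  (\int[normal_prob m s]_x (f x)%:E = \int[mu]_x (f x * normal_pdf m s x)%:E)%E.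
Proof.
move=> f0 mf; apply: ge0_integral_normal_prob => [x|]; first by rewrite lee_fin.
exact/measurable_EFinP.
Qed.

Lemma normal_pdf_affine m s x : 0 < s ->
  normal_pdf m s (s * x + m) * s = normal_pdf 0 1 x.
Proof.
move=> s0; rewrite !normal_pdfE ?gt_eqF//= /normal_peak /normal_fun.
rewrite mulrAC addrK subr0 expr1n mul1r; congr (_ * expR _).
  rewrite -mulrnAr sqrtrM ?sqr_ge0// sqrtr_sqr gtr0_norm//.
  by rewrite invfM mulrAC mulVf ?mul1r// gt_eqF.
rewrite exprMn !mulNr -[s ^+ 2 *+ 2]mulr_natr -mulf_div divff ?mul1r//.
by rewrite expf_eq0 gt_eqF.
Qed.

Lemma cosS_normal m s (a b : R) : 0 < s ->
  \int[normal_prob m s]_x cos (a * x + b) =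
  \int[normal_prob 0 1]_x cos (a * (s * x + m) + b).
Proof.
move=> s0.
have mc c e : measurable_fun setT (fun x => cos (c * x + e) : R).
  apply: (measurableT_comp (@measurable_cos R)).
  by apply: measurable_funD => //; exact: measurable_funM.
(* Adding 1 makes the integrand nonnegative, as the density formula and the substitution rule
   require; [E2] takes it off again. *)
have E1 m' s' c e : (\int[normal_prob m' s']_x (1 + cos (c * x + e))%:E)%E =
    (\int[mu]_x ((1 + cos (c * x + e)) * normal_pdf m' s' x)%:E)%E.
  apply: ge0_integral_normal_probE => [x|]; last exact: measurable_funD.
  by rewrite -lerBlDl sub0r cos_geN1.
have E2 m' s' c e : \int[normal_prob m' s']_x (cos (c * x + e)) =
    fine (\int[normal_prob m' s']_x (1 + cos (c * x + e))%:E)%E - 1.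
  rewrite -[fine _]/(\int[normal_prob m' s']_x (1 + cos (c * x + e))) RintegralD//=.
  - rewrite Rintegral_cst// [X in fine X]probability_setT /= mulr1 addrAC subrr add0r//.
  - by apply: (@bounded_integrable _ _ R (normal_prob m' s') _ 1) => // x; rewrite normr1.
  - by apply: (@bounded_integrable _ _ R (normal_prob m' s') _ 1) => [|x]; [exact: mc|exact: cos_max].
rewrite (E2 m s a b).
have -> : (fun x => cos (a * (s * x + m) + b)) = (fun x => cos (a * s * x + (a * m + b))).
  by apply/funext => x; rewrite mulrDr mulrA addrA.
rewrite (E2 0 1 (a * s) (a * m + b)) (E1 m s a b) (E1 0 1 (a * s) (a * m + b)).
congr (fine _ - 1).
pose F (x : R^o) := s * x + m.
have dF (x : R^o) : derivable F x 1 by [].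
have F'E : F^`()%classic = cst s.
  apply/funext => x; rewrite /F derive1E deriveD// deriveM// derive_cst scaler0.
  by rewrite derive_id derive_cst !addr0 scaler1.
have cG : continuous (fun x => (1 + cos (a * x + b)) * normal_pdf m s x).
  move=> x; apply: cvgM; last by apply: continuous_normal_pdf; rewrite gt_eqF.
  apply: cvgD; first exact: cvg_cst.
  apply: (@cvg_comp _ _ _ (fun x => a * x + b) (@cos R)); last exact: continuous_cos.
  by apply: cvgD; [apply: cvgM; [exact: cvg_cst|exact: cvg_id]|exact: cvg_cst].
pose G x := (1 + cos (a * x + b)) * normal_pdf m s x.
transitivity (\int[mu]_x (((G \o F) * F^`()%classic) x)%:E)%E; last first.
  apply: eq_integral => x _; rewrite F'E /G -(normal_pdf_affine m x s0).
  have <- : a * (s * x + m) + b = a * s * x + (a * m + b) by rewrite mulrDr mulrA addrA.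
  by rewrite mulrA.
apply: increasing_ge0_integration_by_substitutionT.
- by move=> x y xy; rewrite /F ltrD2r ltr_pM2l.
- by rewrite F'E => x; exact: cvg_cst.
- by rewrite F'E; exact: is_cvg_cst.
- by rewrite F'E; exact: is_cvg_cst.
- exact: dF.
- apply/cvgrNyPle => A; near=> x.
  rewrite /F -lerBrDr -ler_pdivlMl//; near: x; exact: nbhs_ninfty_le.
- apply/cvgryPge => A; near=> x.
  rewrite /F -lerBlDr -ler_pdivrMl//; near: x; exact: nbhs_pinfty_ge.
- exact: cG.
- by move=> x; rewrite mulr_ge0 ?normal_pdf_ge0// -lerBlDl sub0r cos_geN1.
Unshelve. all: by end_near. Qed.

(** One formula covers Dirac and nondegenerate laws, so that later computations can be pulled back
    to the standard normal law. For $s>0$ both sides have the same cosine integrals. *)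
Lemma gauss1E m s (B : set R) : 0 <= s -> measurable B ->
  gauss1 m s B = normal_prob 0 1 ((fun x => s * x + m) @^-1` B).
Proof.
rewrite /gauss1 le_eqVlt eq_sym => /predU1P[->|s0] mB.
  rewrite eqxx diracE; have [Bm|Bm] := boolP (m \in B).
    rewrite (_ : _ @^-1` _ = setT) ?[RHS]probability_setT//.
    by apply/seteqP; split=> // x _ /=; rewrite mul0r add0r; exact: set_mem.
  rewrite (_ : _ @^-1` _ = set0) ?measure0//.
  apply/seteqP; split=> // x /=; rewrite mul0r add0r => /mem_set.
  by rewrite (negbTE Bm).
have -> : (s == 0) = false by rewrite gt_eqF.
have maff : measurable_fun setT (fun x : R => s * x + m).
  by apply: measurable_funD => //; exact: measurable_funM.
have cosE l b : \int[normal_prob m s]_x cos (lin (fun _ : unit => id) l (id x) + b) =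
    \int[normal_prob 0 1]_x cos (lin (fun _ : unit => id) l (s * x + m) + b).
  pose a : R := \sum_(p <- l) p.1.
  have linE : lin (fun _ : unit => id) l = (fun x => a * x).
    by apply/funext => x; rewrite /lin mulr_suml.
  rewrite linE; exact: cosS_normal.
pose E : measurableType _ := measurableTypeR R.
have mid : measurable_fun [set: E] (id : E -> R) by exact: measurable_id.
exact: (@cos_uniqueness R unit _ E (fun _ x => x) (fun=> mid) _ E (normal_prob m s) id
  _ E (normal_prob 0 1) _ (@measurable_id _ _ setT) maff cosE B mB (borel_cylinder mB)).
Qed.

End normal.

Section normal2.
Context (R : realType).
Notation mu := (@lebesgue_measure R).
Implicit Types (m s x y : R).

Lemma ge0_integralN_normal (f : R -> R) : (forall x, 0 <= f x) -> continuous f ->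
  (\int[normal_prob 0 1]_x (f (- x))%:E = \int[normal_prob 0 1]_x (f x)%:E)%E.
Proof.
move=> f0 cf.
have mf := continuous_measurable_fun cf.
have mfN : measurable_fun setT (fun x => f (- x)) by exact: (measurableT_comp mf).
rewrite (ge0_integral_normal_probE 0 1 f0 mf).
rewrite (ge0_integral_normal_probE 0 1 (fun x => f0 (- x)) mfN).
pose g x := f x * normal_pdf 0 1 x.
have n10 : (1 : R) != 0 by rewrite oner_eq0.
have pdfN x : normal_pdf 0 1 (- x) = normal_pdf 0 1 x :> R.
  by rewrite !normal_pdfE// /normal_fun !subr0 sqrrN.
have g0 x : 0 <= g x by rewrite mulr_ge0// normal_pdf_ge0.
have cg : continuous g by move=> x; apply: cvgM; [exact: cf|exact: continuous_normal_pdf].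
have mg := continuous_measurable_fun cg.
have mgN : measurable_fun setT (fun x => g (- x)) by exact: (measurableT_comp mg).
have halves (h : R -> R) : measurable_fun setT h -> (forall x, 0 <= h x) ->
    (\int[mu]_x (h x)%:E = \int[mu]_(x in `]-oo, 0%R]) (h x)%:E +
      \int[mu]_(x in `[0%R, +oo[) (h x)%:E)%E.
  move=> mh h0; rewrite -integral_itv_obnd_cbnd; last first.
    exact/measurable_EFinP/measurable_funTS.
  rewrite -ge0_integral_setU//=.
  - by rewrite -setCitvl setUv.
  - exact/measurable_EFinP/measurable_funTS.
  - by move=> x _; rewrite lee_fin.
  - by rewrite -setCitvl; apply/disj_setPCl.
have flip (h : R -> R) : continuous h -> (forall x, 0 <= h x) ->
    (\int[mu]_(x in `]-oo, 0%R]) (h x)%:E = \int[mu]_(x in `[0%R, +oo[) (h (- x))%:E)%E.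
  move=> ch h0; rewrite -[X in `]-oo, X]]oppr0 ge0_integration_by_substitutionNy//.
  exact: continuous_subspaceT.
transitivity (\int[mu]_x (g (- x))%:E)%E.
  by apply: eq_integral => x _; rewrite /g pdfN.
transitivity (\int[mu]_x (g x)%:E)%E; last by [].
have cgN : continuous (fun x => g (- x)).
  move=> x; apply: (@cvg_comp _ _ _ (fun x => - x) g); last exact: cg.
  by apply: cvgN; exact: cvg_id.
rewrite (halves _ mgN (fun x => g0 (- x))) (halves _ mg g0) [RHS]addeC.
have flipN : (\int[mu]_(x in `]-oo, 0%R]) (g (- x))%:E =
    \int[mu]_(x in `[0%R, +oo[) (g x)%:E)%E.
  rewrite (flip _ cgN (fun x => g0 (- x))).
  by apply: eq_integral => x _; rewrite opprK.
by rewrite (flip _ cg g0) flipN.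
Qed.

Lemma integrable_sqr_normal :
  (normal_prob 0 1).-integrable setT (fun x : R => (x ^+ 2)%:E).
Proof.
apply/integrableP; split.
  by apply/measurable_EFinP; exact: measurable_funX.
under eq_integral do rewrite gee0_abs ?lee_fin ?sqr_ge0//.
rewrite (@ge0_integral_normal_probE R 0 1 (fun x => x ^+ 2)); last 2 first.
- by move=> x; exact: sqr_ge0.
- exact: measurable_funX.
(* Domination by a wider normal density: $x^2e^{-x^2/2}\le 4e^{-x^2/4}$ because
   $e^{x^2/4}\ge1+x^2/4$, and $e^{-x^2/4}$ belongs to the deviation $\sqrt2$. The quotient of peaks
   in [c] adjusts the normalizations. *)
pose s : R := Num.sqrt 2.
have s0 : 0 < s by rewrite sqrtr_gt0.
pose c : R := 4 * normal_peak 1 / normal_peak s.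
apply: (@le_lt_trans _ _ (\int[mu]_x (c * normal_pdf 0 s x)%:E)%E).
  apply: ge0_le_integral => //=.
  - by move=> x _; rewrite lee_fin mulr_ge0 ?sqr_ge0 ?normal_pdf_ge0.
  - apply/measurable_EFinP; apply: measurable_funM; first exact: measurable_funX.
    exact: measurable_normal_pdf.
  - by apply/measurable_EFinP; apply: measurable_funM => //; exact: measurable_normal_pdf.
  move=> x _; rewrite lee_fin !normal_pdfE ?oner_eq0 ?gt_eqF//.
  rewrite /c [leRHS]mulrA divfK; last by rewrite gt_eqF// normal_peak_gt0// gt_eqF.
  rewrite [leLHS]mulrCA [4 * _]mulrC -[leRHS]mulrA ler_wpM2l ?normal_peak_ge0//.
  rewrite /normal_fun !subr0 expr1n sqr_sqrtr//.
  have -> : - x ^+ 2 / (1 *+ 2) = - (x ^+ 2 / 4) + - x ^+ 2 / (2 *+ 2) :> R.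
    have -> : 2 *+ 2 = 4 :> R by rewrite -mulrnA.
    by set y := x ^+ 2; lra.
  rewrite expRD mulrA ler_wpM2r ?expR_ge0//.
  rewrite expRN ler_pdivrMr ?expR_gt0//.
  have := expR_ge1Dx (x ^+ 2 / 4); lra.
under eq_integral do rewrite EFinM.
rewrite integralZl//; last exact: integrable_normal_pdf.
by rewrite integral_normal_pdf mule1 ltry.
Qed.

(** On $[1,2]$ and $[-2,-1]$, both of length 1, the density is at least its value at 2. Having both
    sides lets [has_gauss_trunc_abs] treat a mean of either sign. *)
Lemma normal_tails : exists2 p : R, 0 < p &
  (p%:E <= normal_prob 0 1 [set x : R | (1 <= x)%R])%E /\
  (p%:E <= normal_prob 0 1 [set x : R | (x <= -1)%R])%E.
Proof.
have n10 : (1 : R) != 0 by rewrite oner_eq0.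
exists (normal_pdf 0 1 2).
  by rewrite normal_pdfE// mulr_gt0 ?expR_gt0// normal_peak_gt0.
have le_pdf (x : R) : -2 <= x <= 2 -> normal_pdf 0 1 2 <= normal_pdf 0 1 x :> R.
  move=> /andP[x1 x2]; rewrite !normal_pdfE// ler_wpM2l ?normal_peak_ge0//.
  rewrite ler_expR !subr0 ler_pM2r ?invr_gt0// ?mulrn_wgt0 ?exprn_gt0//.
  rewrite lerN2; nra.
have H (a : R) : -2 <= a -> a + 1 <= 2 ->
    ((normal_pdf 0 1 2)%:E <= normal_prob 0 1 `[a, (a + 1)%R])%E.
  move=> a1 a2.
  have <- : (\int[mu]_(x in `[a, (a + 1)%R]) (normal_pdf 0 1 2)%:E =
      (normal_pdf 0 1 2)%:E)%E.
    rewrite integral_cst//= lebesgue_measure_itv/= lte_fin ltrDl ltr01.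
    by rewrite -EFinB addrAC subrr add0r mule1.
  apply: ge0_le_integral => //=.
  - by move=> x _; rewrite lee_fin normal_pdf_ge0.
  - by apply/measurable_EFinP; apply: measurable_funTS; exact: measurable_normal_pdf.
  - move=> x; rewrite in_itv/= lee_fin => /andP[ax xa]; apply: le_pdf; lra.
split.
- apply: le_trans (H 1 _ _) _; [lra|lra|].
  apply: le_measure; rewrite ?inE//.
    by rewrite -set_itvcy.
  by move=> x /=; rewrite in_itv/= => /andP[].
- apply: le_trans (H (-2) _ _) _; [lra|lra|].
  apply: le_measure; rewrite ?inE//.
    by rewrite -set_itvNyc.
  by move=> x /=; rewrite in_itv/= => /andP[]; lra.
Qed.

End normal2.

(** * Convolution of normal laws *)

Section convolution.
Context (R : realType).
Notation mu := (@lebesgue_measure R).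
Implicit Types (m s t x y w : R).

Lemma gauss1_gt0 m s : 0 < s -> gauss1 m s = normal_prob m s.
Proof. by move=> s0; rewrite /gauss1 gt_eqF. Qed.

(* Completing the square in [y]. *)
Lemma normal_pdf_mul m s t y w : 0 < s -> 0 < t ->
  let r := Num.sqrt (s ^+ 2 + t ^+ 2) in
  normal_pdf 0 1 y * normal_pdf (s * y + m) t w =
  normal_pdf m r w * normal_pdf (s * (w - m) / r ^+ 2) (t / r) y.
Proof.
move=> s0 t0 r.
have r20 : 0 < s ^+ 2 + t ^+ 2 by rewrite addr_gt0// exprn_gt0.
have r0 : 0 < r by rewrite sqrtr_gt0.
have rE : r ^+ 2 = s ^+ 2 + t ^+ 2 by rewrite sqr_sqrtr// ltW.
rewrite !normal_pdfE ?oner_eq0 ?gt_eqF ?divr_gt0//=.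
rewrite mulrACA [RHS]mulrACA.
have peakE (a : R) : 0 < a -> normal_peak a = a^-1 * normal_peak 1.
  move=> a0; rewrite /normal_peak -mulrnAr sqrtrM ?sqr_ge0// sqrtr_sqr gtr0_norm//.
  by rewrite invfM expr1n mul1r.
congr (_ * _).
  rewrite (peakE t)// (peakE r)// (peakE (t / r)) ?divr_gt0// invf_div.
  rewrite mulrCA mulrACA [r^-1 * (r / t)]mulrA mulVf ?gt_eqF//.
  by rewrite mul1r.
rewrite /normal_fun -!expRD; congr expR.
rewrite expr_div_n rE subr0 expr1n.
set v := w - m; have -> : w - (s * y + m) = v - s * y by rewrite opprD addrCA addrC.
have tn : t ^+ 2 != 0 by rewrite gt_eqF// exprn_gt0.
have rn : s ^+ 2 + t ^+ 2 != 0 by rewrite gt_eqF.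
have n2E (x : R) : x *+ 2 = x * 2 by rewrite mulr_natr.
rewrite [t ^+ 2 *+ 2]n2E [(s ^+ 2 + t ^+ 2) *+ 2]n2E [(t ^+ 2 / _) *+ 2]n2E.
rewrite !mulNr -!opprD; congr (- _).
move: (t ^+ 2) tn rn => q tn rn; set D := s ^+ 2 + q.
rewrite !invfM invrK !mulrA -!mulrDl; congr (_ * _).
set i := q^-1; set j := D^-1.
have h1 : D * i = s ^+ 2 * i + 1 by rewrite /D mulrDl /i mulfV.
have Dj : D * j = 1 by rewrite mulfV.
have h2 : s ^+ 2 * i * j + j = i.
  by rewrite -[X in _ + X]mul1r -mulrDl -h1 mulrAC Dj mul1r.
have h3 : (y - s * v * j) ^+ 2 * i * D =
    D * i * y ^+ 2 - 2 * s * v * y * i * (D * j) + s ^+ 2 * v ^+ 2 * i * j * (D * j).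
  by rewrite !expr2; lra.
rewrite h3 Dj h1; have : v ^+ 2 * (s ^+ 2 * i * j + j) = v ^+ 2 * i by rewrite h2.
rewrite !expr2; lra.
Qed.

Lemma measurable_normal_pdf_prod m s t : t != 0 ->
  measurable_fun setT (fun z : R * R => normal_pdf 0 1 z.1 * normal_pdf (s * z.1 + m) t z.2).
Proof.
move=> t0; apply: measurable_funM.
  by apply: (measurableT_comp (measurable_normal_pdf 0 1)); exact: measurable_fst.
rewrite (_ : (fun _ => _) = (fun z => normal_pdf 0 t (z.2 - (s * z.1 + m)))).
  apply: (measurableT_comp (measurable_normal_pdf 0 t)).
  apply: measurable_funB; first exact: measurable_snd.
  by apply: measurable_funD => //; apply: measurable_funM => //; exact: measurable_fst.
by apply/funext => z; rewrite !normal_pdfE//= /normal_fun subr0.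
Qed.

Lemma measurable_normal_prob_mean m s t (B : set R) : 0 < t -> measurable B ->
  measurable_fun setT (fun y : R => normal_prob (s * y + m) t B).
Proof.
move=> t0 mB.
pose A := [set z : R * R | B (t * z.2 + (s * z.1 + m))].
have mA : measurable A.
  have mg : measurable_fun setT (fun z : R * R => t * z.2 + (s * z.1 + m)).
    apply: measurable_funD; first by apply: measurable_funM => //; exact: measurable_snd.
    by apply: measurable_funD => //; apply: measurable_funM => //; exact: measurable_fst.
  by have := mg measurableT B mB; rewrite setTI.
rewrite (_ : (fun _ => _) = normal_prob 0 1 \o xsection A).
  exact: measurable_fun_xsection.
apply/funext => y /=; rewrite -gauss1_gt0// (gauss1E _ (ltW t0) mB).
congr (normal_prob 0 1 _).
by apply/seteqP; split=> x; rewrite /xsection /A /= ?inE.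
Qed.

(** Tonelli swaps the integrals, and [normal_pdf_mul] splits the integrand into the target density
    at [w] and a probability density in [y], which integrates to 1. *)
Lemma normal_mixture m s t (B : set R) : 0 < s -> 0 < t -> measurable B ->
  (\int[normal_prob 0 1]_y normal_prob (s * y + m) t B =
   normal_prob m (Num.sqrt (s ^+ 2 + t ^+ 2)) B)%E.
Proof.
move=> s0 t0 mB; set r := Num.sqrt _.
pose f (z : measurableTypeR R * measurableTypeR R) : \bar R :=
  (normal_pdf 0 1 z.1 * normal_pdf (s * z.1 + m) t z.2 * \1_B z.2)%:E.
have f0 z : (0 <= f z)%E by rewrite lee_fin !mulr_ge0 ?normal_pdf_ge0.
have mf : measurable_fun setT f.
  apply/measurable_EFinP; apply: measurable_funM.
    by apply: measurable_normal_pdf_prod; rewrite gt_eqF.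
  apply: (@measurableT_comp _ _ _ _ _ _ (\1_B : R -> R)); last exact: measurable_snd.
  exact: measurable_indic.
have E y : normal_prob (s * y + m) t B =
    (\int[mu]_w (normal_pdf (s * y + m) t w * \1_B w)%:E)%E.
  rewrite /normal_prob integral_mkcond; apply: eq_integral => w _.
  by rewrite patchE indicE; case: ifP => _; rewrite ?mulr1 ?mulr0.
rewrite ge0_integral_normal_prob; last 2 first.
- by move=> y; rewrite measure_ge0.
- exact: measurable_normal_prob_mean.
transitivity (\int[mu]_y \int[mu]_w f (y, w))%E.
  apply: eq_integral => y _; rewrite E muleC -ge0_integralZl//=.
  - by apply: eq_integral => w _; rewrite /f/= -EFinM mulrA.
  - apply/measurable_EFinP; apply: measurable_funM; last exact: measurable_indic.
    exact: measurable_normal_pdf.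
  - by move=> w _; rewrite lee_fin mulr_ge0 ?normal_pdf_ge0.
  - by rewrite lee_fin normal_pdf_ge0.
rewrite (@fubini_tonelli _ _ _ _ _ mu mu f mf f0).
rewrite /normal_prob [RHS]integral_mkcond; apply: eq_integral => w _.
rewrite patchE /f/=; case: ifPn => wB; last first.
  rewrite integral0_eq// => y _; by rewrite indicE (negbTE wB) mulr0.
transitivity (\int[mu]_y ((normal_pdf m r w)%:E *
    (normal_pdf (s * (w - m) / r ^+ 2) (t / r) y)%:E))%E.
  by apply: eq_integral => y _; rewrite indicE wB mulr1 normal_pdf_mul// EFinM.
rewrite integralZl//; last exact: integrable_normal_pdf.
by rewrite integral_normal_pdf mule1.
Qed.

End convolution.

Section same_law.
Context (R : realType) d (E : measurableType d).
Context d1 (O1 : measurableType d1) (P1 : probability O1 R) (Z1 : O1 -> E).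
Context d2 (O2 : measurableType d2) (P2 : probability O2 R) (Z2 : O2 -> E).
Context (mZ1 : measurable_fun setT Z1) (mZ2 : measurable_fun setT Z2).
Hypothesis Z12 : forall B, measurable B -> P1 (Z1 @^-1` B) = P2 (Z2 @^-1` B).

Let X1 : {mfun O1 >-> E} := HB.pack Z1 (isMeasurableFun.Build _ _ _ _ Z1 mZ1).
Let X2 : {mfun O2 >-> E} := HB.pack Z2 (isMeasurableFun.Build _ _ _ _ Z2 mZ2).

Let eq_int (f : E -> \bar R) :
  (\int[distribution P1 X1]_y f y = \int[distribution P2 X2]_y f y)%E.
Proof. by apply: eq_measure_integral => A mA _; exact: Z12. Qed.

Lemma ge0_integral_same_law (f : E -> \bar R) : measurable_fun setT f ->
  (forall y, (0 <= f y)%E) -> (\int[P1]_x f (Z1 x) = \int[P2]_x f (Z2 x))%E.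
Proof.
move=> mf f0.
have := @ge0_integral_distribution _ _ _ _ _ P1 X1 f mf f0.
have := @ge0_integral_distribution _ _ _ _ _ P2 X2 f mf f0.
by rewrite eq_int => -> <-.
Qed.

Lemma integrable_same_law (f : E -> R) : measurable_fun setT f ->
  P2.-integrable setT (fun x => (f (Z2 x))%:E) ->
  P1.-integrable setT (fun x => (f (Z1 x))%:E).
Proof.
move=> mf /integrableP[_ fi]; apply/integrableP; split.
  by apply/measurable_EFinP; exact: (measurableT_comp mf).
move: fi; rewrite -(@ge0_integral_same_law (fun y => `|(f y)%:E|%E))//.
by apply: measurableT_comp => //; exact/measurable_EFinP.
Qed.

Lemma Rintegral_same_law (f : E -> R) : measurable_fun setT f ->
  P2.-integrable setT (fun x => (f (Z2 x))%:E) ->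
  \int[P1]_x f (Z1 x) = \int[P2]_x f (Z2 x).
Proof.
move=> mf fi2; have fi1 := integrable_same_law mf fi2.
have mfE : measurable_fun setT (fun y => (f y)%:E) by exact/measurable_EFinP.
have := @integral_distribution _ _ _ _ _ P1 X1 _ mfE fi1.
have := @integral_distribution _ _ _ _ _ P2 X2 _ mfE fi2.
by rewrite eq_int /Rintegral /= => -> ->.
Qed.

End same_law.

Section gaussian_law.
Context (R : realType).
Notation gam := (@normal_prob R 0 1).

Definition has_gauss d (O : measurableType d) (P : probability O R) (Z : O -> R)
    (m s : R) :=
  [/\ measurable_fun setT Z, 0 <= s &
    forall B, measurable B -> P (Z @^-1` B) = gauss1 m s B].

Let mT := measurableTypeR R.

Lemma measurable_affine (s m : R) : measurable_fun [set: mT] (fun x : R => s * x + m).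
Proof.
have : measurable_fun [set: R] (fun x : R => s * x + m).
  by apply: measurable_funD => //; exact: measurable_funM.
exact.
Qed.

Lemma integrable_sqr_gam : (gam : probability mT R).-integrable setT (fun x : R => (x ^+ 2)%:E).
Proof. exact: integrable_sqr_normal. Qed.

(** Kept as an abstract positive constant: variances are measured in this unit, and
    [ip P Z Z / gam2 R] is the squared deviation of a centred Gaussian [Z]. *)
Definition gam2 : R := \int[gam]_x (x ^+ 2).

Lemma integrable_of_sqr d (O : measurableType d) (P : probability O R) (Z : O -> R) :
  measurable_fun setT Z -> P.-integrable setT (fun x => (Z x ^+ 2)%:E) ->
  P.-integrable setT (fun x => (Z x)%:E).
Proof.
move=> mZ iZ.
have i1 : P.-integrable setT (fun x => (1 + Z x ^+ 2)%:E).
  rewrite (_ : (fun x => _) = (cst 1%:E \+ (fun x => (Z x ^+ 2)%:E))%E)//.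
  by apply: integrableD => //; exact: finite_measure_integrable_cst.
apply: (le_integrable measurableT _ _ i1); first exact/measurable_EFinP.
move=> x _ /=; rewrite lee_fin [leRHS]ger0_norm ?addr_ge0 ?sqr_ge0//.
by rewrite ler_norml; apply/andP; split; nra.
Qed.

Lemma integrable_gam : (gam : probability mT R).-integrable setT (fun x : R => x%:E).
Proof.
apply: (@integrable_of_sqr _ mT gam id); [exact: measurable_id|exact: integrable_sqr_gam].
Qed.

(** [ge0_integralN_normal] speaks of nonnegative functions, so $x$ is written as $f(x)-f(-x)$ with
    $f$ the positive part. *)
Lemma Rintegral_gam : \int[gam]_x x = 0.
Proof.
pose f (x : R) := Num.max x 0.
have cf : continuous f.
  by move=> x; apply: continuous_max; [exact: cvg_id|exact: cvg_cst].
have f0 x : 0 <= f x by rewrite /f le_max lexx orbT.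
have fN : \int[gam]_x f (- x) = \int[gam]_x f x.
  by rewrite /Rintegral ge0_integralN_normal.
have mf : measurable_fun [set: mT] f by exact: continuous_measurable_fun.
have i1 (g : R -> R) : measurable_fun [set: mT] g -> (forall x, `|g x| <= `|x|) ->
    (gam : probability mT R).-integrable setT (fun x => (g x)%:E).
  move=> mg gx; apply: (le_integrable measurableT _ _ integrable_gam).
    exact/measurable_EFinP.
  by move=> x _; rewrite /= lee_fin.
have E : \int[gam]_x x = \int[gam]_x (f x - f (- x)).
  apply: eq_Rintegral => x _; rewrite /f.
  have [x0|x0] := leP 0 x.
    by rewrite max_r ?oppr_le0// subr0.
  by rewrite max_l ?sub0r ?opprK// oppr_ge0 ltW.
rewrite E RintegralB//=; first by rewrite fN subrr.
- apply: i1 => // x; rewrite (ger0_norm (f0 _)) /f ge_max normr_ge0 andbT.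
  exact: ler_norm.
- apply: i1 => [|x].
    apply: (@continuous_measurable_fun R (fun x => f (- x))) => x.
    by apply: (@cvg_comp _ _ _ (fun x => - x) f); [apply: cvgN; exact: cvg_id|exact: cf].
  by rewrite (ger0_norm (f0 _)) /f ge_max normr_ge0 andbT -normrN; exact: ler_norm.
Qed.

Lemma gam2_gt0 : 0 < gam2.
Proof.
have [p p0 [pr _]] := normal_tails R.
apply: (lt_le_trans p0); rewrite -lee_fin /gam2 /Rintegral fineK; last first.
  exact: integrable_fin_num integrable_sqr_gam.
apply: (le_trans pr).
have mA : measurable [set x : mT | (1 <= x)%R] by rewrite -set_itvcy; exact: measurable_itv.
rewrite -[leLHS]mul1e -(integral_cst _ mA).
apply: (@le_trans _ _ (\int[gam]_(x in [set x : mT | (1 <= x)%R]) (x ^+ 2)%:E)%E).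
  apply: ge0_le_integral => //.
  - by apply/measurable_EFinP; apply: measurable_funTS; exact: measurable_funX.
  - by move=> x /= x1; rewrite lee_fin expr_ge1 ?(le_trans ler01).
apply: ge0_subset_integral => //.
  by apply/measurable_EFinP; exact: measurable_funX.
by move=> x _; rewrite lee_fin sqr_ge0.
Qed.

Section has_gauss.
Context d (O : measurableType d) (P : probability O R).
Implicit Types (Z : O -> R) (m s : R).

Lemma has_gauss_same_law Z m s : has_gauss P Z m s -> forall B, measurable B ->
  P (Z @^-1` B) = gam ((fun x : R => s * x + m) @^-1` B).
Proof. by move=> [_ s0 ZP] B mB; rewrite ZP// gauss1E. Qed.

Lemma Rintegral_has_gauss Z m s (f : R -> R) : has_gauss P Z m s ->
  measurable_fun setT f ->
  (gam : probability mT R).-integrable setT (fun x : R => (f (s * x + m))%:E) ->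
  \int[P]_x f (Z x) = \int[gam]_x f (s * x + m).
Proof.
move=> ZP mf fi; have [mZ _ _] := ZP.
exact: (@Rintegral_same_law _ _ _ _ _ P Z _ mT gam (fun x : R => s * x + m) mZ
  (measurable_affine s m) (has_gauss_same_law ZP) f mf fi).
Qed.

Lemma integrable_affine_sqr s m :
  (gam : probability mT R).-integrable setT (fun x : R => ((s * x + m) ^+ 2)%:E).
Proof.
rewrite (_ : (fun x => _) = (fun x : R => (s ^+ 2)%:E * (x ^+ 2)%:E +
   ((2 * s * m)%:E * x%:E + (m ^+ 2)%:E))%E); last first.
  apply/funext => x; rewrite -!EFinM -!EFinD; congr EFin.
  by rewrite sqrrD exprMn -addrA -mulr_natr; congr (_ + (_ + _)); lra.
apply: integrableD => //; first exact: integrableZl integrable_sqr_gam.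
apply: integrableD => //; first exact: integrableZl integrable_gam.
exact: finite_measure_integrable_cst.
Qed.

Lemma integrable_affine s m :
  (gam : probability mT R).-integrable setT (fun x : R => (s * x + m)%:E).
Proof.
apply: integrable_of_sqr; last exact: integrable_affine_sqr.
exact: measurable_affine.
Qed.

Lemma has_gauss_integrable_sqr Z m s : has_gauss P Z m s ->
  P.-integrable setT (fun x => (Z x ^+ 2)%:E).
Proof.
move=> ZP; have [mZ _ _] := ZP.
apply: (@integrable_same_law _ _ _ _ _ P Z _ mT gam (fun x : R => s * x + m) mZ
  (measurable_affine s m) (has_gauss_same_law ZP) (fun x => x ^+ 2)).
  exact: measurable_funX.
exact: integrable_affine_sqr.
Qed.

Lemma has_gauss_integrable Z m s : has_gauss P Z m s ->
  P.-integrable setT (fun x => (Z x)%:E).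
Proof.
move=> ZP; have [mZ _ _] := ZP; apply: integrable_of_sqr => //.
exact: has_gauss_integrable_sqr ZP.
Qed.

Lemma has_gauss_mean Z m s : has_gauss P Z m s -> \int[P]_x Z x = m.
Proof.
move=> ZP; rewrite (Rintegral_has_gauss (f := id) ZP)//.
  rewrite RintegralD//=.
  - rewrite RintegralZl// ?Rintegral_gam ?mulr0 ?add0r; last exact: integrable_gam.
    by rewrite Rintegral_cst// [X in fine X]probability_setT mulr1.
  - exact: integrableZl integrable_gam.
  - exact: finite_measure_integrable_cst.
exact: integrable_affine.
Qed.

Lemma has_gauss_var Z s : has_gauss P Z 0 s -> \int[P]_x (Z x ^+ 2) = s ^+ 2 * gam2.
Proof.
move=> ZP; rewrite (Rintegral_has_gauss (f := fun x => x ^+ 2) ZP).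
- rewrite -RintegralZl//; last exact: integrable_sqr_gam.
  by apply: eq_Rintegral => x _; rewrite addr0 exprMn.
- exact: measurable_funX.
- exact: integrable_affine_sqr.
Qed.

Lemma has_gauss_shift Z m s c : has_gauss P Z m s ->
  has_gauss P (fun x => Z x + c) (m + c) s.
Proof.
move=> ZP; have [mZ s0 _] := ZP; split=> //; first exact: measurable_funD.
move=> B mB; rewrite gauss1E//.
have mBc : measurable ((fun x : R => x + c) @^-1` B).
  rewrite -[X in measurable X]setTI.
  have mxc : measurable_fun [set: R] (fun x : R => x + c) by exact: measurable_funD.
  exact: mxc.
rewrite -[LHS]/(P (Z @^-1` ((fun x : R => x + c) @^-1` B))).
rewrite (has_gauss_same_law ZP)//; congr (gam _).
by apply/seteqP; split=> x /=; rewrite addrA.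
Qed.

(** Bounded and continuous, hence fit for bounded convergence, and equal to 1 as soon as $|z|\ge A$:
    its mean measures tightness where no moment bound is at hand. *)
Definition trunc_abs (A z : R) : R := Num.min 1 (`|z| / A).

Lemma trunc_abs_le1 A z : 0 < A -> 0 <= trunc_abs A z <= 1.
Proof.
by move=> A0; rewrite /trunc_abs le_min ler01 ge_min lexx divr_ge0// ltW.
Qed.

Lemma continuous_trunc_abs A : continuous (trunc_abs A).
Proof.
move=> z; apply: (@continuous_min R R (fun=> 1) (fun z => `|z| / A)); first exact: cvg_cst.
by apply: cvgM; [apply: cvg_norm; exact: cvg_id|exact: cvg_cst].
Qed.

Lemma measurable_trunc_abs A : measurable_fun setT (trunc_abs A).
Proof. by apply: continuous_measurable_fun; exact: continuous_trunc_abs. Qed.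

(** On the tail where $|x|\ge1$ and $x$ has the sign of [m], $|sx+m|=s|x|+|m|\ge s+|m|$. If [s] or
    $|m|$ were at least [A], the truncation would equal 1 there and its mean would be at least
    [p]. *)
Lemma has_gauss_trunc_abs (p : R) :
  (p%:E <= gam [set x : R | (1 <= x)%R])%E ->
  (p%:E <= gam [set x : R | (x <= -1)%R])%E ->
  forall Z m s A, has_gauss P Z m s -> 0 < A -> \int[P]_x trunc_abs A (Z x) < p ->
  `|m| < A /\ s < A.
Proof.
move=> pr pl Z m s A ZP A0 Zp; have [mZ s0 _] := ZP.
have ib : (gam : probability mT R).-integrable setT
    (fun x : R => (trunc_abs A (s * x + m))%:E).
  apply: (@bounded_integrable _ mT R gam _ 1).
    exact: (measurableT_comp (measurable_trunc_abs A) (measurable_affine s m)).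
  move=> x; have /andP[h0 h1] := trunc_abs_le1 (s * x + m) A0.
  by rewrite ger0_norm.
rewrite (Rintegral_has_gauss ZP (measurable_trunc_abs A) ib) in Zp.
have H (T : set R) : measurable T -> (p%:E <= gam T)%E ->
    ~ (forall x, T x -> A <= `|s * x + m|).
  move=> mTT pT h; move: Zp; apply/negP; rewrite -leNgt -lee_fin.
  rewrite /Rintegral fineK; last exact: integrable_fin_num ib.
  have gT : (\int[gam]_(x in T) 1%:E = gam T)%E by rewrite integral_cst// mul1e.
  apply: (le_trans pT); rewrite -gT.
  apply: (@le_trans _ _ (\int[gam]_(x in T) (trunc_abs A (s * x + m))%:E)%E).
    apply: ge0_le_integral => //.
    - by apply: measurable_funTS; exact: (measurable_int _ ib).
    - move=> x /h hx; rewrite lee_fin /trunc_abs le_min lexx/=.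
      by rewrite ler_pdivlMr// mul1r.
  apply: ge0_subset_integral => //; first exact: (measurable_int _ ib).
  by move=> x _; rewrite lee_fin; have /andP[] := trunc_abs_le1 (s * x + m) A0.
have m1 : measurable [set x : R | (1 <= x)%R] by rewrite -set_itvcy; exact: measurable_itv.
have m2 : measurable [set x : R | (x <= -1)%R] by rewrite -set_itvNyc; exact: measurable_itv.
have [m0|m0] := leP 0 m.
  have mA : ~~ ((A <= m) || (A <= s)).
    apply/negP => /orP h; apply: (H _ m1 pr) => x /= x1.
    by rewrite ger0_norm; [case: h => h; nra|nra].
  by move: mA; rewrite negb_or -!ltNge ger0_norm// => /andP[].
have mA : ~~ ((A <= - m) || (A <= s)).
  apply/negP => /orP h; apply: (H _ m2 pl) => x /= x1.
  by rewrite ler0_norm; [case: h => h; nra|nra].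
by move: mA; rewrite negb_or -!ltNge ltr0_norm// => /andP[].
Qed.

End has_gauss.
End gaussian_law.

Section gaussian_sum.
Context (R : realType).
Context d1 (O1 : measurableType d1) (P1 : probability O1 R) (U : O1 -> R) (m s : R).
Context d2 (O2 : measurableType d2) (P2 : probability O2 R) (V : O2 -> R) (t : R).
Hypothesis (Us : has_gauss P1 U m s) (Vt : has_gauss P2 V 0 t).
Notation gam := (@normal_prob R 0 1).
Let mT := measurableTypeR R.

Let measurable_gauss1_mean (B : set R) : measurable B ->
  measurable_fun [set: R] (fun u : R => gauss1 u t B).
Proof.
move=> mB; have [_ t0 _] := Vt.
pose A := [set z : R * R | B (t * z.2 + z.1)].
have mA : measurable A.
  have mg : measurable_fun setT (fun z : R * R => t * z.2 + z.1).
    apply: measurable_funD; last exact: measurable_fst.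
    by apply: measurable_funM => //; exact: measurable_snd.
  by have := mg measurableT B mB; rewrite setTI.
rewrite (_ : (fun _ => _) = normal_prob 0 1 \o xsection A).
  exact: measurable_fun_xsection.
apply/funext => y /=; rewrite (gauss1E _ t0 mB).
congr (normal_prob 0 1 _).
by apply/seteqP; split=> x; rewrite /xsection /A /= ?inE.
Qed.

(** Given the first coordinate, the sum is [V] shifted by a constant, so its law is a mixture of
    normal laws. [normal_mixture] treats $s,t>0$; the degenerate cases are settled separately, as
    Dirac laws have no density. *)
Lemma has_gauss_add_indep :
  has_gauss (P1 \x P2)%E (fun z => U z.1 + V z.2) m (Num.sqrt (s ^+ 2 + t ^+ 2)).
Proof.
have [mU s0 _] := Us; have [mV t0 _] := Vt.
have mW : measurable_fun setT (fun z => U z.1 + V z.2).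
  by apply: measurable_funD; [exact: (measurableT_comp mU measurable_fst)|
    exact: (measurableT_comp mV measurable_snd)].
split=> // B mB.
have E1 : (P1 \x P2)%E ((fun z => U z.1 + V z.2) @^-1` B) = (\int[P1]_x gauss1 (U x) t B)%E.
  apply: eq_integral => x _ /=.
  have [_ _ /(_ B mB)] := has_gauss_shift (U x) Vt; rewrite add0r => <-.
  by congr (P2 _); apply/seteqP; split=> y; rewrite /xsection /= ?inE /= addrC.
transitivity (\int[P1]_x gauss1 (U x) t B)%E; first exact: E1.
rewrite (@ge0_integral_same_law R _ R _ _ P1 U _ mT gam (fun x : R => s * x + m) mU
   (measurable_affine s m) (has_gauss_same_law Us) (fun u : R => gauss1 u t B)); last 2 first.
- exact: measurable_gauss1_mean.
- by move=> y; rewrite gauss1E.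
move: t0; rewrite le_eqVlt => /predU1P[t00|t0].
  rewrite -t00 expr0n/= addr0 sqrtr_sqr ger0_norm// (gauss1E m s0 mB).
  have mB' : measurable ((fun x : mT => s * x + m) @^-1` B).
    by rewrite -[X in measurable X]setTI; exact: measurable_affine.
  have := integral_indic gam measurableT mB'; rewrite setIT => <-.
  apply: eq_integral => x _; rewrite /gauss1 eqxx diracE indicE.
  by congr (_%:R%:E); apply/idP/idP => /set_mem h; exact/mem_set.
move: s0; rewrite le_eqVlt => /predU1P[s00|s0].
  rewrite -s00 expr0n/= add0r sqrtr_sqr gtr0_norm//.
  rewrite (eq_integral (cst (gauss1 m t B))) => [|x _]; last by rewrite mul0r add0r.
  have fm : (gauss1 m t B) \is a fin_num.
    rewrite (gauss1E m (ltW t0) mB); apply: fin_num_measure.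
    by rewrite -[X in measurable X]setTI; exact: measurable_affine.
  by rewrite -(fineK fm) integral_cst// [X in (_ * X)%E]probability_setT mule1.
rewrite gauss1_gt0 ?sqrtr_gt0 ?addr_gt0 ?exprn_gt0// -normal_mixture//.
by apply: eq_integral => x _; rewrite gauss1_gt0.
Qed.
End gaussian_sum.

Section real_law.
Context (R : realType).
Context d1 (O1 : measurableType d1) (P1 : probability O1 R) (Z1 : O1 -> R).
Context d2 (O2 : measurableType d2) (P2 : probability O2 R) (Z2 : O2 -> R).

Lemma real_cos_uniqueness : measurable_fun setT Z1 -> measurable_fun setT Z2 ->
  (forall a b, \int[P1]_x cos (a * Z1 x + b) = \int[P2]_x cos (a * Z2 x + b)) ->
  forall B, measurable B -> P1 (Z1 @^-1` B) = P2 (Z2 @^-1` B).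
Proof.
move=> mZ1 mZ2 H B mB.
have cosE l b : \int[P1]_x cos (lin (fun _ : unit => id) l (Z1 x) + b) =
    \int[P2]_x cos (lin (fun _ : unit => id) l (Z2 x) + b).
  pose a : R := \sum_(p <- l) p.1.
  have linE : lin (fun _ : unit => id) l = (fun x => a * x).
    by apply/funext => x; rewrite /lin mulr_suml.
  by rewrite linE; exact: H.
exact: (@cos_uniqueness R unit _ R (fun _ x => x) (fun=> @measurable_id _ _ _) _ O1 P1 Z1
  _ O2 P2 Z2 mZ1 mZ2 cosE B mB (borel_cylinder mB)).
Qed.

Lemma measurable_cos_affine d (O : measurableType d) (Z : O -> R) (a b : R) :
  measurable_fun setT Z -> measurable_fun setT (fun x => cos (a * Z x + b)).
Proof.
move=> mZ; apply: (measurableT_comp (@measurable_cos R)).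
by apply: measurable_funD => //; exact: measurable_funM.
Qed.
End real_law.

(** * Almost sure limits of Gaussian variables *)

Section gaussian_limit.
Context (R : realType) d (O : measurableType d) (P : probability O R).
Notation gam := (@normal_prob R 0 1).
Let mT := measurableTypeR R.
Implicit Types (Z : O -> R).

Lemma trunc_abs_cvg (Z_ : nat -> O -> R) Z A : 0 < A ->
  (forall n, measurable_fun setT (Z_ n)) -> measurable_fun setT Z ->
  {ae P, forall x, Z_ n x @[n --> \oo] --> Z x} ->
  \int[P]_x trunc_abs A (Z_ n x) @[n --> \oo] --> \int[P]_x trunc_abs A (Z x).
Proof.
move=> A0 mZ_ mZ Z_Z.
apply: (@bounded_cvg_Rintegral _ _ _ P (fun n x => trunc_abs A (Z_ n x)) _ 1) => [n||n x|].
- exact: (measurableT_comp (measurable_trunc_abs A) (mZ_ n)).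
- exact: (measurableT_comp (measurable_trunc_abs A) mZ).
- by have /andP[h0 h1] := trunc_abs_le1 (Z_ n x) A0; rewrite ger0_norm.
- apply: filterS Z_Z => x Zx.
  by apply: (@cvg_comp _ _ _ (fun n => Z_ n x) (trunc_abs A)); [exact: Zx|exact: continuous_trunc_abs].
Qed.

Lemma trunc_abs_cvg0 Z : measurable_fun setT Z ->
  \int[P]_x trunc_abs k.+1%:R (Z x) @[k --> \oo] --> (0 : R).
Proof.
move=> mZ.
have -> : (0 : R) = \int[P]_x (fun=> 0 : R) x by rewrite Rintegral_cst// mul0r.
apply: (@bounded_cvg_Rintegral _ _ _ P (fun k x => trunc_abs k.+1%:R (Z x)) _ 1) => [n||n x|].
- exact: (measurableT_comp (measurable_trunc_abs _) mZ).
- exact: measurable_cst.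
- by have /andP[h0 h1] := trunc_abs_le1 (Z x) (ltr0Sn R n); rewrite ger0_norm.
- apply: aeW => x.
  have c : `|Z x| * k.+1%:R^-1 @[k --> \oo] --> (0 : R).
    rewrite -[X in _ --> X](mulr0 `|Z x|); apply: cvgM; first exact: cvg_cst.
    exact: cvg_invS.
  apply: (@squeeze_cvgr _ _ _ _ (fun=> 0) _ _ _ _ _ c); last exact: cvg_cst.
  apply: nearW => k; have /andP[-> _] := trunc_abs_le1 (Z x) (ltr0Sn R k).
  by rewrite /trunc_abs /= ge_min lexx orbT.
Qed.

(** At every level [A] the truncated means tend to 0; once below the tail constant [p] they force
    both parameters below [A]. *)
Lemma has_gauss_cvg0 (Z_ : nat -> O -> R) m_ s_ :
  (forall n, has_gauss P (Z_ n) (m_ n) (s_ n)) ->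
  {ae P, forall x, Z_ n x @[n --> \oo] --> (0 : R)} ->
  (m_ @ \oo --> (0 : R)) /\ (s_ @ \oo --> (0 : R)).
Proof.
move=> Zg Z0; have [p p0 [pr pl]] := normal_tails R.
have H A : 0 < A -> \forall n \near \oo, `|m_ n| < A /\ s_ n < A.
  move=> A0.
  have := @trunc_abs_cvg Z_ (fun=> 0) A A0 (fun n => let: And3 h _ _ := Zg n in h) (measurable_cst _) Z0.
  have -> : \int[P]_x trunc_abs A ((fun=> 0) x) = 0.
    rewrite Rintegral_cst// /trunc_abs normr0 mul0r.
    by rewrite min_r ?ler01// mul0r.
  move=> /cvgrPdist_lt/(_ _ p0); apply: filterS => n; rewrite sub0r normrN => hn.
  apply: (has_gauss_trunc_abs pr pl (Zg n) A0).
  exact: le_lt_trans (ler_norm _) hn.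
split; apply/cvgrPdist_lt => e /H; apply: filterS => n [hm hs]; rewrite sub0r normrN//.
by rewrite ger0_norm//; have [] := Zg n.
Qed.

(** Boundedness of [s_] comes from tightness: the truncated mean of [Z] is below [p] at some high
    level, and so are eventually those of [Z_]. A subsequence of [s_] then converges, and cosine
    integrals identify the limit law. *)
Lemma has_gauss_cvg (Z_ : nat -> O -> R) Z s_ :
  (forall n, has_gauss P (Z_ n) 0 (s_ n)) -> measurable_fun setT Z ->
  {ae P, forall x, Z_ n x @[n --> \oo] --> Z x} ->
  exists s, has_gauss P Z 0 s.
Proof.
move=> Zg mZ Z_Z; have [p p0 [pr pl]] := normal_tails R.
have mZ_ n : measurable_fun setT (Z_ n) by have [] := Zg n.
have s_ge0 n : 0 <= s_ n by have [] := Zg n.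
have [k kp] : exists k : nat, \int[P]_x trunc_abs k.+1%:R (Z x) < p.
  have /cvgrPdist_lt/(_ _ p0)[k _ /(_ k (leqnn _))] := trunc_abs_cvg0 mZ.
  by rewrite sub0r normrN => h; exists k; exact: le_lt_trans (ler_norm _) h.
have [n0 s_lt] : exists n0, forall n, (n0 <= n)%N -> s_ n < k.+1%:R.
  have /cvgr_lt/(_ _ kp)[n0 _ h] := trunc_abs_cvg (ltr0Sn R k) mZ_ mZ Z_Z.
  exists n0 => n n0n.
  by have [] := has_gauss_trunc_abs pr pl (Zg n) (ltr0Sn R k) (h n n0n).
have bs : bounded_fun (fun n => s_ (n0 + n)%N).
  exists k.+1%:R; split; first exact: num_real.
  move=> x kx n _ /=; rewrite ger0_norm// ltW// (lt_trans _ kx)// s_lt//.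
  exact: leq_addr.
have [f incf /cvg_ex[/= s sE]] := bolzano_weierstrass bs.
have fge n : (n <= f n)%N.
  elim: n => // n ih; apply: (leq_ltn_trans ih).
  by rewrite ltnNge -leEnat incf -ltnNge.
have s0 : 0 <= s by apply: (cvgr_to_ge sE); apply: nearW => n /=.
have foo : (n0 + f n)%N @[n --> \oo] --> \oo.
  apply/cvgnyPge => A; exists A => // n /= An.
  exact: leq_trans An (leq_trans (fge n) (leq_addl _ _)).
exists s; split=> // B mB.
rewrite gauss1E//.
apply: (@real_cos_uniqueness _ _ _ P Z _ mT gam (fun x : R => s * x + 0) mZ
  (measurable_affine s 0)) => // a b.
have bc d' (O' : measurableType d') (P' : probability O' R) (W_ : nat -> O' -> R) (W : O' -> R) :
    (forall n, measurable_fun setT (W_ n)) -> measurable_fun setT W ->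
    {ae P', forall x, W_ n x @[n --> \oo] --> W x} ->
    \int[P']_x cos (a * W_ n x + b) @[n --> \oo] --> \int[P']_x cos (a * W x + b).
  move=> mW_ mW W_W.
  apply: (@bounded_cvg_Rintegral _ _ _ P' (fun n x => cos (a * W_ n x + b)) _ 1) => [n||n x|].
  - exact: measurable_cos_affine.
  - exact: measurable_cos_affine.
  - exact: cos_max.
  - apply: filterS W_W => x Wx.
    apply: (@cvg_comp _ _ _ (fun n => a * W_ n x + b) (@cos R)); last exact: continuous_cos.
    by apply: cvgD; [apply: cvgM; [exact: cvg_cst|exact: Wx]|exact: cvg_cst].
apply: (@cvg_unique _ _ (\int[P]_x cos (a * Z_ (n0 + f n)%N x + b) @[n --> \oo])) => //.
  apply: bc => //; apply: filterS Z_Z => x Zx.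
  exact: (@cvg_comp _ _ _ _ (fun n => Z_ n x) _ _ _ foo Zx).
have E n : \int[P]_x cos (a * Z_ (n0 + f n)%N x + b) =
    \int[gam]_x cos (a * (s_ (n0 + f n)%N * x + 0) + b).
  apply: (Rintegral_has_gauss (f := fun y => cos (a * y + b)) (Zg _)).
    exact: measurable_cos_affine.
  apply: (@bounded_integrable _ mT R gam _ 1); last by move=> x; exact: cos_max.
  by apply: measurable_cos_affine; exact: measurable_affine.
rewrite (_ : (fun n => _) = (fun n => \int[gam]_x cos (a * (s_ (n0 + f n)%N * x + 0) + b)));
  last by apply/funext => n; exact: E.
apply: (bc _ mT gam (fun n x => s_ (n0 + f n)%N * x + 0)) => [n||].
- exact: measurable_affine.
- exact: measurable_affine.
- by apply: aeW => x; apply: cvgD; [apply: cvgM; [exact: sE|exact: cvg_cst]|exact: cvg_cst].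
Qed.

End gaussian_limit.

(** * Gaussian spaces *)

Section inner_product.
Context (R : realType) d (O : measurableType d) (P : probability O R).
Implicit Types (U V W : O -> R).

Definition ip U V : R := \int[P]_x (U x * V x).

(** Joint Gaussianity is encoded by linearity: every combination of members is again a
    one-dimensional centred Gaussian variable. Members are functions, not classes modulo null
    sets. *)
Definition gauss_space (G : set (O -> R)) :=
  [/\ forall Z, G Z -> exists s, has_gauss P Z 0 s,
      G (fun=> 0),
      forall U V, G U -> G V -> G (fun x => U x + V x) &
      forall c U, G U -> G (fun x => c * U x)].

Lemma ipC U V : ip U V = ip V U.
Proof. by apply: eq_Rintegral => x _; rewrite mulrC. Qed.

Section fixed_space.
Context (G : set (O -> R)) (hG : gauss_space G).

Lemma gs_gauss Z : G Z -> exists s, has_gauss P Z 0 s.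
Proof. by have [h _ _ _] := hG; exact: h. Qed.

Lemma gs0 : G (fun=> 0). Proof. by have [] := hG. Qed.

Lemma gsD U V : G U -> G V -> G (fun x => U x + V x).
Proof. by have [_ _ h _] := hG; exact: h. Qed.

Lemma gsZ c U : G U -> G (fun x => c * U x).
Proof. by have [_ _ _ h] := hG; exact: h. Qed.

Lemma gsB U V : G U -> G V -> G (fun x => U x - V x).
Proof.
move=> GU GV; rewrite (_ : (fun x => _) = (fun x => U x + (-1) * V x)).
  by apply: gsD => //; exact: gsZ.
by apply/funext => x; rewrite mulN1r.
Qed.

Lemma gs_sum (I : Type) (r : seq I) (F : I -> O -> R) :
  (forall i, G (F i)) -> G (fun x => \sum_(i <- r) F i x).
Proof.
move=> GF; elim: r => [|i r ih].
  by rewrite (_ : (fun x => _) = (fun=> 0))//; [exact: gs0|apply/funext => x; rewrite big_nil].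
rewrite (_ : (fun x => _) = (fun x => F i x + \sum_(i <- r) F i x)); first exact: gsD.
by apply/funext => x; rewrite big_cons.
Qed.

Lemma gs_measurable U : G U -> measurable_fun setT U.
Proof. by move=> /gs_gauss[s []]. Qed.

Lemma gs_integrable_sqr U : G U -> P.-integrable setT (fun x => (U x ^+ 2)%:E).
Proof. by move=> /gs_gauss[s h]; exact: has_gauss_integrable_sqr h. Qed.

Lemma gs_integrableM U V : G U -> G V -> P.-integrable setT (fun x => (U x * V x)%:E).
Proof.
move=> GU GV.
have i1 : P.-integrable setT (fun x => (U x ^+ 2 + V x ^+ 2)%:E).
  rewrite (_ : (fun x => _) = ((fun x => (U x ^+ 2)%:E) \+ (fun x => (V x ^+ 2)%:E))%E)//.
  by apply: integrableD => //; exact: gs_integrable_sqr.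
apply: (le_integrable measurableT _ _ i1).
  by apply/measurable_EFinP; apply: measurable_funM; exact: gs_measurable.
move=> x _ /=; rewrite lee_fin [leRHS]ger0_norm ?addr_ge0 ?sqr_ge0//.
by rewrite ler_norml; apply/andP; split; nra.
Qed.

Lemma ipDl U V W : G U -> G V -> G W -> ip (fun x => U x + V x) W = ip U W + ip V W.
Proof.
move=> GU GV GW; rewrite /ip -RintegralD//=; last 2 first.
- exact: gs_integrableM.
- exact: gs_integrableM.
by apply: eq_Rintegral => x _; rewrite mulrDl.
Qed.

Lemma ipZl c U W : G U -> G W -> ip (fun x => c * U x) W = c * ip U W.
Proof.
move=> GU GW; rewrite /ip -RintegralZl//=; last exact: gs_integrableM.
by apply: eq_Rintegral => x _; rewrite mulrA.
Qed.

Lemma ip0l W : ip (fun=> 0) W = 0.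
Proof.
rewrite /ip (_ : (fun x => _) = (fun=> 0)); first by rewrite Rintegral_cst// mul0r.
by apply/funext => x; rewrite mul0r.
Qed.

Lemma ipBl U V W : G U -> G V -> G W -> ip (fun x => U x - V x) W = ip U W - ip V W.
Proof.
move=> GU GV GW; rewrite (_ : (fun x => _) = (fun x => U x + (-1) * V x)).
  by rewrite (ipDl GU (gsZ (-1) GV) GW) (ipZl _ GV GW) mulN1r.
by apply/funext => x; rewrite mulN1r.
Qed.

Lemma ipBr U V W : G U -> G V -> G W -> ip W (fun x => U x - V x) = ip W U - ip W V.
Proof. by move=> GU GV GW; rewrite ipC ipBl// ipC [ip V W]ipC. Qed.

Lemma ip_suml (I : Type) (r : seq I) (F : I -> O -> R) W :
  (forall i, G (F i)) -> G W ->
  ip (fun x => \sum_(i <- r) F i x) W = \sum_(i <- r) ip (F i) W.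
Proof.
move=> GF GW; elim: r => [|i r ih].
  rewrite big_nil -[RHS](ip0l W); congr (ip _ W).
  by apply/funext => x; rewrite big_nil.
rewrite big_cons -ih -ipDl//; last exact: gs_sum.
by congr (ip _ W); apply/funext => x; rewrite big_cons.
Qed.

Lemma ip_ge0 U : 0 <= ip U U.
Proof. by apply: Rintegral_ge0 => x _; rewrite -expr2 sqr_ge0. Qed.

Lemma ip_has_gauss U s : has_gauss P U 0 s -> ip U U = s ^+ 2 * gam2 R.
Proof. by move=> h; rewrite -(has_gauss_var h). Qed.

Lemma gs_has_gauss U : G U -> has_gauss P U 0 (Num.sqrt (ip U U / gam2 R)).
Proof.
move=> /gs_gauss[s h]; rewrite (ip_has_gauss h) mulfK ?gt_eqF ?gam2_gt0//.
by have [_ s0 _] := h; rewrite sqrtr_sqr ger0_norm.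
Qed.

Lemma ip_sub_sqr U V : G U -> G V ->
  ip (fun x => U x - V x) (fun x => U x - V x) = ip U U - 2 * ip U V + ip V V.
Proof.
move=> GU GV; have GUV := gsB GU GV.
by rewrite ipBl// !ipBr// [ip V U]ipC; lra.
Qed.

Lemma cauchy_schwarz_ip U V : G U -> G V -> `|ip U V| <= Num.sqrt (ip U U) * Num.sqrt (ip V V).
Proof.
move=> GU GV; rewrite -sqrtrM ?ip_ge0// -sqrtr_sqr ler_wsqrtr//.
have [V0|V0] := eqVneq (ip V V) 0.
  rewrite V0 mulr0.
  (* When [V] has norm 0 the quadratic in [c] becomes affine, and an affine function bounded below
     has slope 0; the value of [c] used below would make it negative. *)
  have H (c : R) : 0 <= ip U U - 2 * c * ip U V.
    have := ip_ge0 (fun x => U x - c * V x); rewrite ip_sub_sqr//; last exact: gsZ.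
    rewrite ipZl//; last exact: gsZ.
    by rewrite ![ip _ (fun x => c * V x)]ipC !ipZl// V0 [ip V U]ipC; lra.
  have [->|UV0] := eqVneq (ip U V) 0; first by rewrite expr0n.
  have := H ((ip U U + 1) / ip U V); rewrite -mulrA divfK//.
  have := ip_ge0 U; lra.
have Vp : 0 < ip V V by rewrite lt_neqAle eq_sym V0 ip_ge0.
pose c := ip U V / ip V V.
have := ip_ge0 (fun x => U x - c * V x); rewrite ip_sub_sqr//; last exact: gsZ.
rewrite ipZl//; last exact: gsZ.
rewrite ![ip _ (fun x => c * V x)]ipC !ipZl// [ip V U]ipC.
have -> : c * (c * ip V V) = c * ip U V by rewrite /c divfK.
have E : ip U V ^+ 2 = c * ip U V * ip V V by rewrite mulrAC /c divfK// expr2.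
rewrite E ler_pM2r// => h; rewrite -subr_ge0; move: h; set a := c * _; lra.
Qed.

Lemma ip_chebyshev U e : G U -> 0 < e ->
  (P [set x | (e < `|U x|)%R] <= (ip U U / e ^+ 2)%:E)%E.
Proof.
move=> GU e0; have mU := gs_measurable GU.
have mA : measurable [set x | (e < `|U x|)%R].
  have : measurable_fun setT (fun x => `|U x|) by exact: measurableT_comp.
  move=> /(_ measurableT `]e, +oo[%classic (measurable_itv _)); rewrite setTI.
  by congr (measurable _); apply/seteqP; split=> x /=; rewrite in_itv/= andbT.
have e20 : 0 < e ^+ 2 by rewrite exprn_gt0.
rewrite EFinM lee_pdivlMr//.
have sqE : ((ip U U)%:E = \int[P]_x (U x ^+ 2)%:E)%E.
  rewrite /ip /Rintegral fineK; last exact: integrable_fin_num (gs_integrableM GU GU).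
  by apply: eq_integral => x _; rewrite expr2.
have mU2 : measurable_fun setT (fun x => (U x ^+ 2)%:E).
  by apply/measurable_EFinP; exact: measurable_funX.
rewrite sqE muleC -(integral_cst _ mA).
apply: (@le_trans _ _ (\int[P]_(x in [set x | (e < `|U x|)%R]) (U x ^+ 2)%:E)%E).
  apply: ge0_le_integral => //.
  - by move=> x _; rewrite lee_fin ltW.
  - exact: measurable_funTS.
  - move=> x /= /ltW eU; rewrite lee_fin -[U x ^+ 2]real_normK ?num_real//.
    by rewrite lerXn2r ?nnegrE// ltW.
apply: ge0_subset_integral => //.
by move=> x _; rewrite lee_fin sqr_ge0.
Qed.

(** A member of [G] with norm 0 has the Dirac law at 0, so it is nonzero on a null set only. *)
Lemma ip_eq0_ae U V : G U -> G V ->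
  ip (fun x => U x - V x) (fun x => U x - V x) = 0 -> {ae P, forall x, U x = V x}.
Proof.
move=> GU GV UV0; have := gs_has_gauss (gsB GU GV); rewrite UV0 mul0r sqrtr0.
move=> [mUV _ /(_ (~` [set 0]))]; rewrite /gauss1 eqxx diracE memNset; last by move=> /=; exact.
move=> h; exists ((fun x => U x - V x) @^-1` (~` [set 0])); split.
- by rewrite -[X in measurable X]setTI; apply: mUV => //; exact: measurableC.
- by rewrite h//; exact: measurableC.
- by move=> x /= /eqP UV; apply/eqP; rewrite subr_eq0.
Qed.


End fixed_space.
End inner_product.

Section gauss_closure.
Context (R : realType) d (O : measurableType d) (P : probability O R).
Context (G : set (O -> R)) (hG : gauss_space P G).

(** Makes room for the limits of the projections and thus for the residual. Measurability is
    demanded apart, since an almost everywhere limit leaves the values on a null set free. *)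
Definition gauss_closure : set (O -> R) := [set Z : O -> R | measurable_fun setT Z /\
  exists2 Z_ : nat -> O -> R, (forall n, G (Z_ n)) &
    {ae P, forall x, Z_ n x @[n --> \oo] --> Z x}].

Lemma sub_gauss_closure : G `<=` gauss_closure.
Proof.
move=> Z GZ; split; first exact: (gs_measurable hG GZ).
by exists (fun=> Z) => //; apply: aeW => x; exact: cvg_cst.
Qed.

Lemma gauss_closure_space : gauss_space P gauss_closure.
Proof.
split.
- move=> Z [mZ [Z_ GZ_ Z_Z]].
  exact: (has_gauss_cvg (fun n => gs_has_gauss hG (GZ_ n)) mZ Z_Z).
- by apply: sub_gauss_closure; exact: (gs0 hG).
- move=> U V [mU [U_ GU_ U_U]] [mV [V_ GV_ V_V]]; split; first exact: measurable_funD.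
  exists (fun n x => U_ n x + V_ n x) => [n|]; first exact: (gsD hG).
  by apply: filterS2 U_U V_V => x; exact: cvgD.
- move=> c U [mU [U_ GU_ U_U]]; split; first exact: measurable_funM.
  exists (fun n x => c * U_ n x) => [n|]; first exact: (gsZ hG).
  by apply: filterS U_U => x Ux; apply: cvgM => //; exact: cvg_cst.
Qed.

(** Within a Gaussian space almost sure convergence implies convergence in $L^2$: the differences
    are centred Gaussian, and [has_gauss_cvg0] drives their deviations to 0. *)
Lemma gs_cvg_ip (Z_ : nat -> O -> R) Z : (forall n, G (Z_ n)) -> G Z ->
  {ae P, forall x, Z_ n x @[n --> \oo] --> Z x} ->
  ip P (fun x => Z_ n x - Z x) (fun x => Z_ n x - Z x) @[n --> \oo] --> (0 : R).
Proof.
move=> GZ_ GZ Z_Z.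
pose D n := fun x => Z_ n x - Z x.
have GD n : G (D n) by exact: (gsB hG).
have D0 : {ae P, forall x, D n x @[n --> \oo] --> (0 : R)}.
  apply: filterS Z_Z => x Zx; rewrite /D -[X in _ --> X](subrr (Z x)).
  by apply: cvgB; [exact: Zx|exact: cvg_cst].
have [_ s0] := has_gauss_cvg0 (fun n => gs_has_gauss hG (GD n)) D0.
have E n : ip P (D n) (D n) = Num.sqrt (ip P (D n) (D n) / gam2 R) ^+ 2 * gam2 R.
  exact: (ip_has_gauss (gs_has_gauss hG (GD n))).
rewrite (_ : (fun n => _) = (fun n => Num.sqrt (ip P (D n) (D n) / gam2 R) ^+ 2 * gam2 R)).
  rewrite [X in _ --> X](_ : 0 = 0 * 0 * gam2 R :> R); last by rewrite !mul0r.
  by apply: cvgM; [under eq_fun do rewrite expr2; exact: cvgM|exact: cvg_cst].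
by apply/funext => n; exact: E.
Qed.

Lemma gs_cvg_ipl (Z_ : nat -> O -> R) Z W : (forall n, G (Z_ n)) -> G Z -> G W ->
  {ae P, forall x, Z_ n x @[n --> \oo] --> Z x} ->
  ip P (Z_ n) W @[n --> \oo] --> ip P Z W.
Proof.
move=> GZ_ GZ GW Z_Z.
have c0 : Num.sqrt (ip P (fun x => Z_ n x - Z x) (fun x => Z_ n x - Z x)) *
    Num.sqrt (ip P W W) @[n --> \oo] --> (0 : R).
  rewrite -[X in _ --> X](mul0r (Num.sqrt (ip P W W))); apply: cvgM; last exact: cvg_cst.
  rewrite -[X in _ --> X]sqrtr0.
  apply: (@cvg_comp _ _ _ _ (@Num.sqrt R)); first exact: gs_cvg_ip.
  exact: sqrt_continuous.
apply/cvgrPdist_le => e e0; move/cvgrPdist_le : c0 => /(_ e e0); apply: filterS => n.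
rewrite sub0r normrN => h; rewrite distrC -(ipBl hG)// (le_trans _ h)//.
rewrite (le_trans (cauchy_schwarz_ip hG (gsB hG (GZ_ n) GZ) GW))//.
exact: ler_norm.
Qed.

End gauss_closure.

Section gauss_same_law.
Context (R : realType) d (O : measurableType d) (P : probability O R).
Context (G : set (O -> R)) (hG : gauss_space P G).
Notation gam := (@normal_prob R 0 1).

Lemma gs_cos Z : G Z -> forall b, \int[P]_x cos (Z x + b) =
  \int[gam]_x cos (Num.sqrt (ip P Z Z / gam2 R) * x + 0 + b).
Proof.
move=> GZ b; have h := gs_has_gauss hG GZ.
have mc : measurable_fun setT (fun y : R => cos (y + b)).
  rewrite (_ : (fun y => _) = (fun y => cos (1 * y + b))).
    by apply: measurable_cos_affine; exact: measurable_id.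
  by apply/funext => y; rewrite mul1r.
apply: (Rintegral_has_gauss h mc).
apply: (@bounded_integrable _ (measurableTypeR R) R gam _ 1); last by move=> x; exact: cos_max.
exact: (measurableT_comp mc (measurable_affine _ 0)).
Qed.

Section general.
Context (I : Type) dE (E : measurableType dE) (ev : I -> E -> R).
Context (mev : forall i, measurable_fun setT (ev i)).

Lemma gs_lin (F : O -> E) l : (forall i, G (fun x => ev i (F x))) ->
  G (fun x => lin ev l (F x)).
Proof.
move=> GF; rewrite /lin; apply: (gs_sum hG l (F := fun p x => p.1 * ev p.2 (F x))) => p.
exact: (gsZ hG).
Qed.

Lemma ip_lin (F : O -> E) l (W : O -> R) : (forall i, G (fun x => ev i (F x))) -> G W ->
  ip P (fun x => lin ev l (F x)) W = \sum_(p <- l) p.1 * ip P (fun x => ev p.2 (F x)) W.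
Proof.
move=> GF GW; rewrite /lin (ip_suml hG l (F := fun p x => p.1 * ev p.2 (F x)))//.
  by apply: eq_bigr => p _; rewrite (ipZl hG).
by move=> p; exact: (gsZ hG).
Qed.

(** The cosine integrals of a linear form depend only on its norm, and the norm only on the inner
    products of the coordinates. *)
Lemma gauss_same_law (F1 F2 : O -> E) :
  measurable_fun setT F1 -> measurable_fun setT F2 ->
  (forall i, G (fun x => ev i (F1 x))) -> (forall i, G (fun x => ev i (F2 x))) ->
  (forall i j, ip P (fun x => ev i (F1 x)) (fun x => ev j (F1 x)) =
               ip P (fun x => ev i (F2 x)) (fun x => ev j (F2 x))) ->
  forall B, measurable B -> <<s range (cylinder ev) >> B ->
  P (F1 @^-1` B) = P (F2 @^-1` B).
Proof.
move=> mF1 mF2 GF1 GF2 F12; apply: cos_uniqueness => // l b.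
rewrite (gs_cos (gs_lin l GF1)) (gs_cos (gs_lin l GF2)).
suff -> : ip P (fun x => lin ev l (F1 x)) (fun x => lin ev l (F1 x)) =
    ip P (fun x => lin ev l (F2 x)) (fun x => lin ev l (F2 x)) by [].
rewrite !ip_lin//; try exact: (gs_lin).
apply: eq_bigr => p _; congr (_ * _).
rewrite ipC [RHS]ipC !ip_lin//; apply: eq_bigr => q _; congr (_ * _).
exact: F12.
Qed.

End general.
End gauss_same_law.

Lemma measurable_to_cylinder (R : realType) d (O : measurableType d) (I : Type)
    (E : pointedType) (ev : I -> E -> R) (F : O -> E) :
  (forall i, measurable_fun setT (fun x => ev i (F x))) ->
  measurable_fun setT (F : O -> g_sigma_algebraType (range (cylinder ev))).
Proof.
move=> mF.
apply: (@measurability _ _ O (g_sigma_algebraType (range (cylinder ev))) setT F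
  (range (cylinder ev))) => // _ [_ [l _ <-] <-]; rewrite setTI.
elim: l => [|p l ih]; first by rewrite (_ : _ @^-1` _ = setT)//; apply/seteqP.
rewrite (_ : _ @^-1` _ = ((fun x => ev p.1 (F x)) @^-1` `]-oo, ratr p.2[) `&`
    (F @^-1` cylinder ev l)).
  by apply: measurableI => //; rewrite -[X in measurable X]setTI; exact: mF.
by apply/seteqP; split=> e; rewrite /cylinder/= in_itv/=; move/andP.
Qed.

(** * Maximal inequality by reflection at the first passage *)

Section gauss_maximal_inequality.
Context (R : realType) d (O : measurableType d) (P : probability O R).
Context (G : set (O -> R)) (hG : gauss_space P G).
Context (J : countType) (A : nat -> J -> O -> R) (B : J -> O -> R) (e : R).
Hypothesis GA : forall n j, G (A n j).
Hypothesis GB : forall j, G (B j).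
(** The martingale property in Hilbert space form: [B j - A n j] is orthogonal to [A m j'] for $m\le
    n$, across all indices of [J] at once. *)
Hypothesis BA : forall n m j j', (m <= n)%N ->
  ip P (B j) (A m j') = ip P (A n j) (A m j').

Let I : Type := ((nat * J) + J)%type.
Let E : pointedType := (I -> R)%type.
Let ev (i : I) (f : E) : R := f i.
Let Ecyl := g_sigma_algebraType (range (cylinder ev)).

Let first_passage (n : nat) : set Ecyl :=
  [set f | (exists j, e < `|f (inl (n, j))|) /\
           (forall m j, (m < n)%N -> `|f (inl (m, j))| <= e)].
Let terminal : set Ecyl := [set f | exists j, e < `|f (inr j)|].

Let mev i : measurable_fun setT (ev i : Ecyl -> R).
Proof. exact: measurable_ev_cylinder. Qed.

Let mexceed i : measurable [set f : Ecyl | e < `|f i|].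
Proof.
have : measurable_fun setT (fun f : Ecyl => `|ev i f|) by exact: measurableT_comp.
move=> /(_ measurableT `]e, +oo[%classic (measurable_itv _)); rewrite setTI.
by congr (measurable _); apply/seteqP; split=> x /=; rewrite in_itv/= andbT.
Qed.

Let mexists (k : J -> I) : measurable [set f : Ecyl | exists j, e < `|f (k j)|].
Proof.
rewrite (_ : [set f | _] = \bigcup_(j in setT) [set f : Ecyl | e < `|f (k j)|]).
  by apply: countable_bigcup_measurable => //; exact: countableP.
by apply/seteqP; split=> f /= [j]; exists j.
Qed.

Let mterminal : measurable terminal. Proof. exact: mexists. Qed.

Let mfirst_passage n : measurable (first_passage n).
Proof.
rewrite (_ : first_passage n = [set f : Ecyl | exists j, e < `|f (inl (n, j))|] `&`
    ~` (\bigcup_(m in [set m | (m < n)%N]) [set f : Ecyl | exists j, e < `|f (inl (m, j))|])).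
  apply: measurableI; first exact: mexists.
  by apply: measurableC; apply: bigcup_measurable => m _; exact: mexists.
apply/seteqP; split=> f /=.
  move=> [h1 h2]; split=> // -[m /= mn [j]]; apply/negP; rewrite -leNgt.
  exact: h2.
move=> [h1 h2]; split=> // m j mn; rewrite leNgt; apply/negP => ej.
by apply: h2; exists m => //; exists j.
Qed.

(* Reflecting B about A n does not change the joint law with (A m)_(m <= n),
   because B - A n is orthogonal to these A m. *)
Let stopped (n : nat) (x : O) : E := fun i => match i with
  inl (m, j) => A (minn m n) j x | inr j => B j x end.
Let reflected_stopped (n : nat) (x : O) : E := fun i => match i with
  inl (m, j) => A (minn m n) j x | inr j => 2 * A n j x - B j x end.

Lemma reflection n (S : set Ecyl) : measurable S ->
  P (stopped n @^-1` S) = P (reflected_stopped n @^-1` S).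
Proof.
move=> mS.
have GS i : G (fun x => ev i (stopped n x)) by case: i => [[m j]|j] /=; [exact: GA|exact: GB].
have GR i : G (fun x => ev i (reflected_stopped n x)).
  case: i => [[m j]|j] /=; first exact: GA.
  by apply: (gsB hG) => //; exact: (gsZ hG).
have mE (F : O -> E) : (forall i, G (fun x => ev i (F x))) ->
    measurable_fun setT (F : O -> Ecyl).
  by move=> GF; apply: measurable_to_cylinder => i; exact: (gs_measurable hG (GF i)).
apply: (gauss_same_law hG mev (mE _ GS) (mE _ GR) GS GR) => //.
have G2 j : G (fun x => 2 * A n j x) by exact: (gsZ hG).
have AB m j j' : ip P (A (minn m n) j) (fun x => 2 * A n j' x - B j' x) =
    ip P (A (minn m n) j) (B j').
  rewrite (ipBr hG)//.
  rewrite [ip P _ (fun x => 2 * _)]ipC (ipZl hG)// [ip P _ (B j')]ipC.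
  by rewrite (BA _ _ (geq_minr m n)); lra.
move=> [[m j]|j] [[m' j']|j'] //=.
- by rewrite /stopped /reflected_stopped /ev AB.
- by rewrite /stopped /reflected_stopped /ev ipC [RHS]ipC AB.
- rewrite /stopped /reflected_stopped /ev.
  rewrite (ipBr hG)//; last by apply: (gsB hG).
  rewrite !(ipBl hG)//.
  rewrite !(ipZl hG)//.
  rewrite ![ip P _ (fun x => 2 * A n j' x)]ipC !(ipZl hG)//.
  rewrite [ip P (A n j) (B j')]ipC [ip P (A n j') (B j)]ipC.
  by rewrite !(BA _ _ (leqnn n)) [ip P (A n j') (A n j)]ipC; lra.
Qed.

Let first_passage_set n : set O :=
  [set x | (exists j, e < `|A n j x|) /\ (forall m j, (m < n)%N -> `|A m j x| <= e)].
Let terminal_set : set O := [set x | exists j, e < `|B j x|].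

Let mpre (F : O -> E) (S : set Ecyl) : (forall i, measurable_fun setT (fun x => F x i)) ->
  measurable S -> measurable (F @^-1` S).
Proof.
move=> mF mS; rewrite -[X in measurable X]setTI.
by have := @measurable_to_cylinder R _ O I E ev F mF; exact.
Qed.

(** Freezing the sequence at time [n] changes none of the coordinates that the event inspects. *)
Let first_passageE n : first_passage_set n = stopped n @^-1` first_passage n.
Proof.
have stE x m j : (m <= n)%N -> stopped n x (inl (m, j)) = A m j x.
  by move=> mn; rewrite /stopped (minn_idPl mn).
apply/seteqP; split=> x /= [[j hj] h2]; split.
- by exists j; rewrite stE.
- by move=> m j' mn; rewrite stE ?(ltnW mn)//; exact: h2.
- by exists j; rewrite -stE.
- by move=> m j' mn; rewrite -stE ?(ltnW mn)//; exact: h2.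
Qed.

Let le_first_passage n :
  (P (first_passage_set n) <= 2%:E * P (first_passage_set n `&` terminal_set))%E.
Proof.
have mGA m j : measurable_fun setT (A m j) by exact: (gs_measurable hG (GA m j)).
have mGB j : measurable_fun setT (B j) by exact: (gs_measurable hG (GB j)).
have mS i : measurable_fun setT (fun x => stopped n x i) by case: i => [[m j]|j] /=.
have mR i : measurable_fun setT (fun x => reflected_stopped n x i).
  by case: i => [[m j]|j] //=; apply: measurable_funB => //; exact: measurable_funM.
have mf := mfirst_passage n.
have mfs := mpre mS mf; have mfr := mpre mR mf.
have mts := mpre mS mterminal; have mtr := mpre mR mterminal.
have sub : first_passage_set n `<=`
    (stopped n @^-1` (first_passage n `&` terminal)) `|`
    (reflected_stopped n @^-1` (first_passage n `&` terminal)).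
  move=> x Fx; have [[j hj] _] := Fx; rewrite first_passageE in Fx.
  have [hB|hB] := ltP e `|B j x|; first by left; split => //; exists j.
  right; split; first exact: Fx.
  (* [A n j] is the midpoint of [B j] and its reflection, so if [B j] stays within [e] the
     reflection must exceed it. *)
  exists j => /=; have := ler_normD (2 * A n j x - B j x) (B j x).
  rewrite subrK normrM ger0_norm//; lra.
have mB1 : measurable (stopped n @^-1` (first_passage n `&` terminal)).
  by rewrite preimage_setI; exact: measurableI.
have mB2 : measurable (reflected_stopped n @^-1` (first_passage n `&` terminal)).
  by rewrite preimage_setI; exact: measurableI.
have eqP : P (reflected_stopped n @^-1` (first_passage n `&` terminal)) =
    P (stopped n @^-1` (first_passage n `&` terminal)).
  by apply/esym/reflection; exact: measurableI.
have -> : first_passage_set n `&` terminal_set =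
    stopped n @^-1` (first_passage n `&` terminal) by rewrite first_passageE.
apply: (@le_trans _ _ (P ((stopped n @^-1` (first_passage n `&` terminal)) `|`
    (reflected_stopped n @^-1` (first_passage n `&` terminal))))).
  by apply: le_measure; rewrite ?inE//; [rewrite first_passageE|exact: measurableU].
set p : \bar R := P (stopped n @^-1` _) in eqP *.
have le2 : (P ((stopped n @^-1` (first_passage n `&` terminal)) `|`
    (reflected_stopped n @^-1` (first_passage n `&` terminal))) <= p + p)%E.
  by rewrite -[X in (_ <= _ + X)%E]eqP; exact: measureU2.
apply: (le_trans le2).
have pfin : p \is a fin_num by exact: fin_num_measure.
by rewrite -(fineK pfin) -EFinD -EFinM lee_fin; lra.
Qed.

(** First passages at different times are disjoint, so [le_first_passage] can be summed over [n];
    the factor 2 counts a path and its reflection. *)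
Lemma gauss_maximal_inequality :
  (P [set x | exists n, exists j, (e < `|A n j x|)%R] <=
   2%:E * P [set x | exists j, (e < `|B j x|)%R])%E.
Proof.
have mGA m j : measurable_fun setT (A m j) by exact: (gs_measurable hG (GA m j)).
have mGB j : measurable_fun setT (B j) by exact: (gs_measurable hG (GB j)).
have mS n i : measurable_fun setT (fun x => stopped n x i) by case: i => [[m j]|j] /=.
have mF n : measurable (first_passage_set n).
  by rewrite first_passageE; exact: mpre.
have mT : measurable terminal_set by exact: (mpre (mS 0%N) mterminal).
have tF : trivIset setT first_passage_set.
  apply/trivIsetP => i j _ _; rewrite neq_lt => /orP[] ij; rewrite -subset0.
    by move=> x [[[k hk] _] [_ /(_ i k ij)]]; rewrite leNgt hk.
  by move=> x [[_ /(_ j _ ij) h] [[k hk] _]]; have := h k; rewrite leNgt hk.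
have -> : [set x | exists n, exists j, (e < `|A n j x|)%R] = \bigcup_n first_passage_set n.
  apply/seteqP; split=> [x /= ex|x [n _ [[j hj] _]]]; last by exists n, j.
  have exn : exists n, `[< exists j, e < `|A n j x| >].
    by have [n h] := ex; exists n; apply/asboolP.
  have [n /asboolP hn nmin] := ex_minnP exn.
  exists n => //; split=> // m j mn; rewrite leNgt; apply/negP => ej.
  have := nmin m; rewrite leqNgt mn => /(_ _)/negP; apply => //.
  by apply/asboolP; exists j.
rewrite measure_bigcup//.
have tFT : trivIset setT (fun n => first_passage_set n `&` terminal_set).
  apply/trivIsetP => i j _ _ ij; move/trivIsetP : tF => /(_ i j Logic.I Logic.I ij) h.
  by rewrite setIACA h set0I.
apply: (@le_trans _ _ (\sum_(n <oo | n \in setT)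
    2%:E * P (first_passage_set n `&` terminal_set))%E).
  by apply: lee_nneseries => // n _; exact: le_first_passage.
rewrite nneseriesZl//; apply: lee_wpmul2l => //.
have mFT n : measurable (first_passage_set n `&` terminal_set) by exact: measurableI.
rewrite -measure_bigcup//; apply: le_measure; rewrite ?inE//.
  by apply: bigcupT_measurable.
by move=> x [n _ []].
Qed.

End gauss_maximal_inequality.

(** * Projection onto the observed values *)

Section projection.
Context (R : realType) d (O : measurableType d) (P : probability O R).
Context (G : set (O -> R)) (hG : gauss_space P G).
Context (T : Type) (xi : T -> O -> R) (s : nat -> T).
Hypothesis Gxi : forall t, G (xi t).

Definition kern (t1 t2 : T) : R := ip P (xi t1) (xi t2).

Let Sn n : 'I_n -> T := fun i => s i.
Arguments Sn : clear implicits.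

Definition weight (k : T -> T -> R) n (t : T) : 'rV[R]_n :=
  kmx k (pt1 t) (Sn n) *m moore_penrose (kmx k (Sn n) (Sn n)).

Definition gproj n (t : T) (x : O) : R := \sum_(i < n) weight kern n t 0 i * xi (s i) x.

Let K n := kmx kern (Sn n) (Sn n).
Let Kt n t : 'rV[R]_n := kmx kern (pt1 t) (Sn n).

Lemma kernC t1 t2 : kern t1 t2 = kern t2 t1.
Proof. exact: ipC. Qed.

Lemma gs_comb n (v : 'I_n -> R) (i : 'I_n -> nat) :
  G (fun x => \sum_(j < n) v j * xi (s (i j)) x).
Proof.
by apply: (gs_sum hG (index_enum 'I_n) (F := fun j x => v j * xi (s (i j)) x)) => j; exact: (gsZ hG).
Qed.

Lemma gs_proj n t : G (gproj n t).
Proof. exact: (gs_comb _ (fun i => i)). Qed.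

Lemma ip_comb n (v : 'I_n -> R) (i : 'I_n -> nat) W : G W ->
  ip P (fun x => \sum_(j < n) v j * xi (s (i j)) x) W =
  \sum_(j < n) v j * ip P (xi (s (i j))) W.
Proof.
move=> GW.
rewrite (ip_suml hG (index_enum 'I_n) (F := fun j x => v j * xi (s (i j)) x))//.
  by apply: eq_bigr => j _; rewrite (ipZl hG).
by move=> j; exact: (gsZ hG).
Qed.

(* A vector in the kernel of the Gram matrix gives a vanishing combination of
   the [xi (s i)], which is orthogonal to every [xi t]. *)
Lemma gram_kernel n t (v : 'cV[R]_n) : K n *m v = 0 -> Kt n t *m v = 0.
Proof.
move=> Kv; pose W := fun x => \sum_(j < n) v j 0 * xi (s j) x.
have GW : G W by exact: (gs_comb _ (fun i => i)).
have WW : ip P W W = 0.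
  rewrite (@ip_comb n (fun j => v j 0) (fun i => i))// big1// => j _.
  rewrite ipC (@ip_comb n (fun j => v j 0) (fun i => i))//.
  move/matrixP : Kv => /(_ j 0); rewrite !mxE => Kj.
  have -> : \sum_(l < n) v l 0 * ip P (xi (s l)) (xi (s j)) = 0.
    by rewrite -[RHS]Kj; apply: eq_bigr => l _; rewrite !mxE mulrC ipC.
  by rewrite mulr0.
apply/matrixP => i j; rewrite !ord1 !mxE.
have := cauchy_schwarz_ip hG GW (Gxi t); rewrite WW sqrtr0 mul0r normr_le0.
rewrite (@ip_comb n (fun j => v j 0) (fun i => i))// => /eqP E0.
by rewrite -[RHS]E0; apply: eq_bigr => l _; rewrite !mxE mulrC ipC.
Qed.

(** The normal equations, solved by the pseudo-inverse even for singular $K$: the columns of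
    $1-K^\dagger K$ lie in the kernel of $K$, and [gram_kernel] shows that $K_{t,S_n}$ kills that
    kernel. *)
Lemma weight_gram n t : weight kern n t *m K n = Kt n t.
Proof.
have [KXK _ _ _] := moore_penroseP (K n).
pose V := 1%:M - moore_penrose (K n) *m K n.
have KV : K n *m V = 0 by rewrite /V mulmxBr mulmx1 mulmxA KXK subrr.
have KtV : Kt n t *m V = 0.
  apply/matrixP => i j; rewrite [RHS]mxE.
  have Kj : K n *m (V *m delta_mx j (0 : 'I_1)) = 0 by rewrite mulmxA KV mul0mx.
  have := gram_kernel t Kj; rewrite mulmxA -colE => /matrixP/(_ i 0).
  by rewrite !mxE.
have := KtV; rewrite /V mulmxBr mulmx1 mulmxA => /eqP; rewrite subr_eq0 => /eqP KtE.
by rewrite [RHS]KtE.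
Qed.

Lemma ip_proj_node n t i : (i < n)%N -> ip P (gproj n t) (xi (s i)) = kern t (s i).
Proof.
move=> ni; rewrite (@ip_comb n (fun j => weight kern n t 0 j) (fun i => i))//.
have /matrixP/(_ 0 (Ordinal ni)) := weight_gram n t; rewrite mxE [RHS]mxE => <-.
by apply: eq_bigr => j _; rewrite [K n j _]mxE.
Qed.

(** [gproj n t1] combines nodes at which the finer projection has the same inner products as
    [xi t2]. This is the martingale property fed to the maximal inequality. *)
Lemma ip_proj_proj n m t1 t2 : (n <= m)%N ->
  ip P (gproj n t1) (gproj m t2) = ip P (gproj n t1) (xi t2).
Proof.
move=> nm; rewrite !(@ip_comb n (fun j => weight kern n t1 0 j) (fun i => i))//; last exact: gs_proj.
apply: eq_bigr => j _; congr (_ * _).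
rewrite ipC ip_proj_node; first by rewrite kernC.
by rewrite (leq_trans _ nm).
Qed.

Lemma ip_projC n t1 t2 : ip P (gproj n t1) (xi t2) = ip P (xi t1) (gproj n t2).
Proof.
by rewrite -(ip_proj_proj _ _ (leqnn n)) ipC ip_proj_proj// ipC.
Qed.

(** Only almost everywhere: with a singular Gram matrix the weights at a node need not form a unit
    vector, and both sides then differ by a combination of norm 0. *)
Lemma proj_node_ae n i : (i < n)%N -> {ae P, forall x, gproj n (s i) x = xi (s i) x}.
Proof.
move=> ni; apply: (ip_eq0_ae hG (gs_proj n (s i)) (Gxi (s i))).
rewrite (ip_sub_sqr hG (gs_proj _ _) (Gxi _)) ip_proj_proj// ip_proj_node// /kern; lra.
Qed.

Lemma sqnorm_proj_increment n m t : (n <= m)%N ->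
  ip P (fun x => gproj m t x - gproj n t x) (fun x => gproj m t x - gproj n t x) =
  ip P (gproj m t) (xi t) - ip P (gproj n t) (xi t).
Proof.
move=> nm; rewrite (ip_sub_sqr hG (gs_proj _ _) (gs_proj _ _)).
rewrite [ip P (gproj m t) (gproj n t)]ipC (ip_proj_proj t t nm).
rewrite (ip_proj_proj t t (leqnn m)) (ip_proj_proj t t (leqnn n)); lra.
Qed.

Lemma ip_proj_le n t : ip P (gproj n t) (xi t) <= kern t t.
Proof.
have := ip_ge0 P (fun x => gproj n t x - xi t x).
rewrite (ip_sub_sqr hG (gs_proj _ _) (Gxi _)) ip_proj_proj// /kern; lra.
Qed.

(** Pythagoras: the projected increment is orthogonal to the rest [U] of the increment. *)
Lemma ip_proj_contraction n t1 t2 :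
  ip P (fun x => gproj n t1 x - gproj n t2 x) (fun x => gproj n t1 x - gproj n t2 x) <=
  ip P (fun x => xi t1 x - xi t2 x) (fun x => xi t1 x - xi t2 x).
Proof.
have g1 := gs_proj n t1; have g2 := gs_proj n t2.
have gx := gsB hG (Gxi t1) (Gxi t2); have gp := gsB hG g1 g2.
pose U := fun x => (xi t1 x - xi t2 x) - (gproj n t1 x - gproj n t2 x).
have := ip_ge0 P U; rewrite /U (ip_sub_sqr hG gx gp).
suff -> : ip P (fun x => xi t1 x - xi t2 x) (fun x => gproj n t1 x - gproj n t2 x) =
  ip P (fun x => gproj n t1 x - gproj n t2 x) (fun x => gproj n t1 x - gproj n t2 x) by lra.
rewrite !(ipBl hG)// !(ipBr hG)//.
by rewrite !ip_proj_proj// -!ip_projC.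
Qed.

Lemma cov_incr_proj n t1 t2 :
  (weight kern n t1 *m kmx kern (Sn n) (pt1 t2)) 0 0 = ip P (gproj n t1) (xi t2).
Proof.
rewrite mxE (@ip_comb n (fun j => weight kern n t1 0 j) (fun i => i))//.
by apply: eq_bigr => j _; rewrite [kmx _ _ _ _ _]mxE.
Qed.

Lemma is_cvg_sqnorm (U : nat -> O -> R) (C : R) : (forall n, G (U n)) ->
  (forall n m, (n <= m)%N -> ip P (U n) (U m) = ip P (U n) (U n)) ->
  (forall n, ip P (U n) (U n) <= C) -> cvgn (fun n => ip P (U n) (U n)).
Proof.
move=> GU UU UC; apply: nondecreasing_is_cvgn.
  move=> n m nm; have := ip_ge0 P (fun x => U m x - U n x).
  by rewrite (ip_sub_sqr hG)// [ip P (U m) (U n)]ipC UU//; lra.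
by exists C => _ [n _ <-].
Qed.

(** Polarization: the product is half of $\|M_nt_1\|^2+\|M_nt_2\|^2-\|M_nt_1-M_nt_2\|^2$, and each
    squared norm is bounded and increases with [n]. *)
Lemma is_cvg_ip_proj t1 t2 : cvgn (fun n => ip P (gproj n t1) (xi t2)).
Proof.
have c t : cvgn (fun n => ip P (gproj n t) (gproj n t)).
  apply: (is_cvg_sqnorm (C := kern t t)) => [n|n m nm|n]; first exact: gs_proj.
    by rewrite !ip_proj_proj.
  by rewrite ip_proj_proj// ip_proj_le.
have c12 : cvgn (fun n => ip P (fun x => gproj n t1 x - gproj n t2 x) (fun x => gproj n t1 x - gproj n t2 x)).
  apply: (is_cvg_sqnorm (C := ip P (fun x => xi t1 x - xi t2 x) (fun x => xi t1 x - xi t2 x))).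
  - by move=> n; apply: (gsB hG); exact: gs_proj.
  - move=> n m nm; have g := gs_proj.
    by rewrite !(ipBl hG)//; try (by apply: (gsB hG)); rewrite !(ipBr hG)// !ip_proj_proj.
  - by move=> n; exact: ip_proj_contraction.
rewrite (_ : (fun n => _) = (fun n => 2^-1 * (ip P (gproj n t1) (gproj n t1) + ip P (gproj n t2) (gproj n t2) -
   ip P (fun x => gproj n t1 x - gproj n t2 x) (fun x => gproj n t1 x - gproj n t2 x)))).
  move: (c t1) (c t2) c12 => /cvg_ex[/= l1 c1] /cvg_ex[/= l2 c2] /cvg_ex[/= l12 c12].
  apply/cvg_ex; exists (2^-1 * (l1 + l2 - l12)) => /=.
  apply: cvgM; first exact: cvg_cst.
  by apply: cvgB; [exact: cvgD|exact: c12].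
apply/funext => n; rewrite (ip_sub_sqr hG (gs_proj _ _) (gs_proj _ _)).
rewrite (ip_proj_proj t1 t2 (leqnn n)).
have polar (a b e : R) : b = 2^-1 * (a + e - (a - 2 * b + e)) by lra.
exact: polar.
Qed.

End projection.

Section almost_sure.
Context (R : realType) d (O : measurableType d) (P : probability O R).

Lemma ae_exists_notin (A : nat -> set O) (b : nat -> R) :
  (forall j, measurable (A j)) -> (forall j, (P (A j) <= (b j)%:E)%E) ->
  b @ \oo --> (0 : R) -> {ae P, forall x, exists j, ~ A j x}.
Proof.
move=> mA Ab b0; exists (\bigcap_j A j); split.
- exact: bigcapT_measurable.
- apply/eqP; rewrite eq_le measure_ge0 andbT.
  have c : (b j)%:E @[j --> \oo] --> (0 : R)%:E by apply: cvg_EFin => //; exact: nearW.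
  apply: (cvge_to_ge c); apply: nearW => j; apply: (le_trans _ (Ab j)).
  apply: le_measure; rewrite ?inE//; first exact: bigcapT_measurable.
  by move=> x; exact.
- by move=> x /= h j _; apply: contrapT => nA; apply: h; exists j.
Qed.

Lemma measurable_gt_norm (Z : O -> R) (e : R) : measurable_fun setT Z ->
  measurable [set x | (e < `|Z x|)%R].
Proof.
move=> mZ; have : measurable_fun setT (fun x => `|Z x|) by exact: measurableT_comp.
move=> /(_ measurableT `]e, +oo[%classic (measurable_itv _)); rewrite setTI.
by congr (measurable _); apply/seteqP; split=> x /=; rewrite in_itv/= andbT.
Qed.

Lemma measurable_exists (J : countType) (Q : J -> set O) :
  (forall j, measurable (Q j)) -> measurable [set x | exists j, Q j x].
Proof.
move=> mQ; rewrite (_ : [set x | _] = \bigcup_(j in setT) Q j).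
  by apply: countable_bigcup_measurable => //; exact: countableP.
by apply/seteqP; split=> f /= [j]; exists j.
Qed.
End almost_sure.

(** * Almost sure uniform convergence of the projections *)

Section path_convergence.
Context (R : realType) d (O : measurableType d) (P : probability O R).
Context (G : set (O -> R)) (hG : gauss_space P G).
Context (T : Type) (xi : T -> O -> R) (s : nat -> T).
Hypothesis Gxi : forall t, G (xi t).
Notation gproj := (gproj P xi s).

Let Gp n t : G (gproj n t). Proof. exact: gs_proj. Qed.
Let mp n t : measurable_fun setT (gproj n t). Proof. exact: (gs_measurable hG (Gp n t)). Qed.
Let pp n m t1 t2 (nm : (n <= m)%N) := ip_proj_proj hG s Gxi t1 t2 nm.

Let c n t : R := ip P (gproj n t) (xi t).

Lemma maximal_proj N N' t e : 0 < e ->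
  (P [set x | exists n, (n <= N')%N /\ (e < `|gproj (N + n) t x - gproj N t x|)%R] <=
   (2 * ((c (N + N') t - c N t) / e ^+ 2))%:E)%E.
Proof.
move=> e0.
(* The sequence is frozen after the horizon [N'], so that its last term can serve as the terminal
   variable [B]. *)
pose A n (_ : unit) x := gproj (N + minn n N') t x - gproj N t x.
pose B (_ : unit) x := gproj (N + N') t x - gproj N t x.
have GA n j : G (A n j) by exact: (gsB hG).
have GB j : G (B j) by exact: (gsB hG).
have inc p q : (p <= q)%N -> ip P (fun x => gproj (N + q) t x - gproj N t x)
    (fun x => gproj (N + p) t x - gproj N t x) = c (N + p) t - c N t.
  move=> pq; rewrite (ipBl hG)//; last exact: (gsB hG).
  rewrite !(ipBr hG)// [ip P (gproj (N + q) t) _]ipC [ip P (gproj (N + q) t) (gproj N t)]ipC.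
  by rewrite !pp ?leq_add2l ?leq_addr// /c; lra.
have BA n m j j' : (m <= n)%N -> ip P (B j) (A m j') = ip P (A n j) (A m j').
  move=> mn; rewrite inc ?geq_minr// inc// leq_min geq_minr andbT.
  by rewrite (leq_trans (geq_minl _ _)).
have := @gauss_maximal_inequality _ _ _ P G hG unit A B e GA GB BA.
have -> : [set x | exists n j, e < `|A n j x|] =
    [set x | exists n, (n <= N')%N /\ (e < `|gproj (N + n) t x - gproj N t x|)%R].
  apply/seteqP; split=> x /= [n]; last first.
    by move=> [nN' h]; exists n, tt; rewrite /A (minn_idPl nN').
  by move=> [j h]; exists (minn n N'); split => //; exact: geq_minr.
move=> h; apply: (le_trans h); rewrite EFinM; apply: lee_wpmul2l => //.
rewrite (_ : [set x | exists j, e < `|B j x|] = [set x | e < `|B tt x|]).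
  apply: (le_trans (ip_chebyshev hG (GB tt) e0)).
  by rewrite lee_fin -(inc N' N' (leqnn _)).
by apply/seteqP; split=> x /=; [case=> -[]|exists tt].
Qed.

(** The squared norms [c n t] increase to [l], so the bound of [maximal_proj] is at most
    $2(l-c_N)/e^2$ for every horizon, and this tends to 0 as $N$ grows. *)
Lemma ae_cauchy_proj t : {ae P, forall x (k : nat), exists N, forall n,
  `|gproj (N + n) t x - gproj N t x| <= k.+1%:R^-1}.
Proof.
apply: ae_foralln => k; set e : R := k.+1%:R^-1.
have e0 : 0 < e by rewrite invr_gt0.
have /cvg_ex[/= l cl] := is_cvg_ip_proj hG Gxi (s := s) (t1 := t) (t2 := t).
have c_le n : c n t <= l.
  apply: (cvgr_to_ge cl); exists n => // m /= nm.
  rewrite -subr_ge0 -(sqnorm_proj_increment hG s Gxi t nm); exact: ip_ge0.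
pose E N N' := [set x | exists n, (n <= N')%N /\ (e < `|gproj (N + n) t x - gproj N t x|)%R].
pose F N := [set x | exists n, (e < `|gproj (N + n) t x - gproj N t x|)%R].
have mE N N' : measurable (E N N').
  apply: (@measurable_exists _ _ nat (fun n => [set x | (n <= N')%N /\
    (e < `|gproj (N + n) t x - gproj N t x|)%R])) => n; case: (leqP n N') => nN'.
    rewrite (_ : [set x | _] = [set x | e < `|gproj (N + n) t x - gproj N t x|]).
      by apply: measurable_gt_norm; exact: measurable_funB.
    by apply/seteqP; split=> x /=; [case|].
  by rewrite (_ : [set x | _] = set0)//; apply/seteqP; split=> x //= [].
have mF N : measurable (F N).
  by apply: measurable_exists => n; apply: measurable_gt_norm; exact: measurable_funB.
have FE N : F N = \bigcup_N' E N N'.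
  apply/seteqP; split=> x /=; first by move=> [n h]; exists n => //; exists n.
  by move=> [N' _ [n [_ h]]]; exists n.
have PF N : (P (F N) <= (2 * ((l - c N t) / e ^+ 2))%:E)%E.
  have : P (E N N') @[N' --> \oo] --> P (\bigcup_N' E N N').
    apply: nondecreasing_cvg_mu; [exact: mE|by rewrite -FE|].
    move=> a b ab; apply/subsetPset => x [n [na h]]; exists n; split => //.
    exact: leq_trans ab.
  rewrite -FE => cE; apply: (cvge_to_le cE); apply: nearW => N'.
  apply: (le_trans (maximal_proj N N' t e0)); rewrite lee_fin ler_pM2l//.
  by rewrite ler_pM2r ?invr_gt0 ?exprn_gt0// lerB.
have q : (2 * ((l - c N t) / e ^+ 2)) @[N --> \oo] --> (0 : R).
  rewrite [X in _ --> X](_ : 0 = 2 * ((l - l) / e ^+ 2)); last first.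
    by rewrite subrr mul0r mulr0.
  apply: cvgM; first exact: cvg_cst.
  apply: cvgM; last exact: cvg_cst.
  by apply: cvgB; [exact: cvg_cst|exact: cl].
apply: filterS (ae_exists_notin mF PF q) => x [N h]; exists N => n.
by rewrite leNgt; apply/negP => hn; apply: h; exists n.
Qed.

Section equicontinuity.
(** [cl j i i'] stands for closeness of [D i] and [D i'] at scale [j]; it is instantiated below by
    balls of radius [j.+1%:R^-1]. *)
Context (D : nat -> T) (cl : nat -> nat -> nat -> Prop).
Hypothesis cl_mono : forall j j' i i', (j <= j')%N -> cl j' i i' -> cl j i i'.
Hypothesis xi_unif : forall x (e : R), 0 < e ->
  exists j, forall i i', cl j i i' -> `|xi (D i) x - xi (D i') x| <= e.

(** The maximal inequality runs over all close pairs at once: some projected increment exceeds [e]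
    with at most twice the probability that an increment of [xi] does. Uniform continuity of each
    path makes the latter events decrease to the empty set as the scale shrinks. *)
Lemma ae_equicontinuous_proj : {ae P, forall x (k : nat), exists j, forall n i i',
  cl j i i' -> `|gproj n (D i) x - gproj n (D i') x| <= k.+1%:R^-1}.
Proof.
apply: ae_foralln => k; set e : R := k.+1%:R^-1.
have e0 : 0 < e by rewrite invr_gt0.
(* Pairs that are not close receive the zero variable, so the index type is [nat * nat] at every
   scale. *)
pose A j n (p : nat * nat) : O -> R := if `[< cl j p.1 p.2 >]
  then (fun x => gproj n (D p.1) x - gproj n (D p.2) x) else (fun=> 0).
pose B j (p : nat * nat) : O -> R := if `[< cl j p.1 p.2 >]
  then (fun x => xi (D p.1) x - xi (D p.2) x) else (fun=> 0).
have GA j n p : G (A j n p) by rewrite /A; case: asboolP => _; [exact: (gsB hG)|exact: (gs0 hG)].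
have GB j p : G (B j p) by rewrite /B; case: asboolP => _; [exact: (gsB hG)|exact: (gs0 hG)].
have BA j n m p p' : (m <= n)%N -> ip P (B j p) (A j m p') = ip P (A j n p) (A j m p').
  move=> mn; rewrite /A /B; case: asboolP => _; last by rewrite !ip0l.
  case: asboolP => _; last by rewrite ![ip P _ (fun=> 0)]ipC !ip0l.
  have Gm : G (fun x => gproj m (D p'.1) x - gproj m (D p'.2) x) by exact: (gsB hG).
  rewrite !(ipBl hG)// !(ipBr hG)//.
  rewrite ![ip P (gproj n _) (gproj m _)]ipC !pp//.
  by rewrite ![ip P (xi _) (gproj m _)]ipC.
pose C j := [set x | exists p, e < `|B j p x|].
pose E j := [set x | exists n p, e < `|A j n p x|].
have mC j : measurable (C j).
  apply: (@measurable_exists _ _ _ (fun p => [set x | e < `|B j p x|])) => p.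
  by apply: measurable_gt_norm; exact: (gs_measurable hG).
have mE j : measurable (E j).
  apply: (@measurable_exists _ _ nat (fun n => [set x | exists p, e < `|A j n p x|])) => n.
  apply: (@measurable_exists _ _ _ (fun p => [set x | e < `|A j n p x|])) => p.
  by apply: measurable_gt_norm; exact: (gs_measurable hG).
have PE j : (P (E j) <= (2 * fine (P (C j)))%:E)%E.
  rewrite EFinM fineK; last exact: fin_num_measure.
  exact: (@gauss_maximal_inequality _ _ _ P G hG _ (A j) (B j) e (GA j) (GB j) (BA j)).
have C0 : fine (P (C j)) @[j --> \oo] --> (0 : R).
  have C0 : \bigcap_j C j = set0.
    rewrite -subset0 => x h; have [j hj] := xi_unif x e0.
    have [[i i']] := h j Logic.I; rewrite /B /=; case: asboolP => [/hj|_].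
      by rewrite leNgt => /negP.
    by rewrite normr0 ltNge (ltW e0).
  have : P (C j) @[j --> \oo] --> P (\bigcap_j C j).
    apply: nonincreasing_cvg_mu => //.
    - by rewrite -ge0_fin_numE//; exact: fin_num_measure.
    - exact: bigcapT_measurable.
    - move=> a b ab; apply/subsetPset => x [p]; rewrite /B /=; case: asboolP => h.
        by move=> hp; exists p; rewrite /B /= asboolT//; exact: cl_mono ab h.
      by rewrite normr0 ltNge (ltW e0).
  by rewrite C0 measure0 => /fine_cvg.
have q : 2 * fine (P (C j)) @[j --> \oo] --> (0 : R).
  by rewrite -[X in _ --> X](mulr0 2); apply: cvgM; [exact: cvg_cst|exact: C0].
apply: filterS (ae_exists_notin mE PE q) => x [j h]; exists j => n i i' ii'.
rewrite leNgt; apply/negP => hn; apply: h; exists n, (i, i').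
by rewrite /A /=; case: asboolP.
Qed.

Hypothesis cl_net : forall j, exists L, forall i, exists2 l, (l < L)%N & cl j l i.

Lemma uniform_cauchy_of_equicontinuous (u : nat -> nat -> R) :
  (forall k : nat, exists j, forall n i i', cl j i i' -> `|u n i - u n i'| <= k.+1%:R^-1) ->
  (forall i (k : nat), exists N, forall n, `|u (N + n)%N i - u N i| <= k.+1%:R^-1) ->
  forall k : nat, exists N, forall n i, `|u (N + n)%N i - u N i| <= k.+1%:R^-1.
Proof.
(* Four errors of $1/(4(k+1))$ add up: the moves between [i] and a net point [l] at times [N + n]
   and [N], and the distances at [l] from these two times to [Nl l]. The predecessor compensates the
   successor in the tolerance. *)
move=> equi ptw k; pose k' := (4 * k.+1).-1.
have k'E : (k'.+1%:R^-1 : R) = k.+1%:R^-1 / 4.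
  by rewrite /k' prednK ?muln_gt0// natrM invfM mulrC.
have [j hj] := equi k'; have [L hL] := cl_net j.
pose Nl (l : nat) := sval (cid (ptw l k')).
have NlP l n : `|u (Nl l + n)%N l - u (Nl l) l| <= k'.+1%:R^-1.
  by rewrite /Nl; case: cid => N /= ->.
pose N := (\max_(l < L) Nl l)%N; exists N => n i.
have [l lL cli] := hL i.
have lN : (Nl l <= N)%N by exact: (leq_bigmax (Ordinal lL)).
have h1 := hj (N + n)%N _ _ cli; have h2 := hj N _ _ cli.
have h3 := NlP l (N + n - Nl l)%N; have h4 := NlP l (N - Nl l)%N.
rewrite subnKC// in h4; rewrite subnKC ?(leq_trans lN) ?leq_addr// in h3.
move: h1 h2 h3 h4; rewrite k'E.
move: (k.+1%:R^-1) (u (N + n)%N i) (u N i) (u (N + n)%N l) (u N l) (u (Nl l) l) => e a b a' b' f.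
rewrite !ler_norml => /andP[? ?] /andP[? ?] /andP[? ?] /andP[? ?].
by apply/andP; split; lra.
Qed.

Lemma ae_uniform_cauchy_proj : {ae P, forall x (k : nat), exists N, forall n i,
  `|gproj (N + n) (D i) x - gproj N (D i) x| <= k.+1%:R^-1}.
Proof.
have h : {ae P, forall x (i k : nat), exists N, forall n,
    `|gproj (N + n) (D i) x - gproj N (D i) x| <= k.+1%:R^-1}.
  by apply: ae_foralln => i; exact: ae_cauchy_proj.
apply: filterS2 ae_equicontinuous_proj h => x h1 h2.
exact: (uniform_cauchy_of_equicontinuous (u := fun n i => gproj n (D i) x)).
Qed.

End equicontinuity.
End path_convergence.

(** * Uniform convergence and functionals on C(T) *)

Section uniform_convergence.
Context (R : realType) (U : topologicalType).

Lemma uniform_cvgP (f_ : nat -> U -> R) (f : U -> R) :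
  (forall e, 0 < e -> \forall n \near \oo, forall t, `|f_ n t - f t| <= e) ->
  {uniform, (f_ n @[n --> \oo]) --> f}.
Proof.
move=> h Q /uniform_nbhs[E [entE EQ]].
move: entE; rewrite -entourage_ballE => -[e /= e0 eE].
have := h (e / 2) (divr_gt0 e0 (ltr0Sn R 1)); apply: filterS => n hn.
apply: EQ => t _; apply: eE => /=.
rewrite /ball /= distrC (le_lt_trans (hn t))//.
by rewrite ltr_pdivrMr// ltr_pMr// (ltr1n _ 2).
Qed.

Definition equicontinuous_seq (f_ : nat -> U -> R) := forall x e, 0 < e ->
  \forall y \near x, forall n, `|f_ n y - f_ n x| <= e.

(** Near each [x] one tail of the sequence works for a whole neighbourhood, at the price of two
    moves and one pointwise limit, a third of [e] each; compactness makes the tail global. *)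
Lemma equicontinuous_uniform (f_ : nat -> U -> R) (f : U -> R) :
  compact [set: U] -> equicontinuous_seq f_ ->
  (forall x, f_ n x @[n --> \oo] --> f x) ->
  forall e, 0 < e -> \forall n \near \oo, forall t, `|f_ n t - f t| <= e.
Proof.
move=> cU eqf ff e e0; have /compact_near_coveringP := cU.
move=> /(_ _ \oo (fun n x => `|f_ n x - f x| <= e) _).
have cov : forall x, [set: U] x -> \forall x' \near x & n \near \oo, `|f_ n x' - f x'| <= e.
  move=> x _; have e3 : 0 < e / 3 by rewrite divr_gt0.
  have h1 := eqf x _ e3.
  have /cvgrPdist_le/(_ _ e3) h2 := ff x.
  exists ([set y | forall n, `|f_ n y - f_ n x| <= e / 3],
    [set n | `|f x - f_ n x| <= e / 3]) => //= -[y n] /= [hy hn].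
  have hl : `|f y - f x| <= e / 3.
    have c : `|f_ n y - f_ n x| @[n --> \oo] --> `|f y - f x|.
      by apply: cvg_norm; apply: cvgB; exact: ff.
    by apply: (cvgr_to_le c); apply: nearW => p; exact: hy.
  move: (hy n) hn hl; move: (f_ n y) (f_ n x) (f x) (f y) => a b c g.
  rewrite !ler_norml => /andP[? ?] /andP[? ?] /andP[? ?].
  by apply/andP; split; lra.
move=> /(_ cov); apply: filterS => n hn t; exact: hn.
Qed.

Lemma equicontinuous_limit (f_ : nat -> U -> R) (f : U -> R) :
  equicontinuous_seq f_ -> (forall x, f_ n x @[n --> \oo] --> f x) -> continuous f.
Proof.
move=> eqf ff x; apply/cvgrPdist_le => e e0.
apply: filterS (eqf x e e0) => y hy.
have c : `|f_ n x - f_ n y| @[n --> \oo] --> `|f x - f y|.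
  by apply: cvg_norm; apply: cvgB; exact: ff.
by apply: (cvgr_to_le c); apply: nearW => n; rewrite distrC; exact: hy.
Qed.

End uniform_convergence.

Section functionals.
Context (R : realType) (T : metricType R) (cT : compact [set: T]).
Local Notation C := (cspace R cT).

Lemma continuous_mdist (x : T) : continuous (mdist x : T -> R).
Proof.
move=> y; apply/cvgrPdist_lt => e e0; apply/nbhs_ballP; exists e => //= z.
move=> yz; have zy := ball_sym yz; rewrite !ballEmdist/= in yz zy.
have t1 := metric_triangle x y z; have t2 := metric_triangle x z y.
by rewrite ltr_norml; apply/andP; split; lra.
Qed.

Lemma cspace_sumE (I : Type) (r : seq I) (F : I -> C) t :
  (\sum_(i <- r) F i) t = \sum_(i <- r) F i t.
Proof.
elim: r => [|i r ih]; first by rewrite !big_nil cspace0E.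
by rewrite !big_cons cspaceDE ih.
Qed.

(* Evaluation at the nodes of a fine net followed by a partition of unity
   converges strongly to the identity of C(T). *)
Lemma interpolation (e : R) : 0 < e ->
  exists l : seq (T * C), forall (f : C) (M : R), 0 <= M ->
    (forall x y, ball x e y -> `|f x - f y| <= M) ->
    `|\sum_(p <- l) f p.1 *: p.2 - f| <= M.
Proof.
move=> e0; have [net netP] := compact_net cT e0.
(* Tent functions vanishing off the [e]-ball of their node, so that normalizing by [S] averages only
   values of [f] within distance [e] of [t]. *)
pose b (y t : T) : R := Num.max (e - mdist y t) 0.
have b0 y t : 0 <= b y t by rewrite le_max lexx orbT.
have cb y : continuous (b y).
  move=> t; apply: (@continuous_max R T (fun t => e - mdist y t) (fun=> 0)).
    by apply: cvgB; [exact: cvg_cst|exact: continuous_mdist].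
  exact: cvg_cst.
pose S t := \sum_(y <- net) b y t.
have S0 t : 0 < S t.
  have [y yn] := netP t; rewrite ballEmdist/= => yt.
  rewrite /S (perm_big _ (perm_to_rem yn))/= big_cons ltr_pwDl//.
    by rewrite /b lt_max subr_gt0 yt.
  by apply: sumr_ge0.
have cS : continuous S.
  move=> t; rewrite /S; elim: net {netP S S0} => [|y r ih].
    by under eq_fun do rewrite big_nil; rewrite ?big_nil; exact: cvg_cst.
  by under eq_fun do rewrite big_cons; rewrite ?big_cons; apply: cvgD => //; exact: cb.
have cphi y : continuous (fun t => b y t / S t).
  move=> t; apply: cvgM; first exact: cb.
  by apply: cvgV; [rewrite gt_eqF|exact: cS].
pose Phi y : C := mkcspace cT (cphi y).
exists [seq (y, Phi y) | y <- net] => f M M0 fM.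
apply: cnorm_le => // t.
rewrite cspaceBE big_map cspace_sumE.
have -> : \sum_(y <- net) (f y *: Phi y) t - f t = \sum_(y <- net) (f y - f t) * (b y t / S t).
  have -> : f t = \sum_(y <- net) f t * (b y t / S t).
    by rewrite -mulr_sumr -mulr_suml -/(S t) mulfV ?mulr1// gt_eqF.
  rewrite -sumrB; apply: eq_bigr => y _; rewrite cspaceZE mulrBl.
  by rewrite -mulr_sumr -mulr_suml -/(S t) mulfV ?mulr1// gt_eqF.
apply: (le_trans (ler_norm_sum _ _ _)).
apply: (@le_trans _ _ (\sum_(y <- net) M * (b y t / S t))).
  apply: ler_sum => y _; rewrite normrM [`|b y t / _|]ger0_norm ?divr_ge0 ?(ltW (S0 t))//.
  have [yt|yt] := ltP (mdist y t) e.
    rewrite ler_wpM2r ?divr_ge0 ?(ltW (S0 t))//; apply: fM.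
    by rewrite ballEmdist.
  have -> : b y t = 0 by rewrite /b max_r// subr_le0.
  by rewrite mul0r !mulr0.
by rewrite -mulr_sumr -mulr_suml -/(S t) mulfV ?mulr1// gt_eqF.
Qed.

(** Applying [x'] to the interpolants of mesh [n.+1%:R^-1] gives combinations of point evaluations,
    weighted by the values of [x'] on the partition of unity. *)
Lemma functional_approx (x' : {scalar C}) : continuous x' ->
  exists l : nat -> seq (R * T), forall f : C,
    \sum_(p <- l n) p.1 * f p.2 @[n --> \oo] --> x' f.
Proof.
move=> cx'.
have h n : exists l : seq (T * C), forall (f : C) (M : R), 0 <= M ->
    (forall x y, ball x (n.+1%:R^-1) y -> `|f x - f y| <= M) ->
    `|\sum_(p <- l) f p.1 *: p.2 - f| <= M.
  by apply: interpolation; rewrite invr_gt0.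
pose L n := sval (cid (h n)).
exists (fun n => [seq (x' p.2, p.1) | p <- L n]) => f.
have E n : \sum_(p <- [seq (x' p.2, p.1) | p <- L n]) p.1 * f p.2 =
    x' (\sum_(p <- L n) f p.1 *: p.2).
  rewrite big_map linear_sum; apply: eq_bigr => p _ /=.
  by rewrite linearZ/= mulrC.
under eq_fun do rewrite E.
apply: (@cvg_comp _ _ _ (fun n => \sum_(p <- L n) f p.1 *: p.2) x'); last exact: cx'.
apply/cvgrPdist_le => e e0; have [n0 fn0] := cspace_unif f e0.
exists n0 => // n /= n0n; rewrite distrC.
apply: (svalP (cid (h n))) => // [|x y xy]; first exact: ltW.
apply: fn0; apply: le_ball xy; rewrite lef_pV2 ?posrE// ler_nat ltnS//.
Qed.

End functionals.

(** * The Gaussian space of a process *)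

Section gaussian_cspace.
Context (R : realType) (T : metricType R) (cT : compact [set: T]).
Context d (O : measurableType d) (P : probability O R).
Context (G : set (O -> R)) (hG : gauss_space P G).
Local Notation C := (cspace R cT).

Lemma has_gauss_gaussian_real Z m s : has_gauss P Z m s -> gaussian_real P Z.
Proof. by move=> [_ s0 h]; exists m, s. Qed.

(** Passes from Gaussian marginals to Gaussian functionals: finite combinations of evaluations
    converge to [x'], and centred Gaussian laws survive the limit. *)
Lemma gs_functional (eta : O -> C) (x' : {scalar C}) : continuous x' ->
  (forall t, G (fun w => eta w t)) -> exists s, has_gauss P (fun w => x' (eta w)) 0 s.
Proof.
move=> cx' Geta; have [l lx'] := functional_approx cx'.
have Gl n : G (fun w => \sum_(p <- l n) p.1 * eta w p.2).
  by apply: (gs_sum hG (l n) (F := fun p w => p.1 * eta w p.2)) => p; exact: (gsZ hG).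
apply: (has_gauss_cvg (fun n => gs_has_gauss hG (Gl n))).
  apply: (@measurable_fun_cvg _ _ _ _ (fun n w => \sum_(p <- l n) p.1 * eta w p.2)) => [n|w _].
    exact: (gs_measurable hG (Gl n)).
  exact: lx'.
by apply: aeW => w; exact: lx'.
Qed.

Lemma cspace_gaussian_rv (Z : {RV P >-> borel C}) (a : C) :
  (forall t, G (fun w => (Z w : C) t - a t)) ->
  [/\ gaussian_rv Z, mean_fun P (fun t w => (Z w : C) t) = a &
    cov_fun P (fun t w => (Z w : C) t) =
      fun t1 t2 => ip P (fun w => (Z w : C) t1 - a t1) (fun w => (Z w : C) t2 - a t2)].
Proof.
move=> GZ.
have meanE t : fine 'E_P[fun w => (Z w : C) t] = a t.
  rewrite unlock -[fine _]/(\int[P]_w (Z w : C) t).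
  have [s h] := gs_gauss hG (GZ t); have := has_gauss_mean (has_gauss_shift (a t) h).
  by rewrite add0r => <-; apply: eq_Rintegral => w _; rewrite subrK.
split.
- move=> x' cx'.
  have [s h] := @gs_functional (fun w => (Z w : C) - a) x' cx' GZ.
  apply: (@has_gauss_gaussian_real _ (0 + x' a) s).
  rewrite (_ : _ \o _ = (fun w => x' ((Z w : C) - a) + x' a)); first exact: has_gauss_shift.
  by apply/funext => w /=; rewrite linearB/= subrK.
- by apply/funext => t; exact: meanE.
- apply/funext => t1; apply/funext => t2.
  rewrite /cov_fun unlock !meanE unlock /ip /Rintegral.
  by congr fine.
Qed.

End gaussian_cspace.

Section sequences.
Context (R : realType) (T : metricType R).

(** Lets sequential limit theorems for Gaussian laws yield neighbourhood statements: otherwise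
    counterexamples within [n.+1%:R^-1] of [t] would form a convergent sequence. *)
Lemma near_seq (t : T) (Q : T -> Prop) :
  (forall u : nat -> T, u n @[n --> \oo] --> t -> \forall n \near \oo, Q (u n)) ->
  \forall t' \near t, Q t'.
Proof.
move=> h; apply: contrapT => nQ.
have hn n : exists y, ball t (n.+1%:R^-1) y /\ ~ Q y.
  apply: contrapT => hy; apply: nQ; apply/nbhs_ballP; exists (n.+1%:R^-1) => /=.
    by rewrite invr_gt0.
  by move=> y ty; apply: contrapT => nQy; apply: hy; exists y.
pose u n := sval (cid (hn n)).
have ut : u n @[n --> \oo] --> t.
  apply/cvg_ballP => e e0.
  have [N _ hN] := near_infty_natSinv_lt (PosNum e0).
  exists N => // n /= Nn; have [un _] := svalP (cid (hn n)).
  by apply: le_ball un; exact: ltW (hN n Nn).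
have [N _ hN] := h _ ut.
by have [_] := svalP (cid (hn N)); apply; exact: (hN N (leqnn N)).
Qed.
End sequences.

Section gaussian_process.
Context (R : realType) (T : metricType R) (cT : compact [set: T]).
Context d (O : measurableType d) (P : probability O R) (X : T -> {RV P >-> R}).
Hypothesis gaussX : gaussian_process X.
Hypothesis contX : forall w, continuous (fun t => X t w).

Let m := mean_fun P (fun t => X t).
Definition centered (t : T) (w : O) : R := X t w - m t.
Definition process_span : set (O -> R) :=
  [set Z | exists l : seq (R * T), Z = fun w => \sum_(p <- l) p.1 * centered p.2 w].

Lemma process_has_gauss (l : seq (R * T)) :
  exists mu s, has_gauss P (fun w => \sum_(p <- l) p.1 * X p.2 w) mu s.
Proof.
have [mu [s [s0 h]]] := gaussX (fun i => (tnth (in_tuple l) i).2) (fun i => (tnth (in_tuple l) i).1).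
exists mu, s; split=> //.
  by apply: (@measurable_sum _ _ R setT _ l (fun p w => p.1 * X p.2 w)) => p; exact: measurable_funM.
move=> B mB; rewrite -h// /pushforward.
have -> // : (fun w => \sum_(p <- l) p.1 * X p.2 w) =
  (fun w => \sum_(i < size l) (tnth (in_tuple l) i).1 * X (tnth (in_tuple l) i).2 w).
by apply/funext => w; rewrite big_tnth.
Qed.

Lemma process_has_gauss1 t : exists mu s, has_gauss P (X t) mu s.
Proof.
have [mu [s h]] := process_has_gauss [:: (1, t)]; exists mu, s.
rewrite (_ : (X t : O -> R) = (fun w => \sum_(p <- [:: (1, t)]) p.1 * X p.2 w))//.
by apply/funext => w; rewrite big_seq1 mul1r.
Qed.

Lemma mean_process t : m t = \int[P]_w X t w.
Proof. by rewrite /m /mean_fun unlock. Qed.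

Lemma process_integrable t : P.-integrable setT (fun w => (X t w)%:E).
Proof. by have [mu [s h]] := process_has_gauss1 t; exact: has_gauss_integrable h. Qed.

Lemma Rintegral_process (l : seq (R * T)) :
  \int[P]_w (\sum_(p <- l) p.1 * X p.2 w) = \sum_(p <- l) p.1 * m p.2.
Proof.
elim: l => [|p l ih].
  rewrite big_nil; under eq_Rintegral do rewrite big_nil.
  by rewrite Rintegral_cst// mul0r.
rewrite big_cons -ih; under eq_Rintegral do rewrite big_cons.
rewrite RintegralD//=.
- by rewrite RintegralZl ?mean_process//; exact: process_integrable.
- have := integrableZl measurableT p.1 (process_integrable p.2).
  by under eq_fun do rewrite -EFinM.
- by have [mu [s h]] := process_has_gauss l; exact: has_gauss_integrable h.
Qed.

Lemma process_span_gauss_space : gauss_space P process_span.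
Proof.
split.
- move=> _ [l ->]; have [mu [s h]] := process_has_gauss l; exists s.
  have muE : mu = \sum_(p <- l) p.1 * m p.2.
    by rewrite -Rintegral_process (has_gauss_mean h).
  have := has_gauss_shift (- mu) h; rewrite subrr.
  rewrite (_ : (fun w => _ - mu) = (fun w => \sum_(p <- l) p.1 * centered p.2 w))//.
  apply/funext => w; rewrite muE -sumrB; apply: eq_bigr => p _.
  by rewrite /centered mulrBr.
- by exists [::]; apply/funext => w; rewrite big_nil.
- move=> _ _ [l1 ->] [l2 ->]; exists (l1 ++ l2); apply/funext => w.
  by rewrite big_cat.
- move=> c _ [l ->]; exists [seq (c * p.1, p.2) | p <- l]; apply/funext => w.
  by rewrite big_map mulr_sumr; apply: eq_bigr => p _; rewrite mulrA.
Qed.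

Lemma centered_span t : process_span (centered t).
Proof.
by exists [:: (1, t)]; apply/funext => w; rewrite big_seq1 mul1r.
Qed.

Lemma cov_process t1 t2 : cov_fun P (fun t => X t) t1 t2 = ip P (centered t1) (centered t2).
Proof.
by rewrite /cov_fun covariance.unlock expectation.unlock /ip /Rintegral /centered /m /mean_fun expectation.unlock.
Qed.

(** Path continuity is the only source of regularity: increments along [u] are Gaussian and vanish
    pointwise, so [has_gauss_cvg0] sends their means and deviations to 0. *)
Lemma process_increment (u : nat -> T) t : u n @[n --> \oo] --> t ->
  (m (u n) @[n --> \oo] --> m t) /\
  (ip P (fun w => centered (u n) w - centered t w)
     (fun w => centered (u n) w - centered t w) @[n --> \oo] --> (0 : R)).
Proof.
move=> ut.
have hD n : exists p : R * R, has_gauss P (fun w => X (u n) w - X t w) p.1 p.2.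
  have [mu [s h]] := process_has_gauss [:: (1, u n); (-1, t)]; exists (mu, s) => /=.
  rewrite (_ : (fun w => _) = (fun w => \sum_(p <- [:: (1, u n); (-1, t)]) p.1 * X p.2 w))//.
  by apply/funext => w; rewrite big_cons big_seq1 mul1r mulN1r.
pose q n := sval (cid (hD n)).
have qP n : has_gauss P (fun w => X (u n) w - X t w) (q n).1 (q n).2 by exact: svalP (cid (hD n)).
have D0 : {ae P, forall w, X (u n) w - X t w @[n --> \oo] --> (0 : R)}.
  apply: aeW => w; rewrite -[X in _ --> X](subrr (X t w)).
  apply: cvgB; last exact: cvg_cst.
  by apply: (@cvg_comp _ _ _ u (fun t => X t w)); [exact: ut|exact: contX].
have [m0 s0] := has_gauss_cvg0 qP D0.
have mE n : (q n).1 = m (u n) - m t.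
  rewrite -(has_gauss_mean (qP n)) RintegralB//; try exact: process_integrable.
  by rewrite !mean_process.
split.
  rewrite (_ : (fun n => m (u n)) = (fun n => (q n).1 + m t)); last first.
    by apply/funext => n; rewrite mE subrK.
  by rewrite -[X in _ --> X]add0r; apply: cvgD; [exact: m0|exact: cvg_cst].
have E n : ip P (fun w => centered (u n) w - centered t w)
     (fun w => centered (u n) w - centered t w) = (q n).2 * (q n).2 * gam2 R.
  have := has_gauss_shift (- (q n).1) (qP n); rewrite subrr => /ip_has_gauss <-.
  have -> : (fun w => X (u n) w - X t w - (q n).1) = (fun w => centered (u n) w - centered t w).
    by apply/funext => w; rewrite mE /centered; lra.
  by [].
rewrite (_ : (fun n => _) = (fun n => (q n).2 * (q n).2 * gam2 R)); last exact/funext.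
rewrite [X in _ --> X](_ : 0 = 0 * 0 * gam2 R); last by rewrite !mul0r.
by apply: cvgM; [apply: cvgM; exact: s0|exact: cvg_cst].
Qed.

Lemma continuous_mean_process : continuous m.
Proof.
move=> t; apply/cvgrPdist_le => e e0; apply: near_seq => u ut.
by have [/cvgrPdist_le/(_ e e0)] := process_increment ut.
Qed.

Lemma centered_continuous_sqnorm t e : 0 < e -> \forall t' \near t,
  ip P (fun w => centered t' w - centered t w) (fun w => centered t' w - centered t w) <= e.
Proof.
move=> e0; apply: near_seq => u ut.
have [_ /cvgrPdist_le/(_ e e0)] := process_increment ut; apply: filterS => n.
by rewrite sub0r normrN => h; exact: le_trans (ler_norm _) h.
Qed.

End gaussian_process.

(** * Equicontinuity of the covariance increments *)

Section kernel_convergence.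
Context (R : realType) (T : topologicalType) (cT : compact [set: T]).
Context d (O : measurableType d) (P : probability O R).
Context (G : set (O -> R)) (hG : gauss_space P G) (xi : T -> O -> R) (s : nat -> T).
Hypothesis Gxi : forall t, G (xi t).
Hypothesis cxi : forall t e, 0 < e -> \forall t' \near t,
  ip P (fun w => xi t' w - xi t w) (fun w => xi t' w - xi t w) <= e.

Lemma continuous_ip Z : G Z -> continuous (fun t => ip P (xi t) Z).
Proof.
move=> GZ t; apply/cvgrPdist_le => e e0.
(* The added 1 keeps the divisor positive when [Z] has norm 0. *)
pose K := Num.sqrt (ip P Z Z) + 1.
have K0 : 0 < K by rewrite ltr_wpDl// sqrtr_ge0.
have d0 : 0 < (e / K) ^+ 2 by rewrite exprn_gt0// divr_gt0.
apply: filterS (cxi t d0) => t' ht'.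
rewrite distrC -(ipBl hG)//.
apply: (le_trans (cauchy_schwarz_ip hG (gsB hG (Gxi t') (Gxi t)) GZ)).
apply: (@le_trans _ _ (e / K * K)); last by rewrite divfK ?gt_eqF.
apply: ler_pM; rewrite ?sqrtr_ge0//; last by rewrite lerDl.
rewrite -[leRHS]ger0_norm; last exact: ltW (divr_gt0 e0 K0).
by rewrite -sqrtr_sqr ler_wsqrtr.
Qed.

(** Projections are contractions, so continuity of [xi] in $L^2$ bounds the increments of the
    bilinear form independently of [n]. *)
Lemma equicontinuous_ip_proj :
  equicontinuous_seq (fun n (p : T * T) => ip P (gproj P xi s n p.1) (xi p.2)).
Proof.
move=> [x1 x2] e e0.
pose N t := Num.sqrt (ip P (xi t) (xi t)).
pose K := N x1 + N x2 + 1.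
have N0 t : 0 <= N t by exact: sqrtr_ge0.
have K0 : 0 < K by rewrite ltr_wpDl// addr_ge0.
(* The increment is bounded by $rN(x_2)+N(x_1)r+r^2$; since $r\le1$, this is at most $rK\le e$. *)
pose r := Num.min 1 (e / K).
have r0 : 0 < r by rewrite lt_min ltr01 divr_gt0.
have r20 : 0 < r ^+ 2 by rewrite exprn_gt0.
have h1 := cxi x1 r20; have h2 := cxi x2 r20.
exists ([set y | ip P (fun w => xi y w - xi x1 w) (fun w => xi y w - xi x1 w) <= r ^+ 2],
        [set y | ip P (fun w => xi y w - xi x2 w) (fun w => xi y w - xi x2 w) <= r ^+ 2]) => //=.
move=> [y1 y2] /= [hy1 hy2] n.
have le_r (a : R) : a <= r ^+ 2 -> Num.sqrt a <= r.
  by move=> ar; rewrite -[leRHS](ger0_norm (ltW r0)) -sqrtr_sqr ler_wsqrtr.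
pose p := gproj P xi s n.
have Gp t : G (p t) by exact: gs_proj.
have D1 : G (fun w => p y1 w - p x1 w) by exact: (gsB hG).
have D2 : G (fun w => xi y2 w - xi x2 w) by exact: (gsB hG).
have E : ip P (p y1) (xi y2) - ip P (p x1) (xi x2) =
    ip P (fun w => p y1 w - p x1 w) (xi x2) + ip P (p x1) (fun w => xi y2 w - xi x2 w) +
    ip P (fun w => p y1 w - p x1 w) (fun w => xi y2 w - xi x2 w).
  rewrite (ipBl hG (Gp y1) (Gp x1) (Gxi x2)) (ipBr hG (Gxi y2) (Gxi x2) (Gp x1)).
  rewrite (ipBl hG (Gp y1) (Gp x1) D2) (ipBr hG (Gxi y2) (Gxi x2) (Gp x1)).
  rewrite (ipBr hG (Gxi y2) (Gxi x2) (Gp y1)).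
  move: (ip P (p y1) (xi y2)) (ip P (p x1) (xi x2)) (ip P (p y1) (xi x2)) (ip P (p x1) (xi y2)) => a b c g.
  lra.
rewrite E.
have b1 : `|ip P (fun w => p y1 w - p x1 w) (xi x2)| <= r * N x2.
  apply: (le_trans (cauchy_schwarz_ip hG D1 (Gxi x2))).
  rewrite ler_wpM2r//; apply: le_r; apply: (le_trans _ hy1).
  exact: (ip_proj_contraction hG s Gxi).
have b2 : `|ip P (p x1) (fun w => xi y2 w - xi x2 w)| <= N x1 * r.
  apply: (le_trans (cauchy_schwarz_ip hG (Gp x1) D2)).
  apply: ler_pM; rewrite ?sqrtr_ge0//; last exact: le_r.
  rewrite ler_wsqrtr// (ip_proj_proj hG s Gxi _ _ (leqnn n)); exact: (ip_proj_le hG s Gxi).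
have b3 : `|ip P (fun w => p y1 w - p x1 w) (fun w => xi y2 w - xi x2 w)| <= r * r.
  apply: (le_trans (cauchy_schwarz_ip hG D1 D2)).
  apply: ler_pM; rewrite ?sqrtr_ge0//; last exact: le_r.
  by apply: le_r; apply: (le_trans _ hy1); exact: (ip_proj_contraction hG s Gxi).
apply: (le_trans (ler_normD _ _)).
apply: (le_trans (lerD (ler_normD _ _) (lexx _))).
apply: (le_trans (lerD (lerD b1 b2) b3)).
have r1 : r <= 1 by rewrite /r ge_min lexx.
have rK : r * K <= e by rewrite -ler_pdivlMr// /r ge_min lexx orbT.
apply: (le_trans _ rK); rewrite /K; nra.
Qed.

End kernel_convergence.

(** * Independence and disintegration *)

Section independence.
Context (R : realType) d (O : measurableType d) (P : probability O R).
Context (G : set (O -> R)) (hG : gauss_space P G).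
Context (I1 I2 : Type) d1 (E1 : measurableType d1) d2 (E2 : measurableType d2).
Context (ev1 : I1 -> E1 -> R) (ev2 : I2 -> E2 -> R).
Hypothesis mev1 : forall i, measurable_fun setT (ev1 i).
Hypothesis mev2 : forall i, measurable_fun setT (ev2 i).
Hypothesis cyl1 : forall A : set E1, measurable A -> <<s range (cylinder ev1)>> A.
Hypothesis cyl2 : forall A : set E2, measurable A -> <<s range (cylinder ev2)>> A.
Context (Y : O -> E1) (W : O -> E2) (a : I1 -> R).
Hypothesis mY : measurable_fun setT Y.
Hypothesis mW : measurable_fun setT W.
Hypothesis GY : forall i, G (fun x => ev1 i (Y x) - a i).
Hypothesis GW : forall i, G (fun x => ev2 i (W x)).
Hypothesis YW : forall i j, ip P (fun x => ev1 i (Y x) - a i) (fun x => ev2 j (W x)) = 0.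

Let I : Type := (I1 + I2)%type.
Let ev (i : I) (e : E1 * E2) : R :=
  match i with inl i => ev1 i e.1 | inr j => ev2 j e.2 end.

Let mev i : measurable_fun setT (ev i).
Proof.
by case: i => i /=; [apply: (measurableT_comp (mev1 i)); exact: measurable_fst|
  apply: (measurableT_comp (mev2 i)); exact: measurable_snd].
Qed.

Let cyl_prod (D : set (E1 * E2)) : measurable D -> <<s range (cylinder ev)>> D.
Proof.
have m1 : measurable_fun setT (fst : g_sigma_algebraType (range (cylinder ev)) ->
    g_sigma_algebraType (range (cylinder ev1))).
  by apply: measurable_to_cylinder => i; exact: (measurable_ev_cylinder (ev := ev) (inl i)).
have m2 : measurable_fun setT (snd : g_sigma_algebraType (range (cylinder ev)) ->
    g_sigma_algebraType (range (cylinder ev2))).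
  by apply: measurable_to_cylinder => i; exact: (measurable_ev_cylinder (ev := ev) (inr i)).
apply: smallest_sub; first exact: smallest_sigma_algebra.
move=> B [[A mA <-]|[A mA <-]].
  by apply: m1 => //; exact: cyl1.
by apply: m2 => //; exact: cyl2.
Qed.

(** [U], [V] and [c] split a linear form on pairs into the centred observed part, the residual part
    and a constant; [U] and [V] lie in [G]. *)
Let U (l : seq (R * I)) x : R :=
  \sum_(p <- l) p.1 * (if p.2 is inl i then ev1 i (Y x) - a i else 0).
Let V (l : seq (R * I)) x : R :=
  \sum_(p <- l) p.1 * (if p.2 is inr j then ev2 j (W x) else 0).
Let c (l : seq (R * I)) : R :=
  \sum_(p <- l) p.1 * (if p.2 is inl i then a i else 0).

Let lin_split l x y : lin ev l (Y x, W y) = U l x + V l y + c l.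
Proof.
rewrite /lin /U /V /c -!big_split/=; apply: eq_bigr => -[r [i|j]] _ /=.
  by rewrite mulr0 addr0 -mulrDr subrK.
by rewrite !mulr0 add0r addr0.
Qed.

Let GUi (p : R * I) : G (fun x => p.1 * (if p.2 is inl i then ev1 i (Y x) - a i else 0)).
Proof. by apply: (gsZ hG); case: p => _ [i|j] /=; [exact: GY|exact: (gs0 hG)]. Qed.

Let GVi (p : R * I) : G (fun x => p.1 * (if p.2 is inr j then ev2 j (W x) else 0)).
Proof. by apply: (gsZ hG); case: p => _ [i|j] /=; [exact: (gs0 hG)|exact: GW]. Qed.

Let GU l : G (U l). Proof. exact: (gs_sum hG l GUi). Qed.
Let GV l : G (V l). Proof. exact: (gs_sum hG l GVi). Qed.

Let UV0 l : ip P (U l) (V l) = 0.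
Proof.
rewrite (ip_suml hG l GUi (GV l)) big1// => -[r [i|j]] _ /=.
  rewrite (ipZl hG _ (GY i) (GV l)) ipC (ip_suml hG l GVi (GY i)) big1 ?mulr0//.
  move=> -[r' [i'|j']] _ /=; first by rewrite (ipZl hG _ (gs0 hG) (GY i)) ip0l mulr0.
  by rewrite (ipZl hG _ (GW j') (GY i)) ipC YW mulr0.
by rewrite (ipZl hG _ (gs0 hG) (GV l)) ip0l mulr0.
Qed.

(** By orthogonality the variance of [U l + V l] is the sum of the two variances, which is also what
    independent copies on the product space give. Equal cosine integrals then identify the joint
    laws. *)
Lemma independent_of_orthogonal (D : set (E1 * E2)) : measurable D ->
  P ((fun x => (Y x, W x)) @^-1` D) =
  (P \x P)%E ((fun z => (Y z.1, W z.2)) @^-1` D).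
Proof.
move=> mD.
have mF1 : measurable_fun setT (fun x => (Y x, W x)) by exact: measurable_fun_pair.
have mF2 : measurable_fun setT (fun z : O * O => (Y z.1, W z.2)).
  apply: measurable_fun_pair; first exact: (measurableT_comp mY measurable_fst).
  exact: (measurableT_comp mW measurable_snd).
apply: (@cos_uniqueness R I _ _ ev mev _ O P _ _ (O * O)%type (P \x P)%E _ mF1 mF2 _ D mD (cyl_prod mD)).
move=> l b.
have h1 := gs_has_gauss hG (GU l); have h2 := gs_has_gauss hG (GV l).
have h12 := has_gauss_add_indep h1 h2.
have h := gs_has_gauss hG (gsD hG (GU l) (GV l)).
have E : ip P (fun x => U l x + V l x) (fun x => U l x + V l x) / gam2 R =
    Num.sqrt (ip P (U l) (U l) / gam2 R) ^+ 2 + Num.sqrt (ip P (V l) (V l) / gam2 R) ^+ 2.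
  rewrite !sqr_sqrtr ?divr_ge0 ?ip_ge0 ?(ltW (gam2_gt0 _))// -mulrDl; congr (_ / _).
  have GUV := gsD hG (GU l) (GV l).
  rewrite (ipDl hG (GU l) (GV l) GUV) (ipC P (U l) (fun x => U l x + V l x)) (ipC P (V l) (fun x => U l x + V l x)).
  rewrite (ipDl hG (GU l) (GV l) (GU l)) (ipDl hG (GU l) (GV l) (GV l)).
  by rewrite (ipC P (V l) (U l)) UV0 addr0 add0r.
rewrite -E in h12.
have mc : measurable_fun setT (fun y : R => cos (y + (c l + b)) : R).
  by apply: (measurableT_comp (@measurable_cos R)); exact: measurable_funD.
have same B : measurable B -> P ((fun x => U l x + V l x) @^-1` B) =
    (P \x P)%E ((fun z : O * O => U l z.1 + V l z.2) @^-1` B).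
  by case: h => _ _ h; case: h12 => _ _ h12 mB; rewrite h// h12.
have [mUV _ _] := h; have [mUV2 _ _] := h12.
have ic : (P \x P)%E.-integrable setT
    (fun z : O * O => (cos (U l z.1 + V l z.2 + (c l + b)))%:E).
  apply: (@bounded_integrable _ _ _ (P \x P)%E (fun z : O * O => cos (U l z.1 + V l z.2 + (c l + b))) 1).
    exact: (measurableT_comp mc mUV2).
  by move=> x; rewrite ler_norml cos_geN1 cos_le1.
under eq_Rintegral do rewrite lin_split -addrA.
under [RHS]eq_Rintegral do rewrite lin_split -addrA.
exact: (Rintegral_same_law mUV mUV2 same mc ic).
Qed.

End independence.

Section subset_metric.
Context (R : realType) (T : metricType R) (S : set T).
(** Makes the subset a metric space, so that the results on $C(T)$ apply verbatim to $C(S)$. *)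
Let dist (x y : S) : R := mdist (set_val x) (set_val y).

Let dist_ge0 x y : 0 <= dist x y. Proof. exact: mdist_ge0. Qed.

Let dist_positivity x y : dist x y = 0 -> x = y.
Proof. by move=> xy; apply: val_inj; exact: mdist_positivity xy. Qed.

Let dist_ball (x : S) (d : R) : ball x d = [set y | dist x y < d].
Proof. by rewrite -[LHS]/(set_val @^-1` (ball (set_val x) d)) ballEmdist. Qed.

HB.instance Definition _ := @PseudoMetric_isMetric.Build R S dist
  dist_ge0 dist_positivity dist_ball.

End subset_metric.

Section cspace_cylinder.
Context (R : realType) (T : metricType R) (cT : compact [set: T]).
Local Notation C := (cspace R cT).

Lemma measurable_eval (t : T) : measurable_fun setT ((fun f => (f : C) t) : borel C -> R).
Proof.
apply: (@measurability _ _ (borel C) _ setT (fun f : C => f t) _ (RGenOpens.measurableE R)).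
move=> _ [_ [a [b ->] <-]]; rewrite setTI; apply: sub_sigma_algebra.
have ct : continuous (fun f : C => f t).
  move=> f; apply/(@cvgrPdist_le _ _ _ (nbhs f)) => e e0.
  have /cvgrPdist_le/(_ e e0) : id x @[x --> f] --> f by exact: cvg_id.
  by apply: filterS => g; apply: le_trans; exact: (le_cnorm (f - g) t).
by move/continuousP : ct; apply; exact: interval_open.
Qed.

Lemma borel_cspace_cylinder (A : set (borel C)) : measurable A ->
  <<s range (cylinder (fun (t : T) (f : C) => f t)) >> A.
Proof.
move=> mA.
have := @measurable_cspace R T cT _ (g_sigma_algebraType (range (cylinder (fun (t : T) (f : C) => f t)))) id.
move=> /(_ (measurable_ev_cylinder (ev := fun (t : T) (f : C) => f t)) measurableT A mA).
by rewrite setTI.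
Qed.

(** The finite nets of all radii are enumerated through [pickle]; each net uses finitely many codes,
    whence [L], and [t0] fills the codes left over. *)
Lemma dense_sequence (t0 : T) : exists D : nat -> T, forall j, exists L, forall t,
  exists2 l, (l < L)%N & ball (D l) (j.+1%:R^-1) t.
Proof.
have net n : {x : seq T | forall t, exists2 x0, x0 \in x & ball x0 (n.+1%:R^-1 : R) t}.
  by apply: cid; apply: (compact_net cT); rewrite invr_gt0.
pose D q := if unpickle q is Some (n, i) then nth t0 (sval (net n)) i else t0.
exists D => j; exists (\max_(i < size (sval (net j))) pickle (j, nat_of_ord i)).+1 => t.
have [x xj xt] := svalP (net j) t.
have ix : (index x (sval (net j)) < size (sval (net j)))%N by rewrite index_mem.
exists (pickle (j, index x (sval (net j)))).
  exact: (leq_bigmax (Ordinal ix)).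
by rewrite /D pickleK nth_index.
Qed.

End cspace_cylinder.

(** * Disintegration along an independent residual *)

Section disintegration.
Context (R : realType) d (O : measurableType d) (P : probability O R).
Context d1 (E1 : measurableType d1) d2 (E2 : measurableType d2) d3 (E : measurableType d3).
Context (Y : {RV P >-> E1}) (W : O -> E2) (Phi : E1 * E2 -> E).
Hypothesis mW : measurable_fun setT W.
Hypothesis mPhi : measurable_fun setT Phi.
Hypothesis indep : forall D, measurable D ->
  P ((fun x => (Y x, W x)) @^-1` D) = (P \x P)%E ((fun z => (Y z.1, W z.2)) @^-1` D).

(** The candidate kernel: the observation is frozen at [g], the residual stays random. *)
Let law (g : E1) (B : set E) : \bar R := P ((fun w => Phi (g, W w)) @^-1` B).

Let measurable_law B : measurable B -> measurable_fun setT (law ^~ B).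
Proof.
move=> mB; pose A := (fun z : E1 * O => Phi (z.1, W z.2)) @^-1` B.
have mA : measurable A.
  rewrite -[A]setTI; apply: (measurableT_comp mPhi) => //.
  apply: measurable_fun_pair; first exact: measurable_fst.
  exact: (measurableT_comp mW measurable_snd).
have := measurable_fun_xsection P mA.
by rewrite (_ : _ \o _ = law ^~ B)//; apply/funext => g /=; rewrite xsectionE.
Qed.

Let integral_law A B : measurable A -> measurable B ->
  P ((fun w => Phi (Y w, W w)) @^-1` B `&` Y @^-1` A) =
  (\int[distribution P Y]_(g in A) law g B)%E.
Proof.
move=> mA mB; have mL := measurable_law mB.
pose D := Phi @^-1` B `&` fst @^-1` A.
have mD : measurable D.
  by apply: measurableI; rewrite -[X in measurable X]setTI; [exact: mPhi|exact: measurable_fst].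
rewrite -[X in P X]/((fun x => (Y x, W x)) @^-1` D) indep//.
rewrite integral_mkcond ge0_integral_distribution.
- apply: eq_integral => x _ /=; rewrite patchE /law; case: ifPn => [/set_mem|/negP] YA.
    by congr (P _); apply/seteqP; split=> [w|w h]; rewrite /xsection /= in_setE; [by case|by split].
  rewrite -[RHS](measure0 P); congr (P _); apply/seteqP; split=> w //.
  by rewrite /xsection /= in_setE => -[_ /mem_set].
- by apply/(measurable_restrictT _ mA); exact: measurable_funTS.
- by move=> g; rewrite patchE; case: ifP => // _; exact: measure_ge0.
Qed.

(** By independence and Fubini, [K ^~ B] and the candidate have the same integral over every
    measurable set of observations. *)
Lemma regular_cond_prob_ae (X : {RV P >-> E}) (K : R.-pker E1 ~> E) B :
  (X : O -> E) = (fun w => Phi (Y w, W w)) -> is_regular_cond_prob X Y K ->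
  measurable B ->
  {ae distribution P Y, forall g, K g B = P ((fun w => Phi (g, W w)) @^-1` B)}.
Proof.
move=> XE rK mB.
have [|||N [mN N0 hN]] := @integral_ae_eq _ _ _ (distribution P Y) setT measurableT (law ^~ B) (K ^~ B).
- apply: (@le_integrable _ _ _ _ setT measurableT _ (fun=> 1%:E)).
  + exact: measurable_kernel.
  + move=> g _; rewrite abse1 gee0_abs ?measure_ge0//.
    rewrite -(@prob_kernel _ _ _ _ _ K g); apply: le_measure; rewrite ?inE//.
  + exact: finite_measure_integrable_cst.
- exact: measurable_law.
- by move=> A _ mA; rewrite -integral_law// -rK// XE.
by exists N; split=> // g /= h; apply: hN => /= h'; apply: h; exact: h'.
Qed.

(** The null set of [regular_cond_prob_ae] depends on [B]; a countable generating family closed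
    under intersection reduces all of them to one. *)
Lemma regular_cond_prob_unique (J : countType) (C : J -> set E)
    (X : {RV P >-> E}) (K : R.-pker E1 ~> E) :
  (forall j, measurable (C j)) -> setI_closed (range C) -> range C setT ->
  (forall B, measurable B -> <<s range C >> B) ->
  (X : O -> E) = (fun w => Phi (Y w, W w)) -> is_regular_cond_prob X Y K ->
  {ae distribution P Y, forall g B, measurable B ->
     K g B = P ((fun w => Phi (g, W w)) @^-1` B)}.
Proof.
move=> mC CI CT genC XE rK.
have h : {ae distribution P Y, forall g n, if unpickle n is Some j then
    K g (C j) = P ((fun w => Phi (g, W w)) @^-1` (C j)) else True}.
  apply: ae_foralln => n; case: (unpickle n) => [j|]; last exact: aeW.
  exact: (regular_cond_prob_ae XE rK (mC j)).
apply: filterS h => g hg B mB.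
have mZ : measurable_fun setT (fun w => Phi (g, W w)).
  by apply: (measurableT_comp mPhi); exact: measurable_fun_pair.
pose Z : {mfun O >-> E} := HB.pack (fun w => Phi (g, W w)) (isMeasurableFun.Build _ _ _ _ _ mZ).
rewrite -[RHS]/(distribution P Z B).
apply: (g_sigma_algebra_measure_unique (range C) _ (fun=> setT)) => //.
- by move=> _ [j _ <-].
- by rewrite bigcup_const//; exists 0%N.
- by move=> _ [j _ <-]; have := hg (pickle j); rewrite pickleK.
- by move=> _; rewrite [X in (X < _)%E](@prob_kernel _ _ _ _ _ K g) ltry.
- exact: genC.
Qed.

End disintegration.

(** * Conditioning *)

Section uniform_cauchy.
Context (R : realType) (T : metricType R) (D : nat -> T).
Hypothesis denseD : forall j t, exists l, ball (D l) (j.+1%:R^-1) t.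

(** Countably many times and tolerances make this a measurable condition on the data
    ([measurable_good_set]); density of [D] and continuity extend it to all of [T]. *)
Definition uniform_cauchy_on (u : nat -> T -> R) := forall k : nat, exists N,
  forall n i, `|u (N + n)%N (D i) - u N (D i)| <= k.+1%:R^-1.

Lemma dense_le (f : T -> R) c t : continuous f -> (forall i, f (D i) <= c) -> f t <= c.
Proof.
move=> cf fD; apply/ler_addgt0Pr => e e0.
have /cvgrPdist_le/(_ e e0)/nbhs_ballP[r /= r0 hr] := cf t.
have [N _ hN] := near_infty_natSinv_lt (PosNum r0).
have [l lt] := denseD N t.
have := hr (D l) (le_ball (ltW (hN N (leqnn N))) (ball_sym lt)).
have := fD l; rewrite ler_norml => h /andP[_ h']; lra.
Qed.

Section limit.
Context (u : nat -> T -> R) (cu : forall n, continuous (u n)) (uc : uniform_cauchy_on u).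

Lemma uniform_cauchy_all k : exists N, forall n t, `|u (N + n)%N t - u N t| <= k.+1%:R^-1.
Proof.
have [N hN] := uc k; exists N => n t.
apply: (@dense_le (fun t => `|u (N + n)%N t - u N t|)) => // x.
apply: cvg_norm; apply: cvgB; exact: cu.
Qed.

Lemma uniform_cauchy_is_cvg t : cvgn (u ^~ t).
Proof.
apply/cauchy_cvgP/cauchy_exP => e e0.
have [k _ hk] := near_infty_natSinv_lt (PosNum e0).
have [N hN] := uniform_cauchy_all k; exists (u N t); exists N => // n /= Nn.
have := hN (n - N)%N t; rewrite subnKC// distrC => h.
exact: le_lt_trans h (hk k (leqnn k)).
Qed.

Lemma uniform_cauchy_uniform e : 0 < e ->
  \forall n \near \oo, forall t, `|u n t - lim (u n t @[n --> \oo])| <= e.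
Proof.
move=> e0; have [k _ hk] := near_infty_natSinv_lt (PosNum (divr_gt0 e0 (ltr0Sn R 1))).
have [N hN] := uniform_cauchy_all k; exists N => // n /= Nn t.
have hn m : (N <= m)%N -> `|u m t - u N t| <= e / 2.
  move=> Nm; have := hN (m - N)%N t; rewrite subnKC// => h.
  exact: le_trans h (ltW (hk k (leqnn k))).
have c : `|u n t - u m t| @[m --> \oo] --> `|u n t - lim (u n t @[n --> \oo])|.
  by apply: cvg_norm; apply: cvgB; [exact: cvg_cst|exact: uniform_cauchy_is_cvg].
apply: (cvgr_to_le c); exists N => // m /= Nm.
move: (hn n Nn) (hn m Nm); move: (u n t) (u m t) (u N t) => x y z.
rewrite !ler_norml => /andP[? ?] /andP[? ?]; apply/andP; split; lra.
Qed.

Lemma uniform_cauchy_limit_continuous : continuous (fun t => lim (u n t @[n --> \oo])).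
Proof.
move=> t; apply/cvgrPdist_le => e e0; have e3 : 0 < e / 3 by rewrite divr_gt0.
have [N _ /(_ N (leqnn N)) /= hN] := uniform_cauchy_uniform e3.
have /cvgrPdist_le/(_ _ e3) := @cu N t; apply: filterS => x.
move: (hN t) (hN x); rewrite !ler_norml.
move: (lim _) (lim _) (u N t) (u N x) => a b c g.
move=> /andP[? ?] /andP[? ?] /andP[? ?]; apply/andP; split; lra.
Qed.

End limit.

Section good_set.
Context (cT : compact [set: T]) d (E : measurableType d) (u : E -> nat -> T -> R).
Hypothesis cu : forall g n, continuous (u g n).
Hypothesis mu : forall n t, measurable_fun setT (fun g => u g n t).

Definition good_set : set E := [set g | uniform_cauchy_on (u g)].

Lemma measurable_good_set : measurable good_set.
Proof.
rewrite (_ : good_set = \bigcap_k \bigcup_N \bigcap_n \bigcap_i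
    ~` [set g | (k.+1%:R^-1 < `|u g (N + n)%N (D i) - u g N (D i)|)%R]).
  apply: bigcapT_measurable => k; apply: bigcupT_measurable => N.
  apply: bigcapT_measurable => n; apply: bigcapT_measurable => i.
  by apply: measurableC; apply: measurable_gt_norm; exact: measurable_funB.
apply/seteqP; split=> [g hg k _|g hg k].
  by have [N hN] := hg k; exists N => // n _ i _ /=; apply/negP; rewrite -leNgt.
by have [N _ hN] := hg k I; exists N => n i; have /negP := hN n I i I; rewrite -leNgt.
Qed.

(** The default 0 off the good set makes this a measurable map into $C(T)$ defined on all of [E]. *)
Definition uniform_limit (g : E) : cspace R cT :=
  match pselect (good_set g) with
  | left h => mkcspace cT (uniform_cauchy_limit_continuous (@cu g) h)
  | right _ => 0
  end.

Lemma uniform_limitE g t : uniform_limit g t =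
  \1_good_set g * lim (u g n t @[n --> \oo]).
Proof.
rewrite /uniform_limit; case: pselect => h /=.
  by rewrite indicE mem_set// mul1r.
by rewrite indicE memNset// mul0r.
Qed.

Lemma cvg_uniform_limit g t :
  \1_good_set g * u g n t @[n --> \oo] --> uniform_limit g t.
Proof.
rewrite uniform_limitE indicE; have [h|h] := boolP (g \in good_set).
  rewrite /= mul1r; under eq_fun do rewrite mul1r.
  by apply: (uniform_cauchy_is_cvg (@cu g)); exact: set_mem h.
by rewrite /= mul0r; under eq_fun do rewrite mul0r; exact: cvg_cst.
Qed.

Lemma measurable_uniform_limit :
  measurable_fun setT (uniform_limit : E -> borel (cspace R cT)).
Proof.
apply: measurable_cspace => t.
apply: (@measurable_fun_cvg _ _ _ _ (fun n g => \1_good_set g * u g n t)) => [n|g _].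
  by apply: measurable_funM => //; exact/measurable_indic/measurable_good_set.
exact: cvg_uniform_limit.
Qed.

End good_set.
End uniform_cauchy.

Section topology.
Context (R : realType).

Lemma dense_eq0 (S : topologicalType) (A : set S) (f : S -> R) :
  dense A -> continuous f -> (forall x, A x -> f x = 0) -> forall x, f x = 0.
Proof.
move=> dA cf f0 x; apply: contrapT => fx.
have [||y [/= fy Ay]] := dA (f @^-1` (~` [set 0])).
- by exists x.
- by move/continuousP : cf; apply; rewrite openC; exact: closed_eq.
- exact: fy (f0 y Ay).
Qed.

Lemma ae_distribution d (O : measurableType d) (P : probability O R)
    d' (E : measurableType d') (Y : {RV P >-> E}) (A : set E) : measurable A ->
  {ae P, forall w, A (Y w)} -> {ae distribution P Y, forall g, A g}.
Proof.
move=> mA [N [mN N0 hN]]; exists (~` A); split; [exact: measurableC| |by []].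
have mYA : measurable (Y @^-1` (~` A)).
  by rewrite -[X in measurable X]setTI; apply: measurable_funPT => //; exact: measurableC.
apply/eqP; rewrite -measure_le0; apply: (@le_trans _ _ (P N)); last by rewrite N0.
exact: (le_measure P (mem_set mYA) (mem_set mN) hN).
Qed.

(** Evaluation at any [t] is a limit of evaluations along [D]; with countably many times the
    generating cylinders are countable. *)
Lemma cspace_dense_cylinder (T : metricType R) (cT : compact [set: T]) (D : nat -> T) :
  (forall j t, exists l, ball (D l) (j.+1%:R^-1) t) ->
  forall A : set (borel (cspace R cT)), measurable A ->
  <<s range (cylinder (fun i (f : cspace R cT) => f (D i))) >> A.
Proof.
move=> denseD A mA.
pose ev i (f : cspace R cT) := f (D i).
suff mev t : measurable_fun setT ((fun f => (f : cspace R cT) t) :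
    g_sigma_algebraType (range (cylinder ev)) -> R).
  have := @measurable_cspace R T cT _ (g_sigma_algebraType (range (cylinder ev))) id.
  by move=> /(_ mev measurableT A mA); rewrite setTI.
pose i n := sval (cid (denseD n t)).
have it n : ball (D (i n)) (n.+1%:R^-1) t by exact: svalP (cid (denseD n t)).
have Dt : D (i n) @[n --> \oo] --> t.
  apply/cvg_ballP => e e0; have [N _ hN] := near_infty_natSinv_lt (PosNum e0).
  exists N => // n /= Nn; apply: ball_sym; apply: le_ball (it n); exact: ltW (hN n Nn).
apply: (@measurable_fun_cvg _ _ _ _ (fun n (f : g_sigma_algebraType (range (cylinder ev))) =>
    (f : cspace R cT) (D (i n)))) => [n|f _].
  exact: (measurable_ev_cylinder (ev := ev) (i n)).
exact: (@cvg_comp _ _ _ (fun n => D (i n)) (f : T -> R) _ _ _ Dt (@cspace_continuous R T cT f t)).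
Qed.

End topology.

(** * The conditional law of the path given its restriction *)

Section conditioning.
Context (R : realType) d (O : measurableType d) (P : probability O R).
Context (T : metricType R) (cT : compact [set: T]) (X : T -> {RV P >-> R}).
Hypothesis gaussX : gaussian_process X.
Hypothesis contX : forall w, continuous (fun t => X t w).
Context (S : set T) (clS : closed S) (s : nat -> S).
Hypothesis dense_s : dense (range s).

Local Notation CT := (cspace R cT).
Local Notation CS := (cspace R (closed_compact_set_type cT clS)).
Let m := mean_fun P (fun t => X t).
Let k := cov_fun P (fun t => X t).
Let XX : {RV P >-> borel CT} := process_rv cT contX.
Let Y : {RV P >-> borel CS} := restriction_rv clS XX.
Let xi := centered X.
Let sT n : T := \val (s n).
Let G := gauss_closure P (process_span X).

Let hG0 : gauss_space P (process_span X). Proof. exact: process_span_gauss_space. Qed.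
Let hG : gauss_space P G. Proof. exact: gauss_closure_space. Qed.
Let G0xi t : process_span X (xi t). Proof. exact: centered_span. Qed.
Let Gxi t : G (xi t). Proof. by apply: (sub_gauss_closure hG0); exact: G0xi. Qed.
Let M n t : O -> R := gproj P xi sT n t.
Let G0M n t : process_span X (M n t). Proof. exact: (gs_proj hG0). Qed.
Let GM n t : G (M n t). Proof. exact: (gs_proj hG). Qed.

Let cxi t e : 0 < e -> \forall t' \near t,
  ip P (fun w => xi t' w - xi t w) (fun w => xi t' w - xi t w) <= e.
Proof. exact: centered_continuous_sqnorm. Qed.

Lemma cov_kern : k = kern P xi.
Proof. by apply/funext => t1; apply/funext => t2; exact: cov_process. Qed.

Lemma mean_incrE g n t :
  mean_incr s m k g n t = \sum_(i < n) weight sT k n t 0 i * (g (s i) - m (sT i)).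
Proof. by rewrite /mean_incr mxE; apply: eq_bigr => i _; rewrite !mxE. Qed.

(** The bridge between formula and process: on an observed path the expression in [g] is the
    projection, so almost sure facts about projections become facts about almost every [g]. *)
Lemma mean_incr_path w n t : mean_incr s m k (Y w : CS) n t = M n t w.
Proof. by rewrite mean_incrE cov_kern; apply: eq_bigr => i _. Qed.

Lemma cov_incrE n t1 t2 : cov_incr s k n (t1, t2) = ip P (M n t1) (xi t2).
Proof. by rewrite -(cov_incr_proj hG sT Gxi) -cov_kern. Qed.

Lemma continuous_weight n (i : 'I_n) : continuous (fun t => weight sT k n t 0 i).
Proof.
rewrite cov_kern (_ : (fun t => _) = (fun t => \sum_(j < n) kern P xi t (sT j) *
    moore_penrose (kmx (kern P xi) (fun i : 'I_n => sT i) (fun i : 'I_n => sT i)) j i)).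
  apply: continuous_big => [|j _ t]; first exact: add_continuous.
  by apply: cvgM; [exact: (continuous_ip hG Gxi cxi)|exact: cvg_cst].
by apply/funext => t; rewrite mxE; apply: eq_bigr => j _; rewrite !mxE.
Qed.

Lemma continuous_mean_incr (g : CS) n : continuous (mean_incr s m k g n).
Proof.
rewrite (_ : mean_incr _ _ _ _ _ = (fun t => \sum_(i < n) weight sT k n t 0 i * (g (s i) - m (sT i)))).
  apply: continuous_big => [|j _ t]; first exact: add_continuous.
  by apply: cvgM; [exact: continuous_weight|exact: cvg_cst].
by apply/funext => t; exact: mean_incrE.
Qed.

Lemma measurable_mean_incr n t :
  measurable_fun setT (fun g : borel CS => mean_incr s m k (g : CS) n t).
Proof.
under eq_fun do rewrite mean_incrE.
apply: (@measurable_sum _ _ R setT _ (index_enum 'I_n)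
  (fun (i : 'I_n) (g : borel CS) => weight sT k n t 0 i * ((g : CS) (s i) - m (sT i)))) => i.
apply: measurable_funM => //; apply: measurable_funB => //; exact: measurable_eval.
Qed.

Lemma cvg_cov_incr t : cov_incr s k n t @[n --> \oo] --> lim_cov_incr s k t.
Proof.
case: t => t1 t2; rewrite /lim_cov_incr; under eq_fun do rewrite cov_incrE.
exact: (is_cvg_ip_proj hG Gxi).
Qed.

Lemma equicontinuous_cov_incr : equicontinuous_seq (cov_incr s k).
Proof.
rewrite (_ : cov_incr s k = (fun n (p : T * T) => ip P (gproj P xi sT n p.1) (xi p.2))).
  exact: (equicontinuous_ip_proj hG sT Gxi cxi).
by apply/funext => n; apply/funext => -[t1 t2]; exact: cov_incrE.
Qed.

Lemma uniform_cov_incr : {uniform, (cov_incr s k n @[n --> \oo]) --> lim_cov_incr s k}.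
Proof.
apply: uniform_cvgP; apply: equicontinuous_uniform.
- by rewrite -setXTT; exact: compact_setX.
- exact: equicontinuous_cov_incr.
- exact: cvg_cov_incr.
Qed.

(** Once [n] exceeds [i], the projection reproduces the node and the increments are constant. *)
Lemma cond_cov_node i t : cond_cov s k (sT i) t = 0.
Proof.
have c := @cvg_cov_incr (sT i, t).
suff h : lim_cov_incr s k (sT i, t) = k (sT i) t by rewrite /cond_cov h subrr.
apply: (cvg_unique _ c) => //.
apply: cvg_near_cst; exists i.+1 => // n /= ni.
by rewrite cov_incrE (ip_projC hG sT Gxi) ipC (ip_proj_node hG sT Gxi _ ni) cov_kern /kern ipC.
Qed.

Lemma cond_cov_node_all (x : S) t : cond_cov s k (\val x) t = 0.
Proof.
move: x; apply: (dense_eq0 dense_s) => [|_ [i _ <-]]; last exact: cond_cov_node.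
move=> x; have cval : {for x, continuous (set_val : S -> T)} by exact: initial_continuous.
have ck : continuous (fun t' => k t' t) by rewrite cov_kern; exact: (continuous_ip hG Gxi cxi).
have c1 : {for x, continuous (fun y : S => k (\val y) t)}.
  by apply: (@continuous_comp _ _ _ (set_val : S -> T) (fun t' => k t' t)) => //; exact: ck.
have c2 : {for x, continuous (fun y : S => lim_cov_incr s k (\val y, t))}.
  apply: (@continuous_comp _ _ _ (fun x : S => (set_val x, t)) (lim_cov_incr s k)).
    apply: (@cvg_pair S T T (nbhs x) (nbhs (set_val x)) (nbhs t) _ _ _ set_val (fun=> t)).
      exact: cval.
    exact: cvg_cst.
  exact: equicontinuous_limit equicontinuous_cov_incr cvg_cov_incr _.
exact: (cvgB c1 c2).
Qed.

Let u (g : borel CS) : nat -> T -> R := mean_incr s m k (g : CS).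
Let cu g n : continuous (u g n). Proof. exact: continuous_mean_incr. Qed.

Section dense_net.
Context (D : nat -> T).
Hypothesis netD : forall j, exists L, forall t,
  exists2 l, (l < L)%N & ball (D l) (j.+1%:R^-1 : R) t.

Let denseD j t : exists l, ball (D l) (j.+1%:R^-1 : R) t.
Proof. by have [L /(_ t)[l _ lt]] := netD j; exists l. Qed.

Let mC : CT := mkcspace cT (continuous_mean_process gaussX contX).
Let limit_mean (g : borel CS) : CT := uniform_limit denseD cT cu g.
Let W w : CT := (XX w : CT) - mC - limit_mean (Y w).

Lemma ae_good : {ae distribution P Y, forall g, good_set D u g}.
Proof.
apply: ae_distribution.
  exact: (@measurable_good_set R T D _ (borel CS) u measurable_mean_incr).
have h := @ae_uniform_cauchy_proj R d O P G hG T xi sT Gxi D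
  (fun j l i => ball (D l) (j.+1%:R^-1 : R) (D i)).
apply: filterS (h _ _ _) => [w hw j|j j' i i' jj'|w e e0|j].
- have [N hN] := hw j; exists N => n i.
  by rewrite /u !mean_incr_path; exact: hN.
- by apply: le_ball; rewrite lef_pV2 ?posrE// ler_nat.
- have [n hn] := cspace_unif ((XX w : CT) - mC) e0; exists n => i i'.
  exact: hn.
- have [L hL] := netD j; exists L => i; have [l lL li] := hL (D i); by exists l.
Qed.

(** With a singular Gram matrix only data in its range are interpolated; observed values are such
    data almost surely, by [proj_node_ae]. *)
Lemma ae_interpolation : {ae distribution P Y, forall g n i, (i < n)%N ->
  u g n (sT i) = (g : CS) (s i) - m (sT i)}.
Proof.
apply: ae_foralln => n; apply: ae_foralln => i.
apply: (@ae_distribution R _ _ P _ _ Y [set g : borel CS | (i < n)%N ->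
  u g n (sT i) = (g : CS) (s i) - m (sT i)]).
  have [ni|ni] := ltnP i n; last by rewrite (_ : [set _ | _] = setT)//; apply/seteqP; split.
  have mf : measurable_fun setT (fun g : borel CS => u g n (sT i) - ((g : CS) (s i) - m (sT i))).
    apply: measurable_funB; first exact: measurable_mean_incr.
    by apply: measurable_funB => //; exact: measurable_eval.
  rewrite (_ : [set _ | _] = setT `&` (fun g : borel CS => u g n (sT i) - ((g : CS) (s i) - m (sT i))) @^-1` [set 0]).
    by apply: mf => //; exact: measurable_set1.
  rewrite setTI; apply/seteqP; split=> g /=; first by move=> /(_ isT) ->; rewrite subrr.
  by move=> /eqP; rewrite subr_eq0 => /eqP.
have [ni|ni] := ltnP i n; last by apply: aeW => w /=.
apply: filterS (proj_node_ae hG sT Gxi ni) => w hw _.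
by rewrite /u mean_incr_path; exact: hw.
Qed.

Lemma limit_mean_good g t : good_set D u g -> limit_mean g t = lim_mean_incr s m k (g : CS) t.
Proof. by move=> h; rewrite /limit_mean uniform_limitE indicE mem_set// mul1r. Qed.

Lemma measurable_limit_mean : measurable_fun setT (limit_mean : borel CS -> borel CT).
Proof. by apply: measurable_uniform_limit => n t; exact: measurable_mean_incr. Qed.

Lemma measurable_limit_mean_eval t : measurable_fun setT (fun g => limit_mean g t).
Proof. exact: (measurableT_comp (measurable_eval t) measurable_limit_mean). Qed.

Lemma ae_good_path : {ae P, forall w, good_set D u (Y w)}.
Proof.
have [N [mN N0 hN]] := ae_good; exists (Y @^-1` N); split => //.
  by rewrite -[X in measurable X]setTI; exact: measurable_funPT.
by move=> w /= h; apply: hN.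
Qed.

Let cvg_M t : {ae P, forall w, M n t w @[n --> \oo] --> limit_mean (Y w) t}.
Proof.
apply: filterS ae_good_path => w hw; rewrite limit_mean_good// /lim_mean_incr.
under eq_fun do rewrite -mean_incr_path.
exact: (uniform_cauchy_is_cvg denseD (@cu (Y w)) hw).
Qed.

Let Glimit_mean t : G (fun w => limit_mean (Y w) t).
Proof.
split; first exact: (measurableT_comp (measurable_limit_mean_eval t) (measurable_funPT Y)).
by exists (fun n => M n t).
Qed.

Let WE w t : W w t = xi t w - limit_mean (Y w) t. Proof. by []. Qed.

Let GW t : G (fun w => W w t).
Proof. by under eq_fun do rewrite WE; exact: (gsB hG). Qed.

Let measurable_W : measurable_fun setT (W : O -> borel CT).
Proof. by apply: measurable_cspace => t; exact: (gs_measurable hG (GW t)). Qed.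

Lemma residual_node i t : ip P (xi (sT i)) (fun w => W w t) = 0.
Proof.
under [X in ip P _ X]eq_fun do rewrite WE.
rewrite (ipBr hG (Gxi t) (Glimit_mean t) (Gxi (sT i))).
have c := gs_cvg_ipl hG (fun n => GM n t) (Glimit_mean t) (Gxi (sT i)) (cvg_M t).
suff -> : ip P (xi (sT i)) (fun w => limit_mean (Y w) t) = ip P (xi (sT i)) (xi t) by rewrite subrr.
rewrite ipC; apply: (cvg_unique _ c) => //.
apply: cvg_near_cst; exists i.+1 => // n /= ni.
by rewrite (ip_proj_node hG sT Gxi _ ni) /kern ipC.
Qed.

Lemma residual_orthogonal (x : S) t : ip P (xi (\val x)) (fun w => W w t) = 0.
Proof.
move: x; apply: (dense_eq0 dense_s) => [x|_ [i _ <-]]; last exact: residual_node.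
apply: (@continuous_comp _ _ _ (set_val : S -> T) (fun t' => ip P (xi t') (fun w => W w t))).
  exact: initial_continuous.
exact: (continuous_ip hG Gxi cxi (GW t)).
Qed.

(** The limit mean is a limit of combinations of nodes, hence orthogonal to the residual; there
    remains [xi t1] against [W t2], where the covariance increments appear. *)
Lemma residual_cov t1 t2 : ip P (fun w => W w t1) (fun w => W w t2) = cond_cov s k t1 t2.
Proof.
under [X in ip P X _]eq_fun do rewrite WE.
rewrite (ipBl hG (Gxi t1) (Glimit_mean t1) (GW t2)).
have -> : ip P (fun w => limit_mean (Y w) t1) (fun w => W w t2) = 0.
  have c := gs_cvg_ipl hG (fun n => GM n t1) (Glimit_mean t1) (GW t2) (cvg_M t1).
  apply: (cvg_unique _ c) => //; apply: cvg_near_cst; apply: nearW => n.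
  rewrite /M /gproj (ip_suml hG _ (F := fun i w => weight sT (kern P xi) n t1 0 i * xi (sT i) w)) => [|i|].
  - apply: big1 => i _; rewrite (ipZl hG _ (Gxi (sT i)) (GW t2)).
    by rewrite residual_node mulr0.
  - exact: (gsZ hG).
  - exact: GW.
rewrite subr0; under [X in ip P _ X]eq_fun do rewrite WE.
rewrite (ipBr hG (Gxi t2) (Glimit_mean t2) (Gxi t1)) /cond_cov; congr (_ - _).
  by rewrite cov_kern.
have c := gs_cvg_ipl hG (fun n => GM n t2) (Glimit_mean t2) (Gxi t1) (cvg_M t2).
rewrite ipC; apply: (cvg_unique _ c) => //.
have := @cvg_cov_incr (t1, t2); rewrite (_ : (fun n => cov_incr s k n (t1, t2)) = (fun n => ip P (M n t2) (xi t1)))//.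
by apply/funext => n; rewrite cov_incrE (ip_projC hG sT Gxi) ipC.
Qed.

Let Phi (z : borel CS * borel CT) : borel CT := mC + limit_mean z.1 + (z.2 : CT).

Let measurable_Phi : measurable_fun setT Phi.
Proof.
apply: measurable_cspace => t.
apply: (@measurable_funD _ _ _ _ (fun z : borel CS * borel CT => mC t + limit_mean z.1 t)
  (fun z => (z.2 : CT) t)).
  apply: measurable_funD => //.
  exact: (measurableT_comp (measurable_limit_mean_eval t) measurable_fst).
exact: (measurableT_comp (measurable_eval t) measurable_snd).
Qed.

Let path_decomposition : (XX : O -> borel CT) = (fun w => Phi (Y w, W w)).
Proof. by apply/funext => w; apply: cspaceP => t; rewrite /Phi /W !cspaceDE !cspaceNE; lra. Qed.

Lemma law_given_restriction (K : R.-pker borel CS ~> borel CT) :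
  is_regular_cond_prob XX Y K ->
  {ae distribution P Y, forall g B, measurable B ->
     K g B = P ((fun w => Phi (g, W w)) @^-1` B)}.
Proof.
move=> rK; have indep := independent_of_orthogonal hG
  (ev1 := fun (x : S) (f : borel CS) => (f : CS) x)
  (ev2 := fun (t : T) (f : borel CT) => (f : CT) t)
  (fun x => measurable_eval x) (fun t => measurable_eval t)
  (fun A mA => borel_cspace_cylinder mA) (fun A mA => borel_cspace_cylinder mA)
  (measurable_funPT Y) measurable_W (a := fun x => m (\val x))
  (fun x => Gxi (\val x)) GW residual_orthogonal.
apply: (regular_cond_prob_unique measurable_W measurable_Phi indep
  (C := cylinder (fun i (f : borel CT) => (f : CT) (D i))) _ _ _ _ path_decomposition rK).
- by move=> l; apply: measurable_cylinder => i; exact: measurable_eval.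
- exact: cylinder_setI_closed.
- by exists [::] => //; apply/seteqP; split.
- exact: cspace_dense_cylinder.
Qed.

Lemma gaussian_law_given (g : borel CS) (mu : set (borel CT) -> \bar R) :
  good_set D u g ->
  (forall B, measurable B -> mu B = P ((fun w => Phi (g, W w)) @^-1` B)) ->
  is_gaussian_law mu (cond_mean s m k (g : CS)) (cond_cov s k).
Proof.
move=> hg hmu.
have mZ : measurable_fun setT (fun w => Phi (g, W w)).
  by apply: (measurableT_comp measurable_Phi); exact: measurable_fun_pair.
pose Z : {mfun O >-> borel CT} := HB.pack (fun w => Phi (g, W w)) (isMeasurableFun.Build _ _ _ _ _ mZ).
have ZW t : (fun w => (Z w : CT) t - (mC + limit_mean g : CT) t) = (fun w => W w t).
  by apply/funext => w; rewrite /Z /= /Phi cspaceDE addrC addKr.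
have GZ t : G (fun w => (Z w : CT) t - (mC + limit_mean g : CT) t) by rewrite ZW; exact: GW.
exists d, O, P, Z; have [Zg ZE ZV] := cspace_gaussian_rv hG GZ; split => //.
- rewrite ZE; apply/funext => t; rewrite cspaceDE limit_mean_good//.
- by rewrite ZV; apply/funext => t1; apply/funext => t2; rewrite !ZW residual_cov.
Qed.

(** At a node the increments are eventually constant; density extends the identity to [S], both
    sides being continuous for a good [g]. *)
Lemma cond_mean_interpolates (g : borel CS) :
  good_set D u g ->
  (forall n i, (i < n)%N -> u g n (sT i) = (g : CS) (s i) - m (sT i)) ->
  forall x : S, cond_mean s m k (g : CS) (\val x) = (g : CS) x.
Proof.
move=> hg ig x; apply/eqP; rewrite -subr_eq0; apply/eqP; move: x.
apply: (dense_eq0 dense_s) => [x|_ [i _ <-]].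
  have cm : continuous (cond_mean s m k (g : CS)).
    rewrite (_ : cond_mean _ _ _ _ = (mC + limit_mean g : CT)); first exact: cspace_continuous.
    by apply/funext => t; rewrite cspaceDE limit_mean_good.
  have c1 : {for x, continuous (fun y : S => cond_mean s m k (g : CS) (\val y))}.
    apply: (@continuous_comp _ _ _ (set_val : S -> T)); last exact: cm.
    exact: initial_continuous.
  exact: (cvgB c1 (@cspace_continuous R _ _ (g : CS) x)).
have c := uniform_cauchy_is_cvg denseD (@cu g) hg (t := sT i).
suff h : lim_mean_incr s m k (g : CS) (sT i) = (g : CS) (s i) - m (sT i).
  by rewrite /cond_mean -/(sT i) h [X in X - _]addrC subrK subrr.
apply: (cvg_unique _ c) => //; apply: cvg_near_cst; exists i.+1 => // n /= ni.
exact: ig.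
Qed.

End dense_net.
End conditioning.

Theorem theorem5p3 (R : realType)
    (d : measure_display) (Omega : measurableType d) (P : probability Omega R)
    (T : metricType R) (cT : compact [set: T])
    (Xt : T -> {RV P >-> R})
    (gaussX : gaussian_process Xt)
    (contX : forall w : Omega, continuous (fun t : T => Xt t w))
    (S : set T) (clS : closed S)
    (Soo : set S) (cntS : countable Soo) (denS : dense Soo)
    (s : nat -> S) (enumS : range s = Soo)
    (PXY : R.-pker borel (cspace R (closed_compact_set_type cT clS))
                   ~> borel (cspace R cT)) :
  let m := mean_fun P (fun t => Xt t) in
  let k := cov_fun P (fun t => Xt t) in
  let X : {RV P >-> borel (cspace R cT)} := process_rv cT contX in
  let Y : {RV P >-> borel (cspace R (closed_compact_set_type cT clS))} :=
    restriction_rv clS X in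
  is_regular_cond_prob X Y PXY ->
  exists N : set (borel (cspace R (closed_compact_set_type cT clS))),
    [/\ measurable N,
        distribution P Y N = 0%E,
        {uniform, (cov_incr s k n @[n --> \oo]) --> lim_cov_incr s k} &
        forall g : cspace R (closed_compact_set_type cT clS), ~ N g ->
        [/\ is_gaussian_law (PXY g) (cond_mean s m k g) (cond_cov s k),
            {uniform, (mean_incr s m k g n @[n --> \oo]) -->
               lim_mean_incr s m k g},
            forall x : S, cond_mean s m k g (\val x) = g x &
            forall (x : S) (t : T), cond_cov s k (\val x) t = 0]].
Proof.
move=> m k X Y rK; rewrite -enumS in denS.
have [D netD] := dense_sequence cT (\val (s 0%N)).
have denseD j t : exists l, ball (D l) (j.+1%:R^-1 : R) t.
  by have [L /(_ t)[l _ lt]] := netD j; exists l.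
(* [N] covers three failures at once: of uniform convergence, of interpolation at the nodes, and of
   agreement with the explicit kernel. *)
have [N [mN N0 hN]] := filterI (ae_good cT gaussX contX clS s netD)
  (filterI (ae_interpolation cT gaussX contX clS s)
     (law_given_restriction gaussX denS netD rK)).
exists N; split => //; first exact: (uniform_cov_incr cT gaussX contX).
move=> g Ng; have [hg [ig lawg]] := contrapT (fun h => Ng (hN g h)).
split.
- exact: (gaussian_law_given hg lawg).
- apply: uniform_cvgP => e e0.
  by apply: (uniform_cauchy_uniform denseD _ hg e0) => n; exact: continuous_mean_incr.
- exact: (cond_mean_interpolates gaussX contX denS netD hg ig).
- exact: (cond_cov_node_all gaussX contX denS).
Qed.
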